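(* For integers $N\ge1$ let $$\Sigma_N=\sum_{j=0}^{N-1}\Bigl(?\bigl(\tfrac{j+1}{N}\bigr)-?\bigl(\tfrac jN\bigr)\Bigr)^2,$$ where $?$ is the Minkowski question mark function, and for real $t$ let $\mathfrak m(it)=\int_0^1e^{ixt}\,\mathrm d?(x)$. For $s\ge0$ let $\mathcal K_s$ be the operator on $C([0,1])$ given by $$(\mathcal K_sg)(x)=\sum_{a\ge1}4^{-a}(a+x)^{2s}\,g\Bigl(\frac1{a+x}\Bigr),$$ and let $P(s)=\log r(\mathcal K_s)$, where $r(\mathcal K_s)$ is the spectral radius of $\mathcal K_s$ on $C([0,1])$. Then the limit $$D_2=-\lim_{N\to\infty}\frac{\log\Sigma_N}{\log N}$$ exists, $P$ has exactly one zero in $(0,1)$, and $D_2$ equals this zero. Moreover, $\Sigma_N\asymp N^{-D_2}$ (for integers $N\ge1$), and $$\int_{-T}^{T}|\mathfrak m(it)|^2\,\mathrm dt\asymp T^{1-D_2}\qquad\text{for } T\ge1.$$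
   Context: The Minkowski question mark function $?:[0,1]\to[0,1]$ is the continuous increasing function defined by $?(0)=0$ and, using the continued fraction $x=[0,a_1,a_2,\ldots]=\cfrac{1}{a_1+\cfrac{1}{a_2+\cdots}}$ with $a_j\in\mathbb N=\{1,2,\ldots\}$, by $$?([0,a_1,a_2,\ldots])=2\sum_{j\ge1}(-1)^{j+1}2^{-(a_1+\cdots+a_j)}$$ (for rational $x$ the continued fraction and the sum are finite). The integral $\int\cdot\,\mathrm d?(x)$ is the integral against the Borel probability measure on $[0,1]$ with distribution function $?$. The number $D_2$ is called the correlation dimension of this measure. The space $C([0,1])$ carries the supremum norm. The notation $A\asymp B$ means that there are constants $0<c\le C$, independent of the variable ($N$ or $T$), with $cB\le A\le CB$. *)

(* Defs.v *)
From HB Require Import structures.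
From mathcomp Require Import all_boot all_order all_algebra.
From mathcomp Require Import complex.
From mathcomp Require Import all_classical all_reals all_analysis.
From mathcomp Require Import ring lra.

Set Implicit Arguments.
Unset Strict Implicit.
Unset Printing Implicit Defensive.

Import numFieldNormedType.Exports.
Import Order.TTheory GRing.Theory Num.Theory.

Local Open Scope classical_set_scope.
Local Open Scope ring_scope.

Section minkowski_question_mark.
Context {R : realType}.
Implicit Types x y u v : R.

(* Since 0^-1 = 0, the point 0 is fixed by gauss and has Num.truncn 0^-1 = 0.  *)
Definition gauss x : R := x^-1 - (Num.truncn x^-1)%:R.

(* cf_digit x j is the partial quotient a_(j+1) of x = [0, a_1, a_2, ...] in   *)
(* [0, 1], and 0 if the continued fraction of x has at most j quotients.       *)
Definition cf_digit x (j : nat) : nat := Num.truncn (iter j gauss x)^-1.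

Definition minkq_term x (j : nat) : R :=
  if cf_digit x j == 0%N then 0
  else (-1) ^+ j / 2 ^+ (\sum_(i < j.+1) cf_digit x i)%N.

Definition minkq x : R := 2 * limn (series (minkq_term x)).

Let q x : R := limn (series (minkq_term x)).

Let a x : nat := Num.truncn x^-1.

Lemma gauss01 x : 0 <= x -> 0 <= gauss x < 1.
Proof.
move=> x0; have /truncn_itv : 0 <= x^-1 by rewrite invr_ge0.
by rewrite /gauss -natr1 => /andP[? ?]; lra.
Qed.

Lemma cf_digitS x j : cf_digit x j.+1 = cf_digit (gauss x) j.
Proof. by rewrite /cf_digit iterSr. Qed.

Lemma minkq_termS x j :
  minkq_term x j.+1 = - (2 ^- cf_digit x 0) * minkq_term (gauss x) j.
Proof.
rewrite /minkq_term cf_digitS; case: ifP => _; first by rewrite mulr0.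
rewrite big_ord_recl exprD exprS.
under eq_bigr do rewrite cf_digitS.
by rewrite invfM; ring.
Qed.

Lemma cf_digit_gt0 x : 0 < x <= 1 -> (0 < cf_digit x 0)%N.
Proof.
by move=> /andP[x0 x1]; rewrite /cf_digit/= truncn_gt0 -invr1 lef_pV2 ?posrE.
Qed.

Lemma cf_digit0 j : cf_digit 0 j = 0%N.
Proof.
rewrite /cf_digit; suff -> : iter j gauss 0 = 0 by rewrite invr0 truncn0.
by elim: j => //= j ->; rewrite /gauss invr0 truncn0 subr0.
Qed.

Lemma minkq_term0 : minkq_term 0 = cst 0.
Proof. by apply/funext => j; rewrite /minkq_term cf_digit0 eqxx. Qed.

Lemma ge0_case x : 0 <= x <= 1 -> x = 0 \/ 0 < x <= 1.
Proof.
move=> /andP[]; rewrite le_eqVlt => /predU1P[<-|x0 x1]; first by left.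
by right; rewrite x0.
Qed.

Lemma half_pow n : (0 < n)%N -> 0 < (2 ^- n : R) <= 2^-1.
Proof.
case: n => // n _; rewrite invr_gt0 exprn_gt0//= exprS invfM ler_piMr//.
by rewrite invf_le1 ?exprn_ege1 ?exprn_gt0// ler1n.
Qed.

Lemma minkq_term_le j x : 0 <= x <= 1 -> `|minkq_term x j| <= 2^-1 * 2^-1 ^+ j.
Proof.
have p0 k : 0 <= 2^-1 * 2^-1 ^+ k :> R by rewrite mulr_ge0 ?exprn_ge0.
elim: j x => [|j ih] x /ge0_case[->|x01]; rewrite ?minkq_term0 ?normr0//.
  have d0 := cf_digit_gt0 x01; have /andP[h0 h1] := half_pow d0.
  rewrite /minkq_term gtn_eqF// big_ord1 expr0 mul1r mulr1.
  by rewrite ger0_norm// ltW.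
have /andP[h0 h1] := half_pow (cf_digit_gt0 x01).
rewrite minkq_termS normrM normrN (gtr0_norm h0) exprS.
apply: ler_pM => //.
have x0 : 0 <= x by lra.
by apply: ih; have /andP[g0 g1] := gauss01 x0; rewrite g0 ltW.
Qed.

Lemma cvg_minkq x : 0 <= x <= 1 -> cvgn (series (minkq_term x)).
Proof.
move=> x01; apply: normed_cvg.
apply: (@series_le_cvg _ _ (geometric 2^-1 2^-1)) => [n|n|n|].
- exact: normr_ge0.
- by rewrite /geometric/= mulr_ge0 ?exprn_ge0.
- exact: minkq_term_le.
- by apply: is_cvg_geometric_series; rewrite ger0_norm// invf_lt1// ltr1n.
Qed.

Lemma q0 : q 0 = 0.
Proof.
rewrite /q minkq_term0 (_ : series _ = cst 0) ?lim_cst//.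
by apply/funext => n; rewrite /series/= big1.
Qed.

Lemma q_rec x : 0 < x <= 1 -> q x = 2 ^- a x * (1 - q (gauss x)).
Proof.
move=> x01; have x0 : 0 <= x by move: x01 => /andP[/ltW].
have /andP[g0 g1] := gauss01 x0.
have cg : cvgn (series (minkq_term (gauss x))).
  by apply: cvg_minkq; rewrite g0 ltW.
apply: cvg_lim => //; rewrite -(cvg_shiftS (series _)).
have -> : (fun n => series (minkq_term x) n.+1) =
    (fun n => 2 ^- a x * (1 - series (minkq_term (gauss x)) n)).
  apply/funext => n; rewrite /series/= big_nat_recl//.
  under eq_bigr do rewrite minkq_termS.
  rewrite -mulr_sumr /minkq_term gtn_eqF ?cf_digit_gt0// big_ord1.
  by rewrite -/(a x) {1 2}/cf_digit/= -/(a x); ring.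
by apply: cvgMl_tmp; apply: cvgB => //; exact: cvg_cst.
Qed.

Lemma minkq0 : minkq 0 = 0.
Proof. by rewrite /minkq -/(q 0) q0 mulr0. Qed.

Lemma minkq_rec x : 0 < x <= 1 ->
  minkq x = 2 ^- cf_digit x 0 * (2 - minkq (gauss x)).
Proof. by move=> x01; rewrite {1}/minkq -/(q x) q_rec// /minkq -/(q _); ring. Qed.

Lemma minkq1 : minkq 1 = 1.
Proof.
rewrite minkq_rec ?ltr01 ?lexx// /cf_digit/= /gauss invr1 truncn1 subrr minkq0.
by rewrite subr0 expr1 mulVf.
Qed.

Lemma minkq01 x : 0 <= x <= 1 -> 0 <= minkq x <= 1.
Proof.
suff main n y : 0 <= y <= 1 ->
    0 <= series (minkq_term y) n <= 2^-1.
  move=> x01; have cx := cvg_minkq x01.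
  have : 0 <= q x <= 2^-1.
    apply/andP; split.
      by apply: limr_ge => //; near=> n; have /andP[] := main n _ x01.
    by apply: limr_le => //; near=> n; have /andP[] := main n _ x01.
  by rewrite /minkq -/(q x) => ?; lra.
elim: n y => [|n ih] y; first by rewrite /series/= big_geq//; lra.
move=> /[dup] y01 /ge0_case[->|y0].
  by rewrite minkq_term0 /series/= big1// lexx/=; lra.
have /andP[g0 /ltW g1] : 0 <= gauss y < 1 by apply: gauss01; case/andP: y01.
have /andP[s0 s1] := ih (gauss y) (introT andP (conj g0 g1)).
have /andP[h0 h1] := half_pow (cf_digit_gt0 y0).
rewrite /series/= big_nat_recl//.
under eq_bigr do rewrite minkq_termS.
rewrite -mulr_sumr /minkq_term gtn_eqF ?cf_digit_gt0// big_ord1 expr0 mul1r.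
move: s0 s1 h0 h1; rewrite /series/=.
by move: (2 ^- _) (\sum_(_ <= _ < _) _) => h s s0 s1 h0 h1; nra.
Unshelve. all: by end_near. Qed.


Lemma le0_pow2 u : (forall n, u <= 2^-1 ^+ n) -> u <= 0.
Proof.
move=> ule; have h : (fun n => 2^-1 ^+ n : R) @ \oo --> (0 : R).
  by apply: cvg_expr; rewrite ger0_norm ?invf_lt1 ?ltr1n.
rewrite -(cvg_lim _ h)//; apply: limr_ge; first by apply/cvg_ex; exists 0.
by near=> n; exact: ule.
Unshelve. all: by end_near. Qed.

Lemma minkq_le x y : 0 <= x -> x <= y -> y <= 1 -> minkq x <= minkq y.
Proof.
move=> x0 xy y1; rewrite -subr_le0; apply: le0_pow2 => n.
elim: n x y x0 xy y1 => [|n ih] x y x0 xy y1.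
  have /andP[? ?] : 0 <= minkq x <= 1 by apply: minkq01; lra.
  have /andP[? ?] : 0 <= minkq y <= 1 by apply: minkq01; lra.
  by rewrite expr0; lra.
have y01 : 0 <= y <= 1 by lra.
have := x0; rewrite le_eqVlt => /predU1P[<-|x_gt0].
  have /andP[? ?] := minkq01 y01.
  by rewrite minkq0 (@le_trans _ _ 0) ?exprn_ge0//; lra.
have x01 : 0 < x <= 1 by lra.
have y01' : 0 < y <= 1 by lra.
have ixy : y^-1 <= x^-1 by rewrite lef_pV2 ?posrE//; lra.
have /andP[gx0 gx1] := gauss01 x0.
have y0 : 0 <= y by lra.
have /andP[gy0 gy1] := gauss01 y0.
have /andP[mx0 mx1] : 0 <= minkq (gauss x) <= 1 by apply: minkq01; lra.
have /andP[my0 my1] : 0 <= minkq (gauss y) <= 1 by apply: minkq01; lra.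
have dyx : (cf_digit y 0 <= cf_digit x 0)%N by rewrite /cf_digit/= le_truncn.
rewrite (minkq_rec x01) (minkq_rec y01').
have [dd|] := eqVneq (cf_digit y 0) (cf_digit x 0).
  have gyx : gauss y <= gauss x.
    by move: dd; rewrite /gauss /cf_digit/= => ->; lra.
  have := ih _ _ gy0 gyx (ltW gx1).
  have /andP[h0 h1] := half_pow (cf_digit_gt0 x01).
  have p0 : 0 <= 2^-1 ^+ n :> R by rewrite exprn_ge0.
  rewrite dd exprS; move: (2 ^- _) (2^-1 ^+ n) h0 h1 p0 => h p h0 h1 p0 k.
  by nra.
move=> dneq; have {dneq dyx} dlt : (cf_digit y 0 < cf_digit x 0)%N.
  by rewrite ltn_neqAle dneq.
have e : 2 * 2 ^- cf_digit x 0 <= 2 ^- cf_digit y 0 :> R.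
  rewrite -(subnKC dlt) exprD exprS !invfM !mulrA mulfV ?mul1r//.
  by rewrite ler_piMr ?invr_ge0 ?exprn_ge0// invf_le1 ?exprn_ege1 ?exprn_gt0 ?ler1n.
have /andP[hx0 _] := half_pow (cf_digit_gt0 x01).
have /andP[hy0 _] := half_pow (cf_digit_gt0 y01').
apply: (@le_trans _ _ 0); last by rewrite exprn_ge0.
move: (2 ^- cf_digit x 0) (2 ^- cf_digit y 0) e hx0 hy0 => hx hy e hx0 hy0.
by nra.
Qed.

Lemma minkq_contract x : 0 <= x <= 1 -> minkq (x / (1 + x)) = minkq x / 2.
Proof.
move=> /ge0_case[->|x01]; first by rewrite mul0r minkq0 mul0r.
have x0 : x != 0 by apply/eqP; lra.
have x10 : 1 + x != 0 by apply/eqP; lra.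
have ix : (x / (1 + x))^-1 = x^-1 + 1 by field; rewrite x0.
have xi0 : 0 <= x^-1 by rewrite invr_ge0; lra.
have t : Num.truncn (x^-1 + 1) = (Num.truncn x^-1).+1.
  by rewrite addrC truncnD ?nnegrE ?truncn1 ?add1n ?rpred1.
have y01 : 0 < x / (1 + x) <= 1.
  by rewrite divr_gt0 ?ler_pdivrMr; lra.
rewrite (minkq_rec y01) (minkq_rec x01) /cf_digit/= /gauss ix t exprS invfM -[(Num.truncn x^-1).+1%:R]natr1.
by rewrite opprD addrACA subrr addr0; ring.
Qed.

Lemma minkq_flip u : 0 <= u <= 1 -> minkq (1 + u)^-1 = 1 - minkq u / 2.
Proof.
move=> /andP[u0 u1].
have y01 : 0 < (1 + u)^-1 <= 1.
  by rewrite invr_gt0 invf_le1; lra.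
move: u1; rewrite le_eqVlt => /predU1P[->|u1].
  rewrite minkq1 minkq_rec ?invr_gt0 ?invf_le1//; last by lra.
  rewrite /cf_digit/= /gauss invrK (_ : 1 + 1 = 2%:R)// natrK subrr minkq0.
  by field.
have t : Num.truncn (1 + u) = 1%N by apply: truncn_def; lra.
by rewrite minkq_rec// /cf_digit/= /gauss invrK t (addrC 1) addrK expr1; field.
Qed.

Lemma minkq_dense n v : 0 <= v <= 1 ->
  exists2 x, 0 <= x <= 1 & `|minkq x - v| <= 2^-1 ^+ n.
Proof.
elim: n v => [|n ih] v v01.
  by exists 0; [lra|rewrite minkq0 expr0 sub0r normrN ger0_norm; lra].
have [v2|v2] := leP v 2^-1.
  have [x x01 xv] : exists2 x, 0 <= x <= 1 & `|minkq x - 2 * v| <= 2^-1 ^+ n.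
    by apply: ih; lra.
  exists (x / (1 + x)).
    by rewrite divr_ge0 ?ler_pdivrMr; lra.
  rewrite minkq_contract// exprS.
  by move: xv; rewrite !ler_norml => /andP[? ?]; apply/andP; split; lra.
have [x x01 xv] : exists2 x, 0 <= x <= 1 & `|minkq x - (2 - 2 * v)| <= 2^-1 ^+ n.
  by apply: ih; lra.
exists (1 + x)^-1.
  by rewrite invr_ge0 invf_le1; lra.
rewrite minkq_flip// exprS.
by move: xv; rewrite !ler_norml => /andP[? ?]; apply/andP; split; lra.
Qed.

Definition minkq_cdf x : R := minkq (Num.max 0 (Num.min x 1)).

Let clamp01 x : 0 <= Num.max 0 (Num.min x 1) <= 1.
Proof. by rewrite le_max lexx/= ge_max ge_min lexx orbT ler01. Qed.

Lemma minkq_cdf_nondecreasing : nondecreasing minkq_cdf.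
Proof.
move=> x y xy; have /andP[x0 _] := clamp01 x; have /andP[_ y1] := clamp01 y.
apply: minkq_le => //; rewrite !maxEle !minEle.
by do ?case: ifPn; rewrite -?ltNge => *; lra.
Qed.

Lemma minkq_cdf_right_continuous : right_continuous minkq_cdf.
Proof.
move=> x.
suff main e : 0 < e -> exists2 y, x < y & minkq_cdf y < minkq_cdf x + e.
  apply/cvgrPdist_lt => e /main[y xy ye]; near=> t.
  have xt : x <= t by near: t; apply: nbhs_right_ge.
  have ty : t <= y by near: t; apply: nbhs_right_le.
  have := minkq_cdf_nondecreasing xt; have := minkq_cdf_nondecreasing ty.
  by rewrite ltr_norml => ? ?; lra.
move=> e0; have [x0|x0] := ltP x 0.
  exists 0 => //; rewrite /minkq_cdf.
  by rewrite min_l// max_l// min_l ?max_l ?ltrDl//; lra.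
have [x1|x1] := leP 1 x.
  exists (x + 1); first lra.
  by rewrite /minkq_cdf !min_r ?ltrDl//; lra.
have cx z : 0 <= z <= 1 -> minkq_cdf z = minkq z.
  by move=> z01; rewrite /minkq_cdf min_l ?max_r; lra.
apply: contrapT => no.
have big y : x < y -> minkq_cdf x + e <= minkq_cdf y.
  by move=> xy; rewrite leNgt; apply/negP => ?; apply: no; exists y.
have := big 1 x1; rewrite (cx 1) ?minkq1; last lra.
rewrite cx; last lra; move=> e1.
have /andP[mx0 mx1] : 0 <= minkq x <= 1 by apply: minkq01; lra.
have [n ne] : exists n, 2^-1 ^+ n < e / 2.
  apply: contrapT => /forallNP h; suff : e / 2 <= 0 by lra.
  by apply: le0_pow2 => n; rewrite leNgt; apply/negP; exact: h.
have [z z01] : exists2 z, 0 <= z <= 1 & `|minkq z - (minkq x + e / 2)| <= 2^-1 ^+ n.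
  by apply: minkq_dense; lra.
rewrite ler_norml => /andP[zl zr].
have [zx|/big] := leP z x.
  by have := @minkq_le z x; lra.
by rewrite !cx; lra.
Unshelve. all: by end_near. Qed.

HB.instance Definition _ := isCumulative.Build R _ R minkq_cdf
  minkq_cdf_nondecreasing minkq_cdf_right_continuous.

End minkowski_question_mark.

(* R[i]^o is R[i] with the topology of its norm.  An element of C([0, 1]) is   *)
(* given by any function R -> R[i]^o that is continuous on [0, 1]; its values  *)
(* outside [0, 1] are irrelevant.                                              *)
Section operators_on_C01.
Context {R : realType}.
Implicit Types (f g : R -> R[i]^o) (T B : (R -> R[i]^o) -> R -> R[i]^o).

Definition C01 : set (R -> R[i]^o) := [set g : R -> R[i]^o | {within `[(0 : R), 1], continuous g}].

Definition supnorm g : R := sup [set Normc.normc (g x) | x in `[0, 1]].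

Definition bounded_operator T :=
  [/\ forall g, C01 g -> C01 (T g),
      forall (l : R[i]) f g x, C01 f -> C01 g -> 0 <= x <= 1 ->
        T (fun y => l * f y + g y) x = l * T f x + T g x
    & exists M : R, forall g, C01 g -> supnorm (T g) <= M * supnorm g].

Definition resolvent_set T : set R[i] := [set l | exists2 B, bounded_operator B &
  forall g x, C01 g -> 0 <= x <= 1 ->
    B (fun y => l * g y - T g y) x = g x /\ l * B g x - T (B g) x = g x].

Definition spectrum T : set R[i] := ~` resolvent_set T.

Definition spectral_radius T : R := sup [set Normc.normc l | l in spectrum T].

End operators_on_C01.

Section correlation_dimension.
Context {R : realType}.

Definition Sigma (N : nat) : R :=
  \sum_(j < N) (minkq (j.+1%:R / N%:R) - minkq (j%:R / N%:R)) ^+ 2.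

Definition log_ratio (N : nat) : R := ln (Sigma N) / ln N%:R.

Definition D2 : R := - limn log_ratio.

(* The Stieltjes measure of minkq_cdf lives on [0, 1], and                     *)
(* e^(i x t) = cos (x t) + i sin (x t).                                        *)
Definition minkq_fourier (t : R) : R[i] :=
  Complex (\int[lebesgue_stieltjes_measure minkq_cdf]_(x in `[0, 1]) cos (x * t))
          (\int[lebesgue_stieltjes_measure minkq_cdf]_(x in `[0, 1]) sin (x * t)).

Definition K_op (s : R) (g : R -> R[i]^o) (x : R) : R[i]^o :=
  \big[+%R/0]_(1 <= a <oo)
    ((4 ^- a * (a%:R + x) `^ (2 * s))%:C%C * g (a%:R + x)^-1 : R[i]^o).

Definition pressure (s : R) : R := ln (spectral_radius (K_op s)).

Definition asymp (I : Type) (D : set I) (A B : I -> R) :=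
  exists c C : R, [/\ 0 < c, c <= C
    & forall i, D i -> c * B i <= A i <= C * B i].

End correlation_dimension.

Arguments D2 R : clear implicits.

(* Main.v *)
Require Import Defs.
From HB Require Import structures.
From mathcomp Require Import all_boot all_order all_algebra.
From mathcomp Require Import complex.
From mathcomp Require Import all_classical all_reals all_analysis.
From mathcomp Require Import ring lra zify.

Set Implicit Arguments.
Unset Strict Implicit.
Unset Printing Implicit Defensive.

Import numFieldNormedType.Exports.
Import Order.TTheory GRing.Theory Num.Theory.

Local Open Scope classical_set_scope.
Local Open Scope ring_scope.

(** No eigenfunction of K_s is constructed. Each comparison of K_s^n 1 with r^n may lose a fixed
    factor, which disappears in n-th roots; the Harnack bound that controls this factor comes from a
    cone of functions that K_s preserves.

    The tree is the slow form of the continued fraction: a partial quotient a takes a binary steps,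
    each of which halves the [?]-mass, so that the weight 4^-a is spread as 4^-1 per step. The
    obstacle is that long runs of steps keep one denominator fixed: a node at which the tree stops
    may have q far below Q, and then its length 1 / (q (q + p)) is far above Q^-2. Lengths of
    stopped nodes are therefore only bounded below. This suffices for the upper bound of Sigma_N;
    for the lower bound the node is replaced by its child with denominators q + p and 2 q + p, both
    of order Q, at the price of half the mass.

    The double integral behind |m(it)|^2 is never formed on a product measure. Riemann-Stieltjes
    sums over a refinement of the grid j / N turn the Fejer mean into a finite double sum, to which
    the kernel estimates apply directly, and the refinement is then sent to infinity. *)

(* For a word of partial quotients with denominators q_n, q_(n-1), the cylinder
   has [?]-mass 2^-(a_1 + ... + a_n) and length about q_n^-2, and
   K_s^n 1 (q_(n-1) / q_n) sums 4^-(sum of a_i) (denominator ratio)^(2s) over the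
   descendants.  The functions K_s^n 1 vary by a factor at most 4 on [0, 1], so
   that they are comparable with r^n for a growth rate r = r(s).  This r is the
   spectral radius: a Neumann series inverts l - K_s for |l| > r, whereas the sums
   of r^-(k+1) K_s^k 1 contradict the boundedness of (r - K_s)^-1.  The growth rate
   is continuous and strictly increasing, below 1 at s = 0 and above 1 at s = 1,
   hence it is 1 at exactly one s in (0, 1).

   At this s, K_s^n 1 is bounded above and below, which makes
   q^(2s) K_s^n 1 (p / q) an almost conserved quantity on the Stern-Brocot tree.
   Stopping the tree at denominators of size Q gives intervals of length at least
   Q^-2 whose squared [?]-masses sum to a constant times Q^(-2s); with Q^2 of
   order N, each interval of the grid j / N meets boundedly many of them, and each
   of them contains an interval of half its mass that meets boundedly many cells of
   the grid, so that Sigma_N is of order N^-s.  Finally, the Fejer mean over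
   [0, T] of |m(it)|^2 is the integral of a kernel of height T and width 1 / T
   against the square of the measure, and Schur's test compares it with
   T Sigma_N for N of order T. *)

(** * Transfer operators on real functions *)

Section weights.
Context {R : realType}.
Implicit Types (s x y c M : R) (g h : R -> R) (n : nat).

(** The index [n] stands for the partial quotient [n.+1], because [series] starts at 0. *)
Definition transfer_weight s x n : R := 4 ^- n.+1 * (n.+1%:R + x) `^ (2 * s).

Definition transfer_term s g x n : R := transfer_weight s x n * g (n.+1%:R + x)^-1.

End weights.

(** The argument [x] is meant to range over all nonnegative numbers, since [transfer_shift] moves it
    beyond 1; [g] is then still evaluated in (0, 1] only. *)
HB.lock Definition transfer {R : realType} (s : R) (g : R -> R) (x : R) : R :=
  limn (series (transfer_term s g x)).

Section real_transfer_operator.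
Context {R : realType}.
Implicit Types (s x y c M : R) (g h : R -> R) (n : nat).

Lemma transferE s g x : transfer s g x = limn (series (transfer_term s g x)).
Proof. by rewrite transfer.unlock. Qed.

Lemma transfer_weight_gt0 s x n : 0 <= x -> 0 < transfer_weight s x n.
Proof.
move=> x0; rewrite /transfer_weight mulr_gt0 ?invr_gt0 ?exprn_gt0// powR_gt0//.
by rewrite ltr_wpDr.
Qed.

Lemma transfer_weight_ge0 s x n : 0 <= x -> 0 <= transfer_weight s x n.
Proof. by move=> x0; apply/ltW/transfer_weight_gt0. Qed.

(** For exponents [2 * s] up to 4 this absorbs the power of the digit into half of the decay
    [4 ^- n], which leaves a geometric majorant of ratio 1/2. *)
Lemma expn4_le n : (n ^ 4 <= 32 * 2 ^ n)%N.
Proof.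
have [|n8] := ltnP n 8; first by do 8 (case: n => [|n]//).
rewrite -(subnK n8); elim: (n - 8)%N => // k ih.
have : ((k + 8).+1 ^ 4 <= 2 * (k + 8) ^ 4)%N by rewrite !expnS expn0; nia.
rewrite addSn [(2 ^ _.+1)%N]expnS; lia.
Qed.

Lemma shift_inv_itv x n : 0 <= x -> 0 < (n.+1%:R + x)^-1 <= 1.
Proof.
move=> x0; have n1 : 1 <= n.+1%:R + x.
  by rewrite -[leLHS]addr0 lerD// ler1n.
by rewrite invr_gt0 invf_le1 ?n1 ?andbT ?(lt_le_trans _ n1).
Qed.

(** The range [s <= 2] goes beyond [0, 1] because [transfer_incr] compares with the exponent
    [s + 1]. *)
Lemma transfer_weight_le s x n : s <= 2 -> 0 <= x ->
  transfer_weight s x n <= 16 * (1 + x) ^+ 4 * 2^-1 ^+ n.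
Proof.
move=> s2 x0; have n1 : (1 : R) <= n.+1%:R by rewrite ler1n.
have y1 : 1 <= n.+1%:R + x by rewrite -[leLHS]addr0 lerD.
have yle : (n.+1%:R + x) `^ (2 * s) <= n.+1%:R ^+ 4 * (1 + x) ^+ 4.
  apply: (@le_trans _ _ ((n.+1%:R + x) `^ 4%:R)).
    by apply: ler_powR => //; lra.
  rewrite powR_mulrn; last lra.
  rewrite -exprMn; apply: lerXn2r; rewrite ?nnegrE; [lra|nra|nra].
have h4 : n.+1%:R ^+ 4 <= 32 * 2 ^+ n.+1 :> R.
  by rewrite -!natrX -natrM ler_nat expn4_le.
rewrite /transfer_weight.
have -> : 4 ^- n.+1 = 2 ^- n.+1 * 2 ^- n.+1 :> R.
  by rewrite -invfM -exprMn; congr (_ ^+ _)^-1; lra.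
have p0 : 0 < 2 ^+ n.+1 :> R by rewrite exprn_gt0.
have q0 : 0 <= (1 + x) ^+ 4 by apply: exprn_ge0; lra.
apply: (@le_trans _ _ (2 ^- n.+1 * 2 ^- n.+1 * (32 * 2 ^+ n.+1 * (1 + x) ^+ 4))).
  apply: ler_wpM2l; first by rewrite mulr_ge0// invr_ge0 ltW.
  by apply: (le_trans yle); rewrite ler_wpM2r.
rewrite exprVn [in leRHS](_ : 2 ^- n = 2 * 2 ^- n.+1); last first.
  by rewrite exprS invfM mulrA mulfV ?mul1r.
rewrite le_eqVlt; apply/predU1P; left; field.
by rewrite expf_neq0.
Qed.

Definition bounded01 M g := forall y, 0 < y <= 1 -> `|g y| <= M.

Lemma transfer_term_le s x g M n : s <= 2 -> 0 <= x -> bounded01 M g ->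
  `|transfer_term s g x n| <= M * (16 * (1 + x) ^+ 4) * 2^-1 ^+ n.
Proof.
move=> s2 x0 gM; rewrite /transfer_term normrM (gtr0_norm (transfer_weight_gt0 _ _ x0))
  mulrC -mulrA.
apply: ler_pM; rewrite ?normr_ge0 ?transfer_weight_ge0//; last exact: transfer_weight_le.
by apply: gM; exact: shift_inv_itv.
Qed.

Lemma cvg_transfer_term s x g M : s <= 2 -> 0 <= x -> bounded01 M g ->
  cvgn (series (transfer_term s g x)).
Proof.
move=> s2 x0 gM; apply: normed_cvg.
apply: (@series_le_cvg _ _ (geometric (M * (16 * (1 + x) ^+ 4)) 2^-1)) => [n|n|n|].
- exact: normr_ge0.
- rewrite /geometric/= mulr_ge0 ?exprn_ge0// mulr_ge0 ?(le_trans _ (gM 1 _))//.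
    by lra.
  by rewrite mulr_ge0// exprn_ge0//; lra.
- exact: transfer_term_le.
- by apply: is_cvg_geometric_series; rewrite ger0_norm// invf_lt1// ltr1n.
Qed.

Lemma transfer_lin s g h x c M M' : s <= 2 -> 0 <= x -> bounded01 M g -> bounded01 M' h ->
  transfer s (fun y => c * g y + h y) x = c * transfer s g x + transfer s h x.
Proof.
move=> s2 x0 gM hM; rewrite !transferE; apply: cvg_lim => //.
have -> : series (transfer_term s (fun y => c * g y + h y) x) =
   (fun n => c * series (transfer_term s g x) n + series (transfer_term s h x) n).
  apply/funext => n; rewrite /series/= mulr_sumr -big_split/=.
  by apply: eq_bigr => i _; rewrite /transfer_term; ring.
apply: cvgD; last exact: cvg_transfer_term hM.
by apply: cvgMl_tmp; exact: cvg_transfer_term gM.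
Qed.

Lemma transfer_le s s' g h x x' c M M' : s <= 2 -> s' <= 2 -> 0 <= x -> 0 <= x' ->
  bounded01 M g -> bounded01 M' h ->
  (forall n, transfer_term s g x n <= c * transfer_term s' h x' n) ->
  transfer s g x <= c * transfer s' h x'.
Proof.
move=> s2 s2' x0 x0' gM hM gh; rewrite !transferE.
have ch := cvg_transfer_term s2' x0' hM.
have -> : c * limn (series (transfer_term s' h x')) =
    limn (fun n => c * series (transfer_term s' h x') n).
  by apply/esym/cvg_lim => //; apply: cvgMl_tmp.
apply: ler_lim; first exact: cvg_transfer_term gM.
  by apply: is_cvgMl_tmp.
near=> n; rewrite /series/= mulr_sumr; apply: ler_sum => i _; exact: gh.
Unshelve. all: by end_near. Qed.

Lemma transfer_mono s g h x M M' : s <= 2 -> 0 <= x ->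
  bounded01 M g -> bounded01 M' h -> (forall y, 0 < y <= 1 -> g y <= h y) ->
  transfer s g x <= transfer s h x.
Proof.
move=> s2 x0 gM hM gh; rewrite -[leRHS]mul1r; apply: (transfer_le _ _ _ _ gM hM) => // n.
by rewrite mul1r ler_wpM2l ?transfer_weight_ge0//; apply: gh; exact: shift_inv_itv.
Qed.

Lemma transfer_ext s g h x : 0 <= x -> (forall y, 0 < y <= 1 -> g y = h y) ->
  transfer s g x = transfer s h x.
Proof.
move=> x0 gh; rewrite !transferE; congr (limn (series _)); apply/funext => n.
by rewrite /transfer_term gh//; exact: shift_inv_itv.
Qed.

Lemma transfer_ge0 s g x M : s <= 2 -> 0 <= x -> bounded01 M g ->
  (forall y, 0 < y <= 1 -> 0 <= g y) -> 0 <= transfer s g x.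
Proof.
move=> s2 x0 gM g0; rewrite transferE -(mul0r (transfer s (cst 1) x)).
apply: limr_ge; first exact: cvg_transfer_term gM.
near=> n; rewrite mul0r; apply: sumr_ge0 => i _.
by rewrite mulr_ge0 ?transfer_weight_ge0// g0//; exact: shift_inv_itv.
Unshelve. all: by end_near. Qed.

Lemma transfer_bound s g x M : s <= 2 -> 0 <= x -> bounded01 M g ->
  `|transfer s g x| <= 32 * (1 + x) ^+ 4 * M.
Proof.
move=> s2 x0 gM; have c1 := cvg_transfer_term s2 x0 gM.
have nb n : `|series (transfer_term s g x) n| <= 32 * (1 + x) ^+ 4 * M.
  apply: (le_trans (ler_norm_sum _ _ _)).
  apply: (@le_trans _ _ (\sum_(0 <= i < n) M * (16 * (1 + x) ^+ 4) * 2^-1 ^+ i)).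
    by apply: ler_sum => i _; exact: transfer_term_le.
  rewrite -mulr_sumr.
  have -> : 32 * (1 + x) ^+ 4 * M = M * (16 * (1 + x) ^+ 4) * 2 by ring.
  rewrite ler_wpM2l//.
    rewrite mulr_ge0 ?(le_trans _ (gM 1 _))//; first lra.
    by rewrite mulr_ge0// exprn_ge0//; lra.
  suff -> : \sum_(0 <= i < n) 2^-1 ^+ i = 2 - 2 * 2^-1 ^+ n :> R.
    by rewrite lerBlDr lerDl mulr_ge0 ?exprn_ge0.
  elim: n => [|n ih]; first by rewrite big_geq// expr0; ring.
  by rewrite big_nat_recr//= ih exprS; field.
rewrite transferE ler_norml; apply/andP; split.
  apply: limr_ge; [exact: c1|near=> n]; have := nb n; rewrite ler_norml; by case/andP.
apply: limr_le; [exact: c1|near=> n]; have := nb n; rewrite ler_norml; by case/andP.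
Unshelve. all: by end_near. Qed.

(** The digit 1 is split off and the others are lowered by one. This breaks a digit into slow steps:
    either it ends here, or [x] moves to [1 + x] at the cost of a factor 1/4. The recursion of the
    tree comes from this identity. *)
Lemma transfer_shift s g x M : s <= 2 -> 0 <= x -> bounded01 M g ->
  transfer s g x = 4^-1 * ((1 + x) `^ (2 * s) * g (1 + x)^-1) + 4^-1 * transfer s g (1 + x).
Proof.
move=> s2 x0 gM; rewrite !transferE; apply: cvg_lim => //.
have x10 : 0 <= 1 + x by lra.
rewrite -(cvg_shiftS (series _)).
have -> : (fun n => series (transfer_term s g x) n.+1) =
  (fun n => 4^-1 * ((1 + x) `^ (2 * s) * g (1 + x)^-1) +
            4^-1 * series (transfer_term s g (1 + x)) n).
  apply/funext => n; rewrite /series/= big_nat_recl//; congr (_ + _).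
    by rewrite /transfer_term /transfer_weight expr1 mulrA.
  rewrite mulr_sumr; apply: eq_bigr => i _.
  rewrite /transfer_term /transfer_weight addrA natr1 [4 ^+ i.+2]exprS invfM -!mulrA;
    congr (_ * (_ * (_ * _))).
by apply: cvgD; [exact: cvg_cst|apply: cvgMl_tmp; exact: cvg_transfer_term gM].
Qed.

End real_transfer_operator.

(** * An invariant cone and the Harnack inequality *)

Section cones.
Context {R : realType}.
Implicit Types (s x y c M : R) (g h : R -> R) (n : nat).

Lemma bounded01_transfer s g M : s <= 2 -> bounded01 M g ->
  bounded01 (512 * M) (transfer s g).
Proof.
move=> s2 gM y /andP[y0 y1]; have M0 : 0 <= M by rewrite (le_trans _ (gM 1 _)) ?ltr01 ?lexx.
apply: (le_trans (transfer_bound s2 (ltW y0) gM)); rewrite ler_wpM2r//.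
have : (1 + y) ^+ 4 <= 2 ^+ 4 by apply: lerXn2r; rewrite ?nnegrE; lra.
by move: (_ ^+ 4) => z; lra.
Qed.

Lemma bounded01_iter s g M n : s <= 2 -> bounded01 M g ->
  bounded01 (512 ^+ n * M) (iter n (transfer s) g).
Proof.
move=> s2 gM; elim: n => [|n ih]; first by rewrite expr0 mul1r.
by rewrite exprS -mulrA /=; exact: bounded01_transfer.
Qed.

Lemma bounded01M g M c : bounded01 M g -> bounded01 (`|c| * M) (fun y => c * g y).
Proof. by move=> gM y y01; rewrite normrM ler_wpM2l// gM. Qed.

Lemma transferZ s g x c M : s <= 2 -> 0 <= x -> bounded01 M g ->
  transfer s (fun y => c * g y) x = c * transfer s g x.
Proof.
move=> s2 x0 gM.
have z0 : bounded01 0 (fun _ : R => 0 : R) by move=> y _; rewrite normr0.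
have zM : bounded01 (0 : R) (cst 0 : R -> R) by [].
rewrite -[RHS]addr0.
have <- : transfer s (fun=> 0) x = 0.
  apply/eqP; rewrite -normr_le0; apply: (le_trans (transfer_bound s2 x0 z0)).
  by rewrite mulr0.
rewrite -(transfer_lin _ s2 x0 gM z0); apply: transfer_ext => // y _; by rewrite addr0.
Qed.

Lemma iter_transfer_mono s g h M M' n : s <= 2 -> bounded01 M g -> bounded01 M' h ->
  (forall y, 0 <= y <= 1 -> g y <= h y) ->
  forall y, 0 <= y <= 1 -> iter n (transfer s) g y <= iter n (transfer s) h y.
Proof.
move=> s2 gM hM gh; elim: n => //= n ih y y01.
apply: (transfer_mono s2 _ (bounded01_iter n s2 gM) (bounded01_iter n s2 hM)); first lra.
by move=> z z01; apply: ih; lra.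
Qed.

Lemma iter_transferZ s g c M n : s <= 2 -> bounded01 M g ->
  forall y, 0 <= y <= 1 ->
  iter n (transfer s) (fun y => c * g y) y = c * iter n (transfer s) g y.
Proof.
move=> s2 gM; elim: n => //= n ih y y01.
rewrite -(transferZ _ s2 _ (bounded01_iter n s2 gM)); last lra.
by apply: transfer_ext => [|z z01]; [lra|apply: ih; lra].
Qed.

(* [g] is in the cone iff [q `^ (2 * s) * g (p / q)] is nondecreasing in [p] and
   [q]; in this form the invariance under the transfer operator is visible. *)
Definition cone s g := [/\ forall x, 0 <= x -> 0 < g x,
  forall x y, 0 <= x <= y -> g x <= g y &
  forall x y, 0 < x <= y -> g y <= (y / x) `^ (2 * s) * g x].

Lemma cone_bounded s g : cone s g -> bounded01 (g 1) g.
Proof.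
move=> [g0 gm _] y y01; rewrite ger0_norm; first by apply: gm; lra.
by apply/ltW/g0; lra.
Qed.

Lemma powR_ge1 x s : 1 <= x -> 0 <= s -> 1 <= x `^ s.
Proof. by move=> x1 s0; rewrite -(powRr0 x) ler_powR. Qed.

Lemma transfer_ge_first s g x M : s <= 2 -> 0 <= x -> bounded01 M g ->
  (forall y, 0 < y <= 1 -> 0 <= g y) ->
  4^-1 * ((1 + x) `^ (2 * s) * g (1 + x)^-1) <= transfer s g x.
Proof.
move=> s2 x0 gM g0; rewrite (transfer_shift s2 x0 gM) lerDl mulr_ge0//.
by apply: (transfer_ge0 _ _ gM) => //; lra.
Qed.

Lemma cone_transfer_ge s g x : 0 <= s <= 1 -> 0 <= x -> cone s g ->
  4^-1 * g 0 <= transfer s g x.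
Proof.
move=> s01 x0 gC; have [g0 gm _] := gC.
apply: le_trans (transfer_ge_first _ x0 (cone_bounded gC) _); last 2 first.
- lra.
- by move=> y y01; apply/ltW/g0; lra.
rewrite ler_wpM2l// -[leLHS]mul1r ler_pM//.
- by apply/ltW/g0.
- by apply: powR_ge1; lra.
- by apply: gm; rewrite lexx invr_ge0; lra.
Qed.

(** The last two conditions exchange their roles. Under inversion, the growth bound on [g] is what
    the weight needs to make each term nondecreasing in [x]; monotonicity of [g] in turn gives the
    growth bound of the image, because (n + 1 + y) / (n + 1 + x) <= y / x. *)
Lemma cone_transfer s g : 0 <= s <= 1 -> cone s g -> cone s (transfer s g).
Proof.
move=> s01 gC; have [g0 gm gp] := gC; have gM := cone_bounded gC.
have s2 : s <= 2 by lra.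
split=> [x x0|x y /andP[x0 xy]|x y /andP[x0 xy]].
- apply: lt_le_trans (cone_transfer_ge _ x0 gC) => //.
  by rewrite mulr_gt0 ?g0.
- rewrite -[leRHS]mul1r; apply: (transfer_le _ _ _ _ gM gM) => // [|n]; first lra.
  rewrite mul1r /transfer_term /transfer_weight -!mulrA ler_wpM2l ?invr_ge0 ?exprn_ge0//.
  have n1 : (1 : R) <= n.+1%:R by rewrite ler1n.
  have X1 : 0 < n.+1%:R + x by lra.
  have Y1 : 0 < n.+1%:R + y by lra.
  have := gp (n.+1%:R + y)^-1 (n.+1%:R + x)^-1.
  rewrite invr_gt0 Y1/= lef_pV2 ?posrE// lerD2l xy => /(_ isT).
  rewrite invrK => h; apply: (le_trans (ler_wpM2l (powR_ge0 _ _) h)).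
  rewrite mulrA -powRM ?mulr_ge0 ?invr_ge0 ?(ltW X1) ?(ltW Y1)//.
  by rewrite mulVKf// ?lt0r_neq0.
- apply: (transfer_le _ _ _ _ gM gM) => // [||n]; [lra|lra|].
  rewrite /transfer_term /transfer_weight mulrCA -!mulrA ler_wpM2l ?invr_ge0 ?exprn_ge0//.
  have n1 : (1 : R) <= n.+1%:R by rewrite ler1n.
  have X1 : 0 < n.+1%:R + x by lra.
  have Y1 : 0 < n.+1%:R + y by lra.
  rewrite mulrA; apply: ler_pM; rewrite ?powR_ge0 ?(ltW (g0 _ _)) ?invr_ge0 ?(ltW Y1)//.
    have y0 : 0 <= y by lra.
    rewrite -powRM ?(ltW X1) ?divr_ge0 ?(ltW x0)//.
    apply: ge0_ler_powR; rewrite ?nnegrE ?(ltW Y1)//; first lra.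
      by rewrite mulr_ge0 ?divr_ge0 ?(ltW X1) ?(ltW x0).
    rewrite mulrDl [x * _]mulrCA divff ?lt0r_neq0// mulr1 lerD2r ler_peMr ?ler_pdivlMr//;
      lra.
  by apply: gm; rewrite invr_ge0 (ltW Y1)/= lef_pV2 ?posrE// lerD2l.
Qed.

Lemma powR2_le4 s : 0 <= s <= 1 -> 2 `^ (2 * s) <= 4 :> R.
Proof.
move=> s01; have -> : 4 = 2 `^ 2%:R :> R by rewrite powR_mulrn// expr2; lra.
by apply: ler_powR => //; lra.
Qed.

(** From n + 2 <= 2 (n + 1), the weights at 1 and at 0 differ by a factor at most 2^(2s) <= 4, while
    [g] is evaluated at a smaller point for the argument 1. *)
Lemma cone_harnack s g : 0 <= s <= 1 -> cone s g -> transfer s g 1 <= 4 * transfer s g 0.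
Proof.
move=> s01 gC; have [g0 gm gp] := gC; have gM := cone_bounded gC.
apply: (transfer_le _ _ _ _ gM gM) => // [||n]; [lra|lra|].
rewrite /transfer_term /transfer_weight mulrCA -!mulrA ler_wpM2l ?invr_ge0 ?exprn_ge0//.
have n1 : (1 : R) <= n.+1%:R by rewrite ler1n.
rewrite mulrA addr0; apply: ler_pM; rewrite ?powR_ge0 ?(ltW (g0 _ _)) ?invr_ge0//.
  apply: (@le_trans _ _ ((n.+1%:R * 2) `^ (2 * s))).
    by apply: ge0_ler_powR; rewrite ?nnegrE; lra.
  by rewrite powRM// ler_wpM2l ?powR_ge0// powR2_le4.
apply: gm; rewrite invr_ge0 lef_pV2 ?posrE; lra.
Qed.

End cones.

(** * Iterates of the constant 1 and their growth rate *)

HB.lock Definition transfer1 {R : realType} (s : R) (n : nat) : R -> R :=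
  iter n (transfer s) (cst 1).

(** The values K^n 1 (0) are supermultiplicative, so that by Fekete's lemma this supremum is also
    the limit; written as a supremum, it bounds each K^n 1 (0) without any limit being taken. *)
HB.lock Definition growth_rate {R : realType} (s : R) : R :=
  expR (sup [set ln (transfer1 s n.+1 0) / n.+1%:R | n in setT]).

Section iterates.
Context {R : realType}.
Implicit Types (s x y c M : R) (g h : R -> R) (n : nat).

Lemma transfer1E s n : transfer1 s n = iter n (transfer s) (cst 1).
Proof. by rewrite transfer1.unlock. Qed.

Lemma transfer10 s x : transfer1 s 0 x = 1. Proof. by rewrite transfer1E. Qed.

Lemma transfer1S s n : transfer1 s n.+1 = transfer s (transfer1 s n). Proof.
  by rewrite !transfer1E. Qed.

Lemma cone_transfer1 s n : 0 <= s <= 1 -> cone s (transfer1 s n).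
Proof.
move=> s01; elim: n => [|n ih]; last by rewrite transfer1S; exact: cone_transfer.
split=> [x x0|x y _|x y /andP[x0 xy]]; rewrite !transfer10 ?ltr01//.
rewrite mulr1; apply: powR_ge1; last lra.
by rewrite ler_pdivlMr// mul1r.
Qed.

Lemma transfer1_gt0 s n x : 0 <= s <= 1 -> 0 <= x -> 0 < transfer1 s n x.
Proof. by move=> /(@cone_transfer1 _ n)[+ _ _]; exact. Qed.

Lemma transfer1_itv s n x : 0 <= s <= 1 -> 0 <= x <= 1 -> transfer1 s n 0 <=
  transfer1 s n x <= transfer1 s n 1.
Proof.
by move=> /(@cone_transfer1 _ n)[_ gm _] x01; apply/andP; split; apply: gm; lra.
Qed.

Lemma transfer1_harnack s n : 0 <= s <= 1 -> transfer1 s n 1 <= 4 * transfer1 s n 0.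
Proof.
case: n => [|n] s01; first by rewrite !transfer10; lra.
rewrite transfer1S; by apply: cone_harnack => //; exact: cone_transfer1.
Qed.

Lemma bounded01_transfer1 s n : 0 <= s <= 1 -> bounded01 (transfer1 s n 1) (transfer1 s n).
Proof. by move=> s01; apply: cone_bounded; exact: cone_transfer1. Qed.

Lemma transfer1D s n m x : transfer1 s (n + m) x = iter n (transfer s) (transfer1 s m) x.
Proof. by rewrite !transfer1E iterD. Qed.

(** K^m 1 lies below its value at 1, and K^n preserves order. Together with [transfer1D_ge], this
    makes K^n 1 (1) submultiplicative and K^n 1 (0) supermultiplicative. *)
Lemma transfer1D_le s n m x : 0 <= s <= 1 -> 0 <= x <= 1 ->
  transfer1 s (n + m) x <= transfer1 s m 1 * transfer1 s n x.
Proof.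
move=> s01 x01; have s2 : s <= 2 by lra.
have b1 : bounded01 (1 : R) (cst 1) by move=> y _; rewrite normr1.
rewrite transfer1D (transfer1E s n) -(iter_transferZ _ _ s2 b1)//.
apply: (iter_transfer_mono _ s2 (bounded01_transfer1 m s01) (bounded01M _ b1)) => // y y01.
by rewrite mulr1; case/andP: (transfer1_itv m s01 y01).
Qed.

Lemma transfer1D_ge s n m x : 0 <= s <= 1 -> 0 <= x <= 1 ->
  transfer1 s m 0 * transfer1 s n x <= transfer1 s (n + m) x.
Proof.
move=> s01 x01; have s2 : s <= 2 by lra.
have b1 : bounded01 (1 : R) (cst 1) by move=> y _; rewrite normr1.
rewrite transfer1D (transfer1E s n) -(iter_transferZ _ _ s2 b1)//.
apply: (iter_transfer_mono _ s2 (bounded01M _ b1) (bounded01_transfer1 m s01)) => // y y01.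
by rewrite mulr1; case/andP: (transfer1_itv m s01 y01).
Qed.

Lemma transfer1M_le s n m : 0 <= s <= 1 -> transfer1 s (n * m) 1 <= transfer1 s m 1 ^+ n.
Proof.
move=> s01; elim: n => [|n ih]; first by rewrite mul0n expr0 transfer10.
rewrite mulSn addnC exprS; apply: (le_trans (transfer1D_le _ _ s01 _)); first lra.
by rewrite ler_wpM2l// ltW// transfer1_gt0.
Qed.

Lemma transfer1M_ge s n m : 0 <= s <= 1 -> transfer1 s m 0 ^+ n <= transfer1 s (n * m) 0.
Proof.
move=> s01; elim: n => [|n ih]; first by rewrite mul0n expr0 transfer10.
rewrite mulSn addnC exprS; apply: le_trans (transfer1D_ge _ _ s01 _); last lra.
by rewrite ler_wpM2l// ltW// transfer1_gt0.
Qed.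

Lemma growth_rateE s : growth_rate s = expR (sup [set ln (transfer1 s n.+1 0) / n.+1%:R |
  n in setT]).
Proof. by rewrite growth_rate.unlock. Qed.


Lemma growth_rate_gt0 s : 0 < growth_rate s. Proof. by rewrite growth_rateE expR_gt0. Qed.

(** Every lower estimate ln (K^k 1 (0)) / k is at most every upper estimate ln (K^m 1 (1)) / m, as a
    comparison at the common index k m shows; the supremum of the former separates them. *)
Lemma growth_rate_itv s n : 0 <= s <= 1 -> transfer1 s n 0 <= growth_rate s ^+ n <=
  transfer1 s n 1.
Proof.
move=> s01; case: n => [|n]; first by rewrite !expr0 !transfer10 lexx.
have key k m : ln (transfer1 s k.+1 0) / k.+1%:R <= ln (transfer1 s m.+1 1) / m.+1%:R.
  rewrite ler_pdivrMr// mulrAC ler_pdivlMr//.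
  have b0 : 0 < transfer1 s k.+1 0 by rewrite transfer1_gt0.
  have a0 : 0 < transfer1 s m.+1 1 by rewrite transfer1_gt0.
  rewrite [leLHS]mulr_natr [leRHS]mulr_natr -lnXn// -lnXn//.
  rewrite ler_ln ?posrE ?exprn_gt0//.
  apply: (le_trans (transfer1M_ge m.+1 k.+1 s01)); rewrite mulnC.
  apply: le_trans (transfer1M_le _ _ s01).
  by have /andP[+ _] := transfer1_itv (k.+1 * m.+1) s01 (x := 1) ltac:(lra).
pose S := [set ln (transfer1 s k.+1 0) / k.+1%:R | k in [set: nat]].
have S0 : S !=set0 by exists (ln (transfer1 s 1 0) / 1%:R); exists 0%N.
have Sub m : ubound S (ln (transfer1 s m.+1 1) / m.+1%:R) by move=> _ [k _ <-].
rewrite growth_rateE -/S -expRM_natl; apply/andP; split.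
- rewrite -[leLHS]lnK ?posrE ?transfer1_gt0// ler_expR mulrC -ler_pdivrMr//.
  by apply: ub_le_sup; [exists (ln (transfer1 s 1 1) / 1%:R); exact: Sub|exists n].
- rewrite -[leRHS]lnK ?posrE ?transfer1_gt0// ler_expR mulrC -ler_pdivlMr//.
  by apply: ge_sup => //; exact: Sub.
Qed.

(** This discards the Harnack constants: if u / v exceeded 1, its powers would be unbounded by
    Bernoulli's inequality. *)
Lemma exp_le_compare c u v : 0 < u -> 0 < v ->
  (forall n, u ^+ n <= c * v ^+ n) -> u <= v.
Proof.
move=> u0 v0 uv; rewrite leNgt; apply/negP => vu.
pose e := u / v - 1.
have e0 : 0 < e by rewrite /e subr_gt0 ltr_pdivlMr// mul1r.
have ge n : 1 + n%:R * e <= c.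
  apply: (@le_trans _ _ ((u / v) ^+ n)).
    have -> : u / v = 1 + e by rewrite /e; ring.
    elim: n => [|n ih]; first by rewrite mul0r addr0 expr0.
    rewrite exprS; apply: (@le_trans _ _ ((1 + e) * (1 + n%:R * e))).
      rewrite -natr1; have : 0 <= n%:R :> R by []; move: (n%:R) => k; nra.
    by rewrite ler_wpM2l//; lra.
  by rewrite expr_div_n ler_pdivrMr ?exprn_gt0.
have := ge (Num.truncn (c / e)).+1.
have c0 : 0 <= c by have := ge 0%N; lra.
have := @truncn_itv _ (c / e); rewrite divr_ge0 ?(ltW e0)// => /(_ isT)/andP[_].
rewrite ltr_pdivrMr//; lra.
Qed.

End iterates.

(** * Dependence of the growth rate on s *)

Section growth.
Context {R : realType}.
Implicit Types (s x y c M d : R) (g h : R -> R) (n : nat).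

Lemma transfer_le_add s s1 s2 g x c M : s <= 2 -> s1 <= 2 -> s2 <= 2 -> 0 <= x ->
  bounded01 M g ->
  (forall n, transfer_term s g x n <=
    transfer_term s1 g x n + c * transfer_term s2 g x n) ->
  transfer s g x <= transfer s1 g x + c * transfer s2 g x.
Proof.
move=> h h1 h2 x0 gM gh; rewrite [leLHS]transferE.
have c1 := cvg_transfer_term h1 x0 gM; have c2 := cvg_transfer_term h2 x0 gM.
have -> : transfer s1 g x + c * transfer s2 g x =
    limn (fun n => series (transfer_term s1 g x) n + c * series (transfer_term s2 g x) n).
  by rewrite !transferE; apply/esym/cvg_lim; [exact: Rhausdorff|apply: cvgD;
    [exact: c1|apply: cvgMl_tmp; exact: c2]].
apply: ler_lim; first exact: cvg_transfer_term gM.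
  apply: is_cvgD; [exact: c1|apply: is_cvgMl_tmp; exact: c2].
near=> n; rewrite /series/= mulr_sumr -big_split/=; apply: ler_sum => i _; exact: gh.
Unshelve. all: by end_near. Qed.

(* Bernoulli: [y^(2d) = (y^2)^d <= 1 + d (y^2 - 1)] for [d] in [0, 1]. *)
Lemma powR_bernoulli y d : 1 <= y -> 0 <= d <= 1 ->
  y `^ (2 * d) <= 1 + d * (y ^+ 2 - 1).
Proof.
move=> y1 /andP[d0 d1]; have y0 : 0 < y by lra.
have := @convex_expR R (Itv01 d0 d1) (ln (y ^+ 2)) 0.
rewrite !convRE/= /unstable.onem expR0 lnK ?posrE ?exprn_gt0// mulr0 addr0 mulr1.
rewrite powRrM powR_mulrn ?(ltW y0)// /powR gt_eqF ?exprn_gt0// => h.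
by apply: (le_trans h); rewrite le_eqVlt; apply/predU1P; left; ring.
Qed.

(** By [powR_bernoulli], y^(2d) <= 1 + d y^2 with y = n + 1 + x, and the factor y^2 raises the
    exponent from [s] to [s + 1]. *)
Lemma transfer_incr s d g x M : 0 <= s -> 0 <= d <= 1 -> s + d <= 1 -> 0 <= x ->
  bounded01 M g -> (forall y, 0 < y <= 1 -> 0 <= g y) ->
  transfer (s + d) g x <= transfer s g x + d * transfer (s + 1) g x.
Proof.
move=> s0 d01 sd x0 gM g0; apply: (transfer_le_add _ _ _ x0 gM) => [|||n]; [lra|lra|lra|].
rewrite /transfer_term mulrA -mulrDl ler_wpM2r ?g0 ?shift_inv_itv//.
rewrite /transfer_weight mulrCA -mulrDr ler_wpM2l ?invr_ge0 ?exprn_ge0//.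
have n1 : (1 : R) <= n.+1%:R by rewrite ler1n.
have Y1 : 1 <= n.+1%:R + x by lra.
have Y0 : 0 < n.+1%:R + x by lra.
rewrite !(mulrDr 2) !powRD ?(lt0r_neq0 Y0) ?implybT// mulr1 powR_mulrn ?(ltW Y0)//.
have := powR_bernoulli Y1 d01.
have := powR_ge0 (n.+1%:R + x) (2 * s).
case/andP: d01 => d0 _; set u := _ `^ (2 * s); set v := _ `^ (2 * d); set w := _ ^+ 2; nra.
Qed.

Lemma powR2_mono x s s' : 1 <= x -> s <= s' -> x `^ (2 * s) <= x `^ (2 * s').
Proof. by move=> x1 ss; apply: ler_powR => //; lra. Qed.

Lemma transfer_mono_s s s' g x M : s' <= 2 -> s <= s' -> 0 <= x ->
  bounded01 M g -> (forall y, 0 < y <= 1 -> 0 <= g y) ->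
  transfer s g x <= transfer s' g x.
Proof.
move=> s2 ss x0 gM g0; rewrite -[leRHS]mul1r.
apply: (transfer_le _ _ _ _ gM gM) => // [|n]; first lra.
rewrite mul1r /transfer_term ler_wpM2r ?g0 ?shift_inv_itv//.
rewrite ler_wpM2l ?invr_ge0 ?exprn_ge0// powR2_mono//.
have : (1 : R) <= n.+1%:R by rewrite ler1n.
lra.
Qed.

(** A factor 32 * 16 comes from [transfer_bound] at [x <= 1], a factor 4 from the Harnack bound and
    a factor 4 from [cone_transfer_ge]. *)
Definition growth_cst : R := 32 * 16 * 16.

Lemma growth_cst_ge0 : 0 <= growth_cst. Proof. by rewrite /growth_cst !mulr_ge0. Qed.

Lemma transfer_incr_transfer1 s d n x : 0 <= s -> 0 <= d <= 1 -> s + d <= 1 -> 0 <= x <=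
  1 ->
  transfer (s + d) (transfer1 s n) x <= (1 + growth_cst * d) * transfer s (transfer1 s n) x.
Proof.
move=> s0 d01 sd x01; have s01 : 0 <= s <= 1 by lra.
have fM := bounded01_transfer1 n s01.
have f0 y : 0 < y <= 1 -> 0 <= transfer1 s n y.
  by move=> y01; apply/ltW/transfer1_gt0 => //; lra.
have x0 : 0 <= x by lra.
have := transfer_incr s0 d01 sd x0 fM f0.
have := @transfer_bound _ (s + 1) _ _ _ ltac:(lra) x0 fM.
have := ler_norm (transfer (s + 1) (transfer1 s n) x).
have := cone_transfer_ge s01 x0 (cone_transfer1 n s01).
have := transfer1_harnack n s01.
have : 0 < transfer1 s n 0 by rewrite transfer1_gt0.
have : 0 < transfer1 s n 1 by rewrite transfer1_gt0.
have : (1 + x) ^+ 4 <= 2 ^+ 4 by apply: lerXn2r; rewrite ?nnegrE; lra.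
have : 0 <= (1 + x) ^+ 4 by apply: exprn_ge0; lra.
case/andP: d01 => d0 _.
move: (transfer _ _ _) (transfer _ _ _) (transfer _ _ _) (transfer1 s n 0) (transfer1 s n
  1) (_ ^+ 4)
 => u v w a b p p0 p1 b0 a0 ba w0 vv vb h.
have pb : 32 * p * b <= 32 * 16 * (4 * a).
  by apply: ler_pM => //; lra.
rewrite /growth_cst; set k : R := 32 * 16 * 16.
have : d * v <= d * (k * w) by apply: ler_wpM2l => //; rewrite /k; lra.
by move: k => k; lra.
Qed.

Lemma transfer1_incr s d n x : 0 <= s -> 0 <= d <= 1 -> s + d <= 1 -> 0 <= x <= 1 ->
  transfer1 (s + d) n x <= (1 + growth_cst * d) ^+ n * transfer1 s n x.
Proof.
move=> s0 d01 sd; have s01 : 0 <= s <= 1 by lra.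
have sd01 : 0 <= s + d <= 1 by lra.
elim: n x => [|n ih] x x01; first by rewrite expr0 mul1r !transfer10.
have s2 : s + d <= 2 by lra.
have x0 : 0 <= x by lra.
have fM := bounded01_transfer1 n s01.
have c0 : 0 <= (1 + growth_cst * d) ^+ n
  by rewrite exprn_ge0// addr_ge0// mulr_ge0 ?growth_cst_ge0//; case/andP: d01.
rewrite !transfer1S; apply: (@le_trans _ _ ((1 + growth_cst * d) ^+ n * transfer (s + d)
  (transfer1 s n) x)).
  rewrite -(transferZ _ s2 x0 fM).
  apply: (transfer_mono s2 x0 (bounded01_transfer1 n sd01) (bounded01M _ fM)) => y y01.
  by apply: ih; lra.
by rewrite exprSr -mulrA ler_wpM2l// transfer_incr_transfer1.
Qed.

Lemma transfer1_mono s s' n x : 0 <= s -> s <= s' -> s' <= 1 -> 0 <= x <= 1 ->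
  transfer1 s n x <= transfer1 s' n x.
Proof.
move=> s0 ss s1; elim: n x => [|n ih] x x01; first by rewrite !transfer10.
rewrite !transfer1S; have s01 : 0 <= s <= 1 by lra.
have s01' : 0 <= s' <= 1 by lra.
have x0 : 0 <= x by lra.
have s2 : s <= 2 by lra.
have s2' : s' <= 2 by lra.
apply: (@le_trans _ _ (transfer s' (transfer1 s n) x)).
  apply: (transfer_mono_s s2' ss x0 (bounded01_transfer1 n s01)) => y y01.
  by apply/ltW/transfer1_gt0 => //; lra.
apply: (transfer_mono s2' x0 (bounded01_transfer1 n s01) (bounded01_transfer1 n s01')) =>
  y y01.
by apply: ih; lra.
Qed.

Lemma growth_rate_le s s' : 0 <= s -> s <= s' -> s' <= 1 -> growth_rate s <= growth_rate s'.
Proof.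
move=> s0 ss s1; apply: (@exp_le_compare _ 4); rewrite ?growth_rate_gt0// => n.
have s01 : 0 <= s <= 1 by lra.
have s01' : 0 <= s' <= 1 by lra.
have /andP[_ h1] := growth_rate_itv n s01; have /andP[h2 _] := growth_rate_itv n s01'.
have h3 := transfer1_harnack n s01.
have := @transfer1_mono s s' n 0 s0 ss s1; rewrite lexx ler01 => /(_ isT) h4.
apply: (le_trans h1); apply: (le_trans h3); rewrite ler_pM2l//.
exact: le_trans h2.
Qed.

Lemma growth_rate_incr s d : 0 <= s -> 0 <= d <= 1 -> s + d <= 1 ->
  growth_rate (s + d) <= (1 + growth_cst * d) * growth_rate s.
Proof.
move=> s0 d01 sd; apply: (@exp_le_compare _ 4); rewrite ?mulr_gt0 ?growth_rate_gt0//.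
  by rewrite ltr_wpDr// mulr_ge0 ?growth_cst_ge0//; case/andP: d01.
move=> n.
have s01 : 0 <= s <= 1 by lra.
have s01' : 0 <= s + d <= 1 by lra.
have /andP[h1 _] := growth_rate_itv n s01; have /andP[_ h2] := growth_rate_itv n s01'.
have h3 := transfer1_harnack n s01'.
have := @transfer1_incr s d n 0 s0 d01 sd; rewrite lexx ler01 exprMn => /(_ isT) h4.
apply: (le_trans h2); apply: (le_trans h3); rewrite ler_pM2l//.
apply: (le_trans h4); apply: ler_wpM2l h1.
by rewrite exprn_ge0// addr_ge0// mulr_ge0 ?growth_cst_ge0//; case/andP: d01.
Qed.

(* Two consecutive digits contribute [(a + x) * (b + (a + x)^-1) >= 2]. *)
Lemma transfer2_op_incr s s' g x : 0 <= s -> s <= s' -> s' <= 1 -> 0 <= x <= 1 ->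
  cone s g ->
  2 `^ (2 * (s' - s)) * transfer s (transfer s g) x <= transfer s' (transfer s' g) x.
Proof.
move=> s0 ss s1 x01 gC; have s01 : 0 <= s <= 1 by lra.
have gM := cone_bounded gC; have kC := cone_transfer s01 gC.
have s2 : s <= 2 by lra.
have s2' : s' <= 2 by lra.
have x0 : 0 <= x by lra.
have kM := cone_bounded kC; have [g0 _ _] := gC; have [k0 _ _] := kC.
have kM' := bounded01_transfer s2' gM.
set c := 2 `^ _; have c0 : 0 < c by apply: powR_gt0.
rewrite -ler_pdivlMl//; apply: (transfer_le s2 s2' x0 x0 kM kM') => n.
rewrite ler_pdivlMl// /transfer_term /transfer_weight -!mulrA mulrCA ler_wpM2l ?invr_ge0
  ?exprn_ge0//.
have n1 : (1 : R) <= n.+1%:R by rewrite ler1n.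
set X := n.+1%:R + x.
have X1 : 1 <= X by rewrite /X; lra.
have X0 : 0 < X by lra.
have Xi0 : 0 < X^-1 by rewrite invr_gt0.
have Xi : 0 <= X^-1 by apply: ltW.
have Xi1 : X^-1 <= 1 by rewrite invf_le1//.
have kk : (1 + X^-1) `^ (2 * (s' - s)) * transfer s g X^-1 <= transfer s' g X^-1.
  set e := _ `^ _; have e0 : 0 < e by apply: powR_gt0; lra.
  rewrite -ler_pdivlMl//; apply: (transfer_le s2 s2' Xi Xi gM gM) => m.
  rewrite ler_pdivlMl// /transfer_term mulrA ler_wpM2r ?(ltW (g0 _ _)) ?invr_ge0//.
    have : (1 : R) <= m.+1%:R by rewrite ler1n.
    lra.
  rewrite /transfer_weight mulrCA ler_wpM2l ?invr_ge0 ?exprn_ge0//.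
  have m1 : (1 : R) <= m.+1%:R by rewrite ler1n.
  have Y0 : 0 < m.+1%:R + X^-1 by lra.
  have -> : 2 * s' = 2 * (s' - s) + 2 * s by ring.
  rewrite powRD ?(lt0r_neq0 Y0) ?implybT// ler_wpM2r ?powR_ge0//.
  by apply: ge0_ler_powR; rewrite ?nnegrE; lra.
apply: (@le_trans _ _ (X `^ (2 * s') * ((1 + X^-1) `^ (2 * (s' - s)) * transfer s g
  X^-1))); last first.
  by rewrite ler_wpM2l ?powR_ge0.
rewrite mulrCA !mulrA ler_wpM2r ?(ltW (k0 _ _))//.
have -> : 2 * s' = 2 * (s' - s) + 2 * s by ring.
rewrite [leLHS]mulrC powRD ?(lt0r_neq0 X0) ?implybT// mulrAC ler_wpM2r ?powR_ge0//.
rewrite -powRM ?(ltW X0)//; last lra.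
rewrite mulrDr mulr1 divff ?lt0r_neq0//.
by apply: ge0_ler_powR; rewrite ?nnegrE; lra.
Qed.

Lemma transfer1_double_incr s s' n x : 0 <= s -> s <= s' -> s' <= 1 -> 0 <= x <= 1 ->
  (2 `^ (2 * (s' - s))) ^+ n * transfer1 s n.*2 x <= transfer1 s' n.*2 x.
Proof.
move=> s0 ss s1; have s01 : 0 <= s <= 1 by lra.
have s01' : 0 <= s' <= 1 by lra.
have s2' : s' <= 2 by lra.
set c := 2 `^ _.
elim: n x => [|n ih] x x01; first by rewrite expr0 mul1r !transfer10.
have x0 : 0 <= x by lra.
have c0 : 0 < c by apply: powR_gt0.
have cn0 : 0 < c ^+ n by apply: exprn_gt0.
rewrite doubleS !transfer1S exprSr -mulrA.
apply: (@le_trans _ _ (c ^+ n * transfer s' (transfer s' (transfer1 s n.*2)) x)).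
  by rewrite ler_pM2l// transfer2_op_incr//; exact: cone_transfer1.
have fM := bounded01_transfer1 n.*2 s01.
have fM' := bounded01_transfer1 n.*2 s01'.
have rM := bounded01_transfer s2' fM.
have rM' := bounded01_transfer s2' fM'.
rewrite -(transferZ _ s2' x0 rM).
apply: (transfer_mono s2' x0 (bounded01M _ rM) rM') => y y01.
have y0 : 0 <= y by lra.
rewrite -(transferZ _ s2' y0 fM).
apply: (transfer_mono s2' y0 (bounded01M _ fM) fM') => z z01.
by apply: ih; lra.
Qed.

(** A single step gains nothing where a + x = 1. The strict gain [c] is therefore one per pair of
    steps, and the rates are compared through their squares. *)
Lemma growth_rate_lt s s' : 0 <= s -> s < s' -> s' <= 1 -> growth_rate s < growth_rate s'.
Proof.
move=> s0 ss s1; have s01 : 0 <= s <= 1 by lra.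
have s01' : 0 <= s' <= 1 by lra.
set c := 2 `^ (2 * (s' - s)) : R.
have c1 : 1 < c.
  by rewrite /c /powR pnatr_eq0/= expR_gt1; apply: mulr_gt0; [lra|rewrite ln_gt0// ltr1n].
have := growth_rate_gt0 s; have := growth_rate_gt0 s'; set u := growth_rate s; set v :=
  growth_rate s' => v0 u0.
suff : c * u ^+ 2 <= v ^+ 2.
  move=> h; rewrite ltNge; apply/negP => vu.
  have uu : 0 < u ^+ 2 by rewrite exprn_gt0.
  have : v ^+ 2 <= u ^+ 2 by rewrite ler_sqr ?nnegrE ?(ltW u0) ?(ltW v0).
  by apply/negP; rewrite -ltNge; apply: lt_le_trans h; rewrite ltr_pMl.
apply: (@exp_le_compare _ 4); rewrite ?mulr_gt0 ?exprn_gt0//.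
  by lra.
move=> n; rewrite exprMn -!exprM.
have /andP[_ h1] := growth_rate_itv (2 * n) s01; have /andP[h2 _] :=
  growth_rate_itv (2 * n) s01'.
have h3 := transfer1_harnack (2 * n) s01.
have := @transfer1_double_incr s s' n 0 s0 (ltW ss) s1; rewrite lexx ler01 -mul2n =>
  /(_ isT) h4.
have c0 : 0 <= c ^+ n by apply: exprn_ge0; lra.
apply: (@le_trans _ _ (4 * transfer1 s' (2 * n) 0)).
  apply: (@le_trans _ _ (4 * (c ^+ n * transfer1 s (2 * n) 0))); last by rewrite ler_pM2l.
  by rewrite mulrCA ler_wpM2l//; exact: le_trans h3.
rewrite ler_pM2l//; exact: h2.
Qed.

(** At [s = 0] the weights are 4^-a, with sum 1/3, so that one step decides. *)
Lemma growth_rate0_lt1 : growth_rate (0 : R) < 1.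
Proof.
have s01 : 0 <= (0 : R) <= 1 by rewrite lexx ler01.
have /andP[+ _] := growth_rate_itv 1 s01; have /andP[_] := growth_rate_itv 1 s01.
rewrite expr1 => h _; apply: (le_lt_trans h).
have -> : transfer1 0 1 1 = transfer 0 (cst 1) 1 :> R.
  by rewrite transfer1S; apply: transfer_ext => // y _; rewrite transfer10.
apply: (@le_lt_trans _ _ 2^-1); last lra.
have b1 : bounded01 (1 : R) (cst 1) by move=> y _; rewrite normr1.
rewrite transferE; apply: limr_le; first exact: (cvg_transfer_term _ _ b1).
near=> n; rewrite /series/=.
suff -> : \sum_(0 <= k < n) transfer_term 0 (cst 1) 1 k = 3^-1 - 3^-1 * 4^-1 ^+ n :> R.
  by have : 0 <= (4^-1 : R) ^+ n by []; lra.
elim: (n) => [|k ih]; first by rewrite big_geq// expr0; ring.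
rewrite big_nat_recr//= ih /transfer_term /transfer_weight mulr0 powRr0 !mulr1 -exprVn
  exprS.
by field.
Unshelve. all: by end_near. Qed.

(* [17/16] is a lower bound for the first three terms of
   [sum_a 4^-a ((a + x)^2 + (a + x))] relative to [1 + x]. *)
Lemma transfer1_op_ge x : 0 <= x <= 1 ->
  17 / 16 * (1 + x) <= transfer 1 (fun y => 1 + y) x :> R.
Proof.
move=> x01; have x0 : 0 <= x by lra.
have gM : bounded01 (2 : R) (fun y => 1 + y) by move=> y y01; rewrite ger0_norm; lra.
have t0 n : 0 <= transfer_term 1 (fun y => 1 + y) x n.
  rewrite mulr_ge0 ?transfer_weight_ge0// addr_ge0//.
  by have /andP[/ltW] := shift_inv_itv n x0.
have tE n : transfer_term 1 (fun y =>
  1 + y) x n = 4^-1 ^+ n.+1 * ((n.+1%:R + x) ^+ 2 + (n.+1%:R + x)).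
  rewrite /transfer_term /transfer_weight mulr1 powR_mulrn ?addr_ge0// -exprVn -mulrA
    mulrDr mulr1.
  by rewrite expr2 mulfK// gt_eqF// ltr_wpDr.
have s2 : (1 : R) <= 2 by lra.
rewrite transferE; apply: limr_ge; first exact: (cvg_transfer_term s2 x0 gM).
near=> n; have n3 : (3 <= n)%N by near: n; exact: nbhs_infty_ge.
rewrite /series/= (big_cat_nat (leq0n 3) n3)/=.
apply: (@le_trans _ _ (\sum_(0 <= k < 3) transfer_term 1 (fun y => 1 + y) x k)); last first.
  by rewrite lerDl sumr_ge0.
rewrite !big_nat_recl//= big_geq// addr0 !tE !exprS expr0.
nra.
Unshelve. all: by end_near. Qed.

(** The test function 1 + y grows by 17/16 in every step at every point. The constant 1 does not
    show growth so directly, since K_1 1 (0) = 20/27. As 1 + y <= 2, the gain passes to the iterates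
    of 1 up to a constant. *)
Lemma rho1_gt1 : 1 < growth_rate (1 : R).
Proof.
apply: (@lt_le_trans _ _ (17 / 16)); first lra.
have s01 : 0 <= (1 : R) <= 1 by rewrite lexx ler01.
apply: (@exp_le_compare _ 8) => [||n]; [lra|exact: growth_rate_gt0|].
have gM : bounded01 (2 : R) (fun y => 1 + y) by move=> y y01; rewrite ger0_norm; lra.
have b1 : bounded01 (1 : R) (cst 1) by move=> y _; rewrite normr1.
have s2 : (1 : R) <= 2 by lra.
have lo x : 0 <= x <= 1 -> (17 / 16) ^+ n * (1 + x) <= iter n (transfer 1) (fun y =>
  1 + y) x.
  elim: n x => [|n ih] x x01; first by rewrite expr0 mul1r.
  have x0 : 0 <= x by lra.
  apply: (@le_trans _ _ ((17 / 16) ^+ n * transfer 1 (fun y => 1 + y) x)).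
    by rewrite exprSr -mulrA ler_wpM2l ?transfer1_op_ge// exprn_ge0//; lra.
  rewrite -(transferZ _ s2 x0 gM)/=.
  apply: (transfer_mono s2 x0 (bounded01M _ gM) (bounded01_iter n s2 gM)) => y y01.
  by apply: ih; lra.
have hi : iter n (transfer 1) (fun y => 1 + y) 0 <= 2 * transfer1 1 n 0.
  rewrite transfer1E -(iter_transferZ _ _ s2 b1); last by rewrite lexx ler01.
  apply: (iter_transfer_mono _ s2 gM (bounded01M _ b1)); last by rewrite lexx ler01.
  by move=> y y01; rewrite /=; lra.
have /andP[h _] := growth_rate_itv n s01.
have := lo 0; rewrite lexx ler01 => /(_ isT).
have : 0 < growth_rate (1 : R) ^+ n by rewrite exprn_gt0// growth_rate_gt0.
lra.
Qed.

Lemma growth_rate_eq1 : exists2 s : R, 0 < s < 1 & growth_rate s = 1.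
Proof.
(* Extended by constants outside [0, 1], the growth rate is Lipschitz on the whole line by
   [growth_rate_incr], and the intermediate value theorem applies. *)
pose clamp (s : R) := Num.max 0 (Num.min s 1).
have cl s : 0 <= clamp s <= 1 by rewrite le_max lexx/= ge_max ge_min lexx orbT ler01.
have lip s s' : s <= s' -> growth_rate (clamp s) <= growth_rate (clamp s') <=
  growth_rate (clamp s) + growth_cst * (s' - s) * growth_rate 1.
  move=> ss; have := cl s; have := cl s' => cs' cs.
  have c1 : clamp s <= clamp s'.
    by rewrite /clamp !maxEle !minEle; do ?case: ifPn; rewrite -?ltNge => *; lra.
  have c2 : clamp s' - clamp s <= s' - s.
    by rewrite /clamp !maxEle !minEle; do ?case: ifPn; rewrite -?ltNge => *; lra.
  rewrite growth_rate_le//=; [|lra|lra].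
  have := @growth_rate_incr (clamp s) (clamp s' - clamp s) ltac:(lra) ltac:(lra) ltac:(lra).
  rewrite subrKC => h.
  have h2 : growth_rate (clamp s) <= growth_rate 1 by apply: growth_rate_le; lra.
  apply: (le_trans h); rewrite mulrDl mul1r lerD2l.
  have k0 := growth_cst_ge0.
  apply: ler_pM => //; first by rewrite mulr_ge0// subr_ge0.
    exact/ltW/growth_rate_gt0.
  by rewrite ler_wpM2l.
have ct : {within `[0, 1], continuous (fun s => growth_rate (clamp s))}.
  apply: continuous_subspaceT => x; apply/cvgrPdist_lt => e e0.
  have r0 := growth_rate_gt0 (1 : R).
  have k0 : 0 < growth_cst by rewrite /growth_cst !mulr_gt0.
  near=> y.
  have : `|x - y| < e / (growth_cst * growth_rate 1).
    near: y; apply: cvgr_dist_lt => //; first by rewrite divr_gt0 ?mulr_gt0.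
  rewrite ltr_pdivlMr ?mulr_gt0// => h.
  have [xy|yx] := leP x y.
    have /andP[h1 h2] := lip _ _ xy.
    rewrite ler0_norm in h; last lra.
    rewrite ler0_norm; lra.
  have /andP[h1 h2] := lip _ _ (ltW yx).
  rewrite ger0_norm in h; last lra.
  rewrite ger0_norm; lra.
have c0 : clamp 0 = 0 by rewrite /clamp min_l// max_l.
have c1 : clamp 1 = 1 by rewrite /clamp min_l// max_r.
have l0 := growth_rate0_lt1; have l1 := rho1_gt1.
have [|s sI rs] := @IVT _ _ 0 1 1 ler01 ct.
  by rewrite c0 c1 ge_min le_max (ltW l0) (ltW l1) orbT.
have s01 : 0 <= s <= 1 by move: sI; rewrite in_itv.
have cs : clamp s = s by rewrite /clamp min_l ?max_r//; lra.
rewrite cs in rs; exists s => //.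
apply/andP; split; rewrite lt_neqAle; apply/andP; split; try lra.
  by apply/eqP => s0; rewrite -s0 in rs; lra.
by apply/eqP => s0; rewrite s0 in rs; lra.
Unshelve. all: by end_near. Qed.

End growth.

(** * Spectrum of the transfer operator on C([0, 1]) *)

Section complex_functions.
Context {R : realType}.
Implicit Types (f g h : R -> R[i]^o) (x y M : R).
Notation normc := Normc.normc.
Notation Re := complex.Re.
Notation Im := complex.Im.

Lemma normc_gt0P (e : R[i]) : 0 < e -> exists2 d : R, 0 < d & e = d%:C%C.
Proof.
case: e => a b; rewrite ltcE/= => /andP[/eqP b0 a0]; exists a => //.
by rewrite b0.
Qed.

Lemma norm_normc (z : R[i]^o) : `|z| = ((normc z)%:C)%C :> R[i].
Proof. by rewrite normc_def; case: z. Qed.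

Lemma normc_ge0 (z : R[i]) : 0 <= normc z.
Proof. by case: z => a b; rewrite sqrtr_ge0. Qed.

Lemma normc_Re (z : R[i]) : `|Re z| <= normc z.
Proof. by have := normc_ge_Re z; rewrite norm_normc lecR. Qed.

Lemma normc_Im (z : R[i]) : `|Im z| <= normc z.
Proof.
case: z => a b /=; rewrite -(sqrtr_sqr b); apply: ler_wsqrtr.
by rewrite lerDr sqr_ge0.
Qed.

Lemma normc_le (z : R[i]) : normc z <= `|Re z| + `|Im z|.
Proof.
case: z => a b /=.
rewrite -[leRHS]ger0_norm ?addr_ge0// -sqrtr_sqr; apply: ler_wsqrtr.
rewrite -(real_normK (num_real a)) -(real_normK (num_real b)).
by rewrite sqrrD -addrA lerD2l lerDr mulrn_wge0// mulr_ge0.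
Qed.

Lemma normc_real x : 0 <= x -> normc (x%:C)%C = x.
Proof. by move=> x0; rewrite /= expr0n addr0 sqrtr_sqr ger0_norm. Qed.

Lemma normcB (u v : R[i]) : normc (u - v) <= normc u + normc v.
Proof. by rewrite (le_trans (le_normcD _ _))// normcN. Qed.

Lemma cvg_complex (u : nat -> R[i]^o) (a b : R) :
  (fun n => Re (u n)) @ \oo --> a -> (fun n => Im (u n)) @ \oo --> b ->
  u @ \oo --> ((a +i* b)%C : R[i]^o).
Proof.
move=> /cvgrPdist_lt ua /cvgrPdist_lt ub; apply/cvgrPdist_lt => _ /normc_gt0P[d d0 ->].
have d2 : 0 < d / 2 by rewrite divr_gt0.
have := ua _ d2; have := ub _ d2; apply: filterS2 => n h1 h2.
rewrite norm_normc ltcR (le_lt_trans (normc_le _))//.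
move: (u n) h1 h2 => [p q] /= h1 h2.
lra.
Qed.

(** The norm of [R[i]^o] takes its values in [R[i]]; this form has real radii and [normc] only. *)
Lemma C01P g : C01 g <-> forall x, 0 <= x <= 1 -> forall e, 0 < e ->
  exists2 d, 0 < d & forall y, 0 <= y <= 1 -> `|x - y| < d -> normc (g x - g y) < e.
Proof.
rewrite /C01/=; split.
  move=> /subspace_continuousP gc x x01 e e0.
  have xI : `[(0 : R), 1]%classic x by rewrite /= in_itv.
  have eC : 0 < (e%:C)%C :> R[i] by rewrite ltcR.
  have /cvgrPdist_lt /(_ _ eC) := gc x xI.
  rewrite near_withinE => /nbhs_ballP[d /= d0 dP]; exists d => // y y01 xy.
  have := dP y xy; rewrite /= in_itv/= => /(_ y01).
  by rewrite norm_normc ltcR.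
move=> H; apply/subspace_continuousP => x; rewrite /= in_itv/= => x01.
apply/cvgrPdist_lt => _ /normc_gt0P[e e0 ->].
have [d d0 dP] := H x x01 e e0.
rewrite near_withinE; apply/nbhs_ballP; exists d => // y xy /=.
by rewrite in_itv/= => y01; rewrite norm_normc ltcR; exact: dP.
Qed.

Lemma C01_bounded g : C01 g ->
  exists2 M, 0 <= M & forall x, 0 <= x <= 1 -> normc (g x) <= M.
Proof.
move=> gC; have cn : {within `[0, 1], continuous (fun x => normc (g x))}.
  apply/subspace_continuousP => x; rewrite /= in_itv/= => x01.
  apply/cvgrPdist_lt => e e0.
  have [d d0 dP] := (C01P g).1 gC x x01 e e0.
  rewrite near_withinE; apply/nbhs_ballP; exists d => // y xy /=.
  rewrite in_itv/= => y01; apply: le_lt_trans (dP y y01 xy).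
  have h1 : normc (g x) <= normc (g x - g y) + normc (g y).
    by rewrite -{1}(subrK (g y) (g x)) le_normcD.
  have h2 : normc (g y) <= normc (g x - g y) + normc (g x).
    by rewrite -[g x - g y]opprB normcN -{1}(subrK (g x) (g y)) le_normcD.
  by rewrite ler_norml lerNl opprB !lerBlDr h1 h2.
have [c _ cP] := EVT_max ler01 cn.
by exists (normc (g c)) => [|x x01]; [exact: normc_ge0|apply: cP; rewrite in_itv].
Qed.

Lemma supnorm_ge g x : C01 g -> 0 <= x <= 1 -> normc (g x) <= supnorm g.
Proof.
move=> /C01_bounded[M M0 gM] x01; apply: ub_le_sup; last first.
  by exists x => //; rewrite /= in_itv.
by exists M => _ [y + <-]; rewrite /= in_itv/= => y01; exact: gM.
Qed.

Lemma supnorm_le g M : (forall x, 0 <= x <= 1 -> normc (g x) <= M) -> supnorm g <= M.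
Proof.
move=> gM; apply: ge_sup.
  by exists (normc (g 0)); exists 0 => //; rewrite /= in_itv/= lexx ler01.
by move=> _ [y + <-]; rewrite /= in_itv/= => y01; exact: gM.
Qed.

Lemma C01_lin (l : R[i]) f g : C01 f -> C01 g -> C01 (fun y => l * f y + g y).
Proof.
move=> /C01P fC /C01P gC; apply/C01P => x x01 e e0.
have L0 : 0 < normc l + 1 by rewrite ltr_wpDl// normc_ge0.
have e1 : 0 < e / 2 / (normc l + 1) by rewrite !divr_gt0.
have e2 : 0 < e / 2 by rewrite divr_gt0.
have [d1 d10 h1] := fC x x01 _ e1; have [d2 d20 h2] := gC x x01 _ e2.
exists (Num.min d1 d2); first by rewrite lt_min d10.
move=> y y01; rewrite lt_min => /andP[/(h1 _ y01) k1 /(h2 _ y01) k2].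
rewrite (_ : _ - _ = l * (f x - f y) + (g x - g y)); last by ring.
apply: (le_lt_trans (le_normcD _ _)); rewrite Normc.normcM.
move: k1; rewrite ltr_pdivlMr// => k1.
have := normc_ge0 (f x - f y).
move: (normc (f x - f y)) (normc (g x - g y)) k1 k2 => p q k1 k2 p0.
have : normc l * p <= p * (normc l + 1) by rewrite mulrDr mulr1 mulrC lerDl.
lra.
Qed.

Lemma C01_cst (l : R[i]) : C01 (fun=> l).
Proof.
apply/C01P => x _ e e0; exists 1 => // y _ _.
by rewrite subrr Normc.normc0.
Qed.

Lemma C01_ext f g : (forall x, 0 <= x <= 1 -> f x = g x) -> C01 f -> C01 g.
Proof.
move=> fg /C01P fC; apply/C01P => x x01 e e0.
have [d d0 dP] := fC x x01 e e0; exists d => // y y01 xy.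
by rewrite -!fg//; exact: dP.
Qed.

Lemma C01_uniform (u : nat -> R -> R[i]^o) g : (forall n, C01 (u n)) ->
  (forall e, 0 < e -> exists n, forall x, 0 <= x <= 1 -> normc (g x - u n x) <= e) ->
  C01 g.
Proof.
move=> uC ug; apply/C01P => x x01 e e0.
have e3 : 0 < e / 3 by rewrite divr_gt0.
have [n gn] := ug _ e3; have [d d0 dP] := (C01P _).1 (uC n) x x01 _ e3.
exists d => // y y01 /(dP _ y01) k1.
rewrite (_ : g x - g y = (g x - u n x) + ((u n x - u n y) - (g y - u n y))); last by ring.
have k2 := gn x x01; have k3 := gn y y01.
apply: (le_lt_trans (le_normcD _ _)).
have := normcB (u n x - u n y) (g y - u n y); lra.
Qed.

End complex_functions.

Arguments C01_cst {R} l.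
Arguments C01_lin {R} l {f g}.
Arguments C01_ext {R f g}.
Arguments C01_uniform {R} u {g}.

Section geometric_tail.
Context {R : realType}.

Lemma geometric_sum_le (q : R) (n m : nat) : 0 <= q < 1 ->
  \sum_(n <= k < m) q ^+ k <= q ^+ n / (1 - q).
Proof.
move=> /andP[q0 q1]; have q1' : 0 < 1 - q by lra.
have [nm|mn] := leqP n m; last first.
  by rewrite big_geq 1?ltnW// mulr_ge0 ?exprn_ge0 ?invr_ge0 ?(ltW q1').
suff -> : \sum_(n <= k < m) q ^+ k = (q ^+ n - q ^+ m) / (1 - q).
  by rewrite ler_pM2r ?invr_gt0// lerBlDr lerDl exprn_ge0.
rewrite -(subnK nm); elim: (m - n)%N => [|k ih].
  by rewrite add0n big_geq// subrr mul0r.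
rewrite addSn big_nat_recr ?leq_addl//= ih exprS; field.
by rewrite lt0r_neq0.
Qed.

Lemma geometric_tail (u : nat -> R) (C q : R) : 0 <= q < 1 ->
  (forall k, `|u k| <= C * q ^+ k) ->
  cvgn (series u) /\
  forall n, `|limn (series u) - series u n| <= C * (q ^+ n / (1 - q)).
Proof.
move=> q01 uC; have C0 : 0 <= C by have := uC 0%N; rewrite expr0 mulr1; exact: le_trans.
have cu : cvgn (series u).
  apply: normed_cvg; apply: (@series_le_cvg _ _ (geometric C q)) => [k|k|k|].
  - exact: normr_ge0.
  - by rewrite /geometric/= mulr_ge0 ?exprn_ge0//; case/andP: q01.
  - exact: uC.
  - apply: is_cvg_geometric_series; case/andP: q01 => q0 q1; by rewrite ger0_norm.
split=> // n.
have main m : (n <= m)%N -> `|series u m - series u n| <= C * (q ^+ n / (1 - q)).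
  move=> nm; rewrite /series/= (big_cat_nat (leq0n n) nm)/= addrAC subrr add0r.
  apply: (le_trans (ler_norm_sum _ _ _)).
  apply: (@le_trans _ _ (\sum_(n <= k < m) C * q ^+ k)); first exact: ler_sum.
  by rewrite -mulr_sumr ler_wpM2l// geometric_sum_le.
rewrite ler_norml; apply/andP; split.
  rewrite lerBrDl; apply: limr_ge; first exact: cu.
  near=> m; have nm : (n <= m)%N by near: m; exact: nbhs_infty_ge.
  by have := main m nm; rewrite ler_norml lerBrDl => /andP[+ _].
rewrite lerBlDr; apply: limr_le; first exact: cu.
near=> m; have nm : (n <= m)%N by near: m; exact: nbhs_infty_ge.
by have := main m nm; rewrite ler_norml lerBlDr => /andP[_].
Unshelve. all: by end_near. Qed.

Lemma geometric_small (C q e : R) : 0 <= q < 1 -> 0 < e -> exists n, C * q ^+ n <= e.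
Proof.
move=> /andP[q0 q1] e0.
have : (fun n => C * q ^+ n) @ \oo --> C * 0.
  by apply: cvgMl_tmp; apply: cvg_expr; rewrite ger0_norm.
rewrite mulr0 => /cvgrPdist_lt /(_ _ e0)[n _ /(_ n (leqnn n))/=].
rewrite sub0r normrN => h; exists n; apply: le_trans (ltW h); exact: ler_norm.
Qed.

End geometric_tail.

(** * Inversion of [l - K] by a Neumann series *)

Section neumann.
Context {R : realType}.
Implicit Types (f g h : R -> R[i]^o) (x y M : R).
Notation normc := Normc.normc.
Notation Re := complex.Re.
Notation Im := complex.Im.
Local Opaque C01.
Variables (K : (R -> R[i]^o) -> R -> R[i]^o) (A r : R) (l : R[i]).
Hypotheses (KC : forall g, C01 g -> C01 (K g))
  (Klin : forall (a : R[i]) f g x, C01 f -> C01 g -> 0 <= x <= 1 ->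
     K (fun y => a * f y + g y) x = a * K f x + K g x)
  (Kext : forall f g x, (forall y, 0 <= y <= 1 -> f y = g y) -> 0 <= x <= 1 ->
     K f x = K g x)
  (Kpow : forall n g M x, C01 g -> (forall y, 0 <= y <= 1 -> normc (g y) <= M) ->
     0 <= x <= 1 -> normc (iter n K g x) <= A * r ^+ n * M)
  (r0 : 0 < r) (rl : r < normc l).

Let l0 : 0 < normc l. Proof. exact: lt_trans rl. Qed.

Let q := r / normc l.

Let q01 : 0 <= q < 1.
Proof. by rewrite divr_ge0 ?(ltW r0) ?(ltW l0)//= ltr_pdivrMr// mul1r. Qed.

Let l_neq0 : l != 0.
Proof. by apply/eqP => lE; move: l0; rewrite lE Normc.normc0 ltxx. Qed.

Let T g n x : R[i] := l ^- n.+1 * iter n K g x.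

Let S g n x : R[i]^o := \sum_(0 <= k < n) T g k x.

(** The limit is taken separately in the real and imaginary parts, to which [geometric_tail]
    applies. *)
Let B g x : R[i]^o := (limn (series (fun k => Re (T g k x))) +i*
                       limn (series (fun k => Im (T g k x))))%C.

Let iterC g n : C01 g -> C01 (iter n K g).
Proof. by move=> gC; elim: n => [|n ih]; [exact: gC|exact: KC]. Qed.

Let T_le g M n x : C01 g -> (forall y, 0 <= y <= 1 -> normc (g y) <= M) ->
  0 <= x <= 1 -> normc (T g n x) <= A * M / normc l * q ^+ n.
Proof.
move=> gC gM x01; rewrite /T Normc.normcM Normc.normcV.
have nX k : normc (l ^+ k) = normc l ^+ k.
  by elim: k => [|k ih]; rewrite ?expr0 ?Normc.normc1// !exprS Normc.normcM ih.
rewrite nX exprS invfM /q exprMn exprVn.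
have := Kpow n gC gM x01; have p0 : 0 < normc l ^+ n by rewrite exprn_gt0.
have -> : A * M / normc l * (r ^+ n / normc l ^+ n) =
   (normc l)^-1 / normc l ^+ n * (A * r ^+ n * M) by ring.
by move=> h; rewrite ler_wpM2l// mulr_ge0// invr_ge0 ltW.
Qed.

(** The factor 2 counts one geometric tail for the real part and one for the imaginary part. *)
Let cB M : R := 2 * (A * M / normc l) / (1 - q).

Let B_S g M n x : C01 g -> (forall y, 0 <= y <= 1 -> normc (g y) <= M) ->
  0 <= x <= 1 ->
  normc (B g x - S g n x) <= cB M * q ^+ n.
Proof.
move=> gC gM x01.
have [_ h1] := geometric_tail q01 (fun k => le_trans (normc_Re _) (T_le k gC gM x01)).
have [_ h2] := geometric_tail q01 (fun k => le_trans (normc_Im _) (T_le k gC gM x01)).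
apply: (le_trans (normc_le _)).
have := lerD (h1 n) (h2 n).
have -> : series (fun k => Re (T g k x)) n = Re (S g n x).
  by rewrite /series /S/= raddf_sum.
have -> : series (fun k => Im (T g k x)) n = Im (S g n x).
  by rewrite /series /S/= raddf_sum.
move=> h; apply: le_trans (le_trans h _); last first.
  by rewrite /cB le_eqVlt; apply/predU1P; left; ring.
by rewrite /B !raddfB.
Qed.

Let S_C01 g n : C01 g -> C01 (S g n).
Proof.
move=> gC; elim: n => [|n ih].
  by apply: (C01_ext _ (C01_cst 0)) => x _; rewrite /S big_geq.
apply: (C01_ext _ (C01_lin (l ^- n.+1) (@iterC g n gC) ih)) => x _.
by rewrite /S big_nat_recr//= addrC.
Qed.

(** All identities for [B] are obtained in this way: partial sums satisfy them exactly or up to one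
    term, and the defect decays like [q ^+ n]. *)
Let eq0_small (z : R[i]) C : (forall n, normc z <= C * q ^+ n) -> z = 0.
Proof.
move=> h; apply: Normc.eq0_normc; apply/eqP; rewrite eq_le normc_ge0 andbT.
apply/ler_addgt0Pl => e e0; rewrite addr0.
have [n nC] := geometric_small C q01 e0.
exact: le_trans (h n) nC.
Qed.

Let iter_lin a f g n x : C01 f -> C01 g -> 0 <= x <= 1 ->
  iter n K (fun y => a * f y + g y) x = a * iter n K f x + iter n K g x.
Proof.
move=> fC gC; elim: n x => [//|n ih] x x01.
rewrite -[RHS](Klin a (@iterC f n fC) (@iterC g n gC) x01).
by apply: (Kext _ x01) => y y01; exact: ih.
Qed.

Let iter_ext f g n x : (forall y, 0 <= y <= 1 -> f y = g y) -> 0 <= x <= 1 ->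
  iter n K f x = iter n K g x.
Proof.
move=> fg; elim: n x => [|n ih] x x01; first exact: fg.
by apply: (Kext _ x01) => y y01; exact: ih.
Qed.

Let S_lin a f g n x : C01 f -> C01 g -> 0 <= x <= 1 ->
  S (fun y => a * f y + g y) n x = a * S f n x + S g n x.
Proof.
move=> fC gC x01; rewrite /S mulr_sumr -big_split/=; apply: eq_bigr => k _.
by rewrite /T iter_lin//; ring.
Qed.

Let B_C01 g : C01 g -> C01 (B g).
Proof.
move=> gC; have [M M0 gM] := C01_bounded gC.
apply: (C01_uniform (S g)) => [n|e e0]; first exact: (@S_C01 g n gC).
have [n nC] := geometric_small (cB M) q01 e0.
by exists n => x x01; apply: le_trans nC; exact: (B_S n gC gM x01).
Qed.

Let B_lin a f g x : C01 f -> C01 g -> 0 <= x <= 1 ->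
  B (fun y => a * f y + g y) x = a * B f x + B g x.
Proof.
move=> fC gC x01; have fgC := C01_lin a fC gC.
have [M M0 fM] := C01_bounded fC; have [M' M0' gM] := C01_bounded gC.
have [M'' M0'' fgM] := C01_bounded fgC.
apply/eqP; rewrite -subr_eq0; apply/eqP.
apply: (@eq0_small _ (cB M'' + (normc a * cB M + cB M'))) => n.
rewrite (_ : _ - _ = (B (fun y => a * f y + g y) x - S (fun y => a * f y + g y) n x)
  - (a * (B f x - S f n x) + (B g x - S g n x))); last first.
  by rewrite (S_lin a n fC gC x01); ring.
apply: (le_trans (normcB _ _)); rewrite !mulrDl; apply: lerD;
  first exact: (B_S n fgC fgM x01).
apply: (le_trans (le_normcD _ _)); apply: lerD; last exact: (B_S n gC gM x01).
rewrite Normc.normcM -mulrA; apply: ler_wpM2l; first exact: normc_ge0.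
exact: (B_S n fC fM x01).
Qed.

Let B_bounded : exists M, forall g, C01 g -> supnorm (B g) <= M * supnorm g.
Proof.
exists (2 * (A / normc l) / (1 - q)) => g gC; apply: supnorm_le => x x01.
have := B_S 0 gC (fun y => supnorm_ge gC) x01.
rewrite {1}/S big_geq// subr0 expr0 mulr1 => h; apply: (le_trans h).
by rewrite /cB le_eqVlt; apply/predU1P; left; ring.
Qed.

Let S_rec g n x : l * S g n.+1 x = g x + \sum_(0 <= k < n) l ^- k.+1 * iter k.+1 K g x.
Proof.
rewrite /S big_nat_recl// mulrDr {1}/T expr1 mulrA divff// mul1r; congr (_ + _).
rewrite mulr_sumr; apply: eq_bigr => k _.
by rewrite /T mulrA [l ^+ k.+2]exprS invfM mulrA divff// mul1r.
Qed.

Let K_S g n x : C01 g -> 0 <= x <= 1 ->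
  K (S g n) x = \sum_(0 <= k < n) l ^- k.+1 * iter k.+1 K g x.
Proof.
move=> gC; elim: n x => [|n ih] x x01.
  rewrite big_geq//.
  have z : C01 (fun=> 0 : R[i]^o) := C01_cst 0.
  have -> : K (S g 0) x = K (fun=> 0) x.
    by apply: (Kext _ x01) => y _; rewrite /S big_geq.
  (* Additivity applied to 0 = 0 + 0 yields that [K] vanishes on the zero function. *)
  have := Klin 1 z z x01; rewrite !mul1r.
  rewrite (Kext (g := fun=> 0) _ x01); last by move=> y _; rewrite addr0.
  by move/eqP; rewrite -subr_eq0 opprD addrA subrr sub0r oppr_eq0 => /eqP.
rewrite big_nat_recr//= -(ih _ x01) addrC.
rewrite -[RHS](Klin (l ^- n.+1) (@iterC g n gC) (@S_C01 g n gC) x01).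
by apply: (Kext _ x01) => y _; rewrite /S big_nat_recr//= addrC.
Qed.

Let right_inv g x : C01 g -> 0 <= x <= 1 -> l * B g x - K (B g) x = g x.
Proof.
move=> gC x01; have [M M0 gM] := C01_bounded gC.
set C := cB M.
apply/eqP; rewrite -subr_eq0; apply/eqP.
have BC := B_C01 gC.
apply: (@eq0_small _ (normc l * (C * q) + A * r ^+ 1 * C)) => n.
have KB : K (fun y => -1 * S g n y + B g y) x = K (B g) x - K (S g n) x.
  by rewrite (Klin (-1) (@S_C01 g n gC) BC x01) mulN1r addrC.
rewrite (_ : _ - _ = l * (B g x - S g n.+1 x) - K (fun y => -1 * S g n y + B g y) x);
  last first.
  rewrite KB mulrBr S_rec -(K_S n gC x01); ring.
apply: (le_trans (normcB _ _)); rewrite mulrDl; apply: lerD.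
  rewrite Normc.normcM -[normc l * _ * _]mulrA -[C * q * _]mulrA -exprS;
    apply: ler_wpM2l; first exact: normc_ge0.
  exact: (B_S n.+1 gC gM x01).
rewrite -[leRHS]mulrA.
(* At exponent 1 the power bound says that [K] is bounded, which is what lets it pass to the limit
   of the partial sums. *)
apply: (@Kpow 1 (fun y => -1 * S g n y + B g y) _ _ _ _ x01) => [|y y01].
  exact: (C01_lin (-1) (@S_C01 g n gC) BC).
by rewrite mulN1r addrC; exact: (B_S n gC gM y01).
Qed.

Let left_inv g x : C01 g -> 0 <= x <= 1 -> B (fun y => l * g y - K g y) x = g x.
Proof.
move=> gC x01; have [M M0 gM] := C01_bounded gC.
have KgC := KC gC.
set h := (fun y => _); have hC : C01 h.
  apply: (C01_ext _ (C01_lin (-1) KgC (C01_lin l gC (C01_cst 0)))) => y _.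
  by rewrite /h mulN1r addr0 addrC.
have [M' M0' hM] := C01_bounded hC.
apply/eqP; rewrite -subr_eq0; apply/eqP.
apply: (@eq0_small _ (cB M' + A * M / normc l * normc l)) => n.
have iterh k : iter k K h x = l * iter k K g x - iter k.+1 K g x.
  have e1 : iter k K h x = iter k K (fun y => l * g y + (-1 * K g y + 0)) x.
    by apply: (iter_ext k _ x01) => y _; rewrite /h mulN1r addr0.
  have K0C : C01 (fun y => -1 * K g y + 0) by exact: (C01_lin (-1) KgC (C01_cst 0)).
  have z : C01 (fun=> 0 : R[i]^o) := C01_cst 0.
  rewrite e1 (iter_lin l k gC K0C x01) (iter_lin (-1) k KgC z x01) mulN1r iterSr.
  have := iter_lin 1 k z z x01; rewrite !mul1r.
  rewrite (iter_ext (g := fun=> 0) k _ x01); last by move=> y _; rewrite addr0.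
  move/eqP; rewrite -subr_eq0 opprD addrA subrr sub0r oppr_eq0 => /eqP ->.
  by rewrite addr0.
(* The partial sums telescope, since [h] is [l * g - K g]. *)
have Sh : S h n x = g x - l ^- n * iter n K g x.
  elim: n => [|n ih]; first by rewrite /S big_geq// expr0 invr1 mul1r subrr.
  rewrite /S big_nat_recr//= -/(S h n x) ih /T iterh.
  rewrite mulrBr mulrA [l ^+ n.+1]exprSr invfM -[_^-1 / _ * l]mulrA mulVf// mulr1.
  by rewrite iterS; ring.
rewrite (_ : _ - _ = (B h x - S h n x) - l * T g n x); last first.
  rewrite Sh /T mulrA exprS invfM mulrA divff// mul1r; ring.
apply: (le_trans (normcB _ _)); rewrite mulrDl; apply: lerD; first exact: (B_S n hC hM x01).
rewrite Normc.normcM mulrC -[leRHS]mulrA [normc l * _]mulrC mulrA.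
apply: ler_wpM2r; first exact: normc_ge0.
exact: (T_le n gC gM x01).
Qed.

(** Only the growth of the powers of [K] enters and not its norm, so that every [l] outside the disk
    of radius [r] is reached even if the norm of [K] exceeds [r]. *)
Lemma neumann_resolvent : resolvent_set K l.
Proof.
exists B; last by move=> g x gC x01; split; [exact: left_inv|exact: right_inv].
by split; [exact: B_C01|exact: B_lin|exact: B_bounded].
Qed.

End neumann.

(** * The spectral radius of [K_op] *)

Section transfer_operator_spectrum.
Context {R : realType}.
Implicit Types (f g h : R -> R[i]^o) (s x y M : R).
Notation normc := Normc.normc.
Notation Re := complex.Re.
Notation Im := complex.Im.

Definition bounded_on01 M g := forall y, 0 <= y <= 1 -> normc (g y) <= M.

Lemma bounded01_Re M g : bounded_on01 M g -> bounded01 M (fun y => Re (g y)).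
Proof. by move=> gM y y01; apply: le_trans (normc_Re _) (gM _ _); lra. Qed.

Lemma bounded01_Im M g : bounded_on01 M g -> bounded01 M (fun y => Im (g y)).
Proof. by move=> gM y y01; apply: le_trans (normc_Im _) (gM _ _); lra. Qed.

Lemma K_op_partialE s g x n :
  \sum_(1 <= a < n.+1) ((4 ^- a * (a%:R + x) `^ (2 * s))%:C%C * g (a%:R + x)^-1 : R[i]^o) =
  (series (transfer_term s (fun y => Re (g y)) x) n +i* series (transfer_term s (fun y =>
    Im (g y)) x) n)%C.
Proof.
rewrite big_add1/= /series/=; elim: n => [|n ih]; first by rewrite !big_geq.
rewrite !big_nat_recr//= ih /transfer_term /transfer_weight.
by case: (g _) => a b; rewrite /GRing.mul/= !mul0r subr0 addr0.
Qed.

(** The weights are real, so that the complex operator acts on the real and imaginary parts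
    separately. *)
Lemma K_opE s g x M : s <= 2 -> 0 <= x -> bounded_on01 M g ->
  K_op s g x = (transfer s (fun y => Re (g y)) x +i* transfer s (fun y => Im (g y)) x)%C.
Proof.
move=> s2 x0 gM; rewrite /K_op !transferE.
apply: cvg_lim; first exact: norm_hausdorff.
rewrite -cvg_shiftS.
under eq_fun do rewrite K_op_partialE.
apply: cvg_complex => /=.
  exact: cvg_transfer_term s2 x0 (bounded01_Re gM).
exact: cvg_transfer_term s2 x0 (bounded01_Im gM).
Qed.

(** Elements of C([0, 1]) are represented by functions on the whole line; the operator must not see
    their values outside [0, 1]. *)
Lemma K_op_ext s f g x : 0 <= x <= 1 -> (forall y, 0 <= y <= 1 -> f y = g y) ->
  K_op s f x = K_op s g x.
Proof.
move=> x01 fg; rewrite /K_op.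
pose F h n : R[i]^o := \sum_(1 <= a < n)
  ((4 ^- a * (a%:R + x) `^ (2 * s))%:C%C * h (a%:R + x)^-1 : R[i]^o).
suff e : F f = F g by rewrite -[RHS]/(limn (F g)) -e.
apply/funext => n.
apply: eq_big_nat => -[//|a] _; rewrite fg//.
have x0 : 0 <= x by lra.
by have /andP[/ltW-> ->] := shift_inv_itv a x0.
Qed.

Lemma complex_ReM (z w : R[i]) : Re (z * w) = Re z * Re w - Im z * Im w.
Proof. by case: z; case: w. Qed.

Lemma complex_ImM (z w : R[i]) : Im (z * w) = Re z * Im w + Im z * Re w.
Proof. by case: z => a b; case: w => c d /=; rewrite [b * c]mulrC. Qed.

Lemma K_op_lin s (l : R[i]) f g x : s <= 2 -> C01 f -> C01 g -> 0 <= x <= 1 ->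
  K_op s (fun y => l * f y + g y) x = l * K_op s f x + K_op s g x.
Proof.
move=> s2 fC gC x01; have x0 : 0 <= x by lra.
have [M _ fM] := C01_bounded fC; have [M' _ gM] := C01_bounded gC.
have [M'' _ fgM] := C01_bounded (C01_lin l fC gC).
rewrite (K_opE s2 x0 fM) (K_opE s2 x0 gM) (K_opE s2 x0 fgM).
have fR := bounded01_Re fM; have fI := bounded01_Im fM.
have gR := bounded01_Re gM; have gI := bounded01_Im gM.
have bD u v A B : bounded01 A u -> bounded01 B v ->
    bounded01 (A + B) (fun y : R => u y + v y).
  by move=> uA vB y y01; apply: le_trans (ler_normD _ _) (lerD (uA _ y01) (vB _ y01)).
case: l fgM => a b _.
set u := fun y => Re (f y) in fR *; set v := fun y => Im (f y) in fI *.
set p := fun y => Re (g y) in gR *; set q := fun y => Im (g y) in gI *.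
have -> : transfer s (fun y => Re ((a +i* b)%C * f y + g y)) x =
    a * transfer s u x + (- b * transfer s v x + transfer s p x).
  rewrite -(transfer_lin _ s2 x0 fI gR) -(transfer_lin _ s2 x0 fR (bD _ _ _ _ (bounded01M
    _ fI) gR)).
  apply: transfer_ext => // y _; rewrite /u /v /p.
  by rewrite raddfD/= complex_ReM/=; ring.
have -> : transfer s (fun y => Im ((a +i* b)%C * f y + g y)) x =
    a * transfer s v x + (b * transfer s u x + transfer s q x).
  rewrite -(transfer_lin _ s2 x0 fR gI) -(transfer_lin _ s2 x0 fI (bD _ _ _ _ (bounded01M
    _ fR) gI)).
  apply: transfer_ext => // y _; rewrite /u /v /q.
  by rewrite raddfD/= complex_ImM/=; ring.
by apply/eqP; rewrite eq_complex/= mulNr -addrA eqxx/= addrA eqxx.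
Qed.

Lemma C01_scale_comp (v phi : R -> R) g :
  (forall x, 0 <= x <= 1 -> {for x, continuous v}) ->
  (forall x y, 0 <= x <= 1 -> 0 <= y <= 1 -> `|phi x - phi y| <= `|x - y|) ->
  (forall x, 0 <= x <= 1 -> 0 <= phi x <= 1) ->
  C01 g -> C01 (fun x => ((v x)%:C)%C * g (phi x)).
Proof.
move=> vc philip phi01 gC; apply/C01P => x x01 e e0.
have [M M0 gM] := C01_bounded gC.
have M1 : 0 < M + 1 by lra.
have V1 : 0 < `|v x| + 1 by rewrite ltr_wpDl.
have e1 : 0 < e / 2 / (`|v x| + 1) by rewrite !divr_gt0.
have e2 : 0 < e / 2 / (M + 1) by rewrite !divr_gt0.
have [d d0 dP] := (C01P g).1 gC (phi x) (phi01 x x01) _ e1.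
have /cvgrPdist_lt /(_ _ e2) /nbhs_ballP[d' /= d'0 d'P] := vc x x01.
exists (Num.min d d'); first by rewrite lt_min d0.
move=> y y01; rewrite lt_min => /andP[xy1 xy2].
have k1 := dP _ (phi01 y y01) (le_lt_trans (philip _ _ x01 y01) xy1).
have k2 := d'P y xy2.
rewrite (_ : _ - _ = ((v x)%:C)%C * (g (phi x) - g (phi y)) +
   ((v x - v y)%:C)%C * g (phi y)); last by rewrite rmorphB/=; ring.
apply: (le_lt_trans (le_normcD _ _)); rewrite !Normc.normcM.
have nR (z : R) : normc ((z%:C)%C) = `|z| by rewrite /= expr0n addr0 sqrtr_sqr.
rewrite !nR; have k3 := gM _ (phi01 y y01).
move: k1 k2; rewrite !ltr_pdivlMr// => k1 k2.
have n1 := normc_ge0 (g (phi x) - g (phi y)).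
have n2 : 0 <= `|v x - v y| by [].
have n3 : `|v x| * normc (g (phi x) - g (phi y)) <=
   normc (g (phi x) - g (phi y)) * (`|v x| + 1) by rewrite mulrDr mulr1 mulrC lerDl.
have n4 : `|v x - v y| * normc (g (phi y)) <= `|v x - v y| * (M + 1).
  by apply: ler_wpM2l => //; lra.
lra.
Qed.

(** Each branch 1 / (n + 1 + x) maps [0, 1] into itself and is 1-Lipschitz there, so that the
    partial sums are continuous; they converge uniformly. *)
Lemma K_op_C01 s g : s <= 2 -> C01 g -> C01 (K_op s g).
Proof.
move=> s2 gC; have [M M0 gM] := C01_bounded gC.
pose u n x : R[i]^o := \sum_(1 <= a < n.+1)
  ((4 ^- a * (a%:R + x) `^ (2 * s))%:C%C * g (a%:R + x)^-1 : R[i]^o).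
apply: (C01_uniform u) => [n|e e0].
  elim: n => [|n ih].
    by apply: (C01_ext _ (C01_cst 0)) => x _; rewrite /u big_geq.
  have tC : C01 (fun x => ((4 ^- n.+1 * (n.+1%:R + x) `^ (2 * s))%:C%C *
                          g (n.+1%:R + x)^-1 : R[i]^o)).
    apply: (@C01_scale_comp _ (fun x => (n.+1%:R + x)^-1)) gC => [x x01|x y x01 y01|x x01].
    - have n1 : (1 : R) <= n.+1%:R by rewrite ler1n.
      have X0 : 0 < n.+1%:R + x by lra.
      apply: cvgMl_tmp.
      have pc : {for n.+1%:R + x, continuous (fun z => z `^ (2 * s))}.
        apply: differentiable_continuous; apply/derivable1_diffP.
        by apply: derivable_powR; rewrite in_itv/= X0.
      apply: (@cvg_comp _ _ _ (fun x => n.+1%:R + x) (fun z => z `^ (2 * s))) pc.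
      by apply: cvgD; [exact: cvg_cst|exact: cvg_id].
    - have n1 : (1 : R) <= n.+1%:R by rewrite ler1n.
      have X1 : 1 <= n.+1%:R + x by lra.
      have Y1 : 1 <= n.+1%:R + y by lra.
      have X0 : n.+1%:R + x != 0 by rewrite gt_eqF//; lra.
      have Y0 : n.+1%:R + y != 0 by rewrite gt_eqF//; lra.
      have -> : (n.+1%:R + x)^-1 - (n.+1%:R + y)^-1 =
          (y - x) / ((n.+1%:R + x) * (n.+1%:R + y)).
        have -> : y - x = (n.+1%:R + y) - (n.+1%:R + x) by ring.
        by move: (n.+1%:R + x) (n.+1%:R + y) X0 Y0 => p q p0 q0; field; rewrite q0 p0.
      rewrite normrM distrC normfV ler_pdivrMr ?normr_gt0 ?mulf_neq0//.
      rewrite ler_peMr// ger0_norm; nra.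
    - have x0 : 0 <= x by lra.
      by have /andP[/ltW-> ->] := shift_inv_itv n x0.
  apply: (C01_ext _ (C01_lin 1 tC ih)) => x _.
  by rewrite /u [RHS]big_nat_recr//= mul1r addrC.
have h01 : 0 <= (2^-1 : R) < 1 by lra.
(* The factor 4 is 2 for the two parts times 1 / (1 - 1/2); the second 16 bounds (1 + x)^4. *)
have [n nC] := geometric_small (4 * (M * (16 * 16))) h01 e0.
exists n => x x01; apply: le_trans nC; have x0 : 0 <= x by lra.
rewrite /u K_op_partialE (K_opE s2 x0 gM).
have [_ /(_ n) h1] := geometric_tail h01 (fun n =>
  transfer_term_le n s2 x0 (bounded01_Re gM)).
have [_ /(_ n) h2] := geometric_tail h01 (fun n =>
  transfer_term_le n s2 x0 (bounded01_Im gM)).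
apply: (le_trans (normc_le _)) => /=; rewrite !transferE.
have p16 : (1 + x) ^+ 4 <= 16.
  by have : (1 + x) ^+ 4 <= 2 ^+ 4; [apply: lerXn2r; rewrite ?nnegrE; lra|lra].
have p0 : 0 <= (1 + x) ^+ 4 by apply: exprn_ge0; lra.
apply: (le_trans (lerD h1 h2)).
have -> : 1 - 2^-1 = 2^-1 :> R by field.
have -> : 4 * (M * (16 * 16)) * 2^-1 ^+ n =
  M * (16 * 16) * (2^-1 ^+ n / 2^-1) + M * (16 * 16) * (2^-1 ^+ n / 2^-1) :> R.
  by rewrite invrK; ring.
by apply: lerD; (apply: ler_wpM2r; first by rewrite invrK mulr_ge0// exprn_ge0//; lra);
  apply: ler_wpM2l => //; apply: ler_wpM2l.
Qed.

Lemma K_op_iterE s g x n : s <= 2 -> C01 g -> 0 <= x <= 1 ->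
  iter n (K_op s) g x = (iter n (transfer s) (fun y => Re (g y)) x +i*
                         iter n (transfer s) (fun y => Im (g y)) x)%C.
Proof.
move=> s2 gC; elim: n x => [|n ih] x x01; first by rewrite /=; case: (g x).
have x0 : 0 <= x by lra.
have C n' : C01 (iter n' (K_op s) g).
  by elim: n' => [|n' ih']; [exact: gC|exact: K_op_C01].
have [M _ gM] := C01_bounded (C n).
rewrite iterS (K_opE s2 x0 gM) !iterS; congr (_ +i* _)%C.
  by apply: transfer_ext => // y y01; rewrite ih//; lra.
by apply: transfer_ext => // y y01; rewrite ih//; lra.
Qed.

(** A positive operator is controlled by its action on constants: apply it to -M <= u <= M. *)
Lemma iter_transfer_le_transfer1 s (u : R -> R) M n x : 0 <= s <= 1 ->
  (forall y, 0 <= y <= 1 -> `|u y| <= M) -> 0 <= x <= 1 ->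
  `|iter n (transfer s) u x| <= M * transfer1 s n x.
Proof.
move=> s01 uM x01; have s2 : s <= 2 by lra.
have uM' : bounded01 M u by move=> y y01; apply: uM; lra.
have b1 : bounded01 (1 : R) (cst 1) by move=> y _; rewrite normr1.
have h1 := @iter_transfer_mono _ s u (fun y => M * cst 1 y) _ _ n s2 uM' (bounded01M _ b1).
have h2 := @iter_transfer_mono _ s (fun y =>
  - M * cst 1 y) u _ _ n s2 (bounded01M _ b1) uM'.
rewrite ler_norml; apply/andP; split.
  rewrite transfer1E -mulNr -(iter_transferZ _ _ s2 b1)//; apply: h2 => // y y01.
  by have := uM y y01; rewrite ler_norml mulr1 => /andP[].
rewrite transfer1E -(iter_transferZ _ _ s2 b1)//; apply: h1 => // y y01.
by have := uM y y01; rewrite ler_norml mulr1 => /andP[].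
Qed.

Lemma transfer1_le_rho s n x : 0 <= s <= 1 -> 0 <= x <= 1 -> transfer1 s n x <=
  4 * growth_rate s ^+ n.
Proof.
move=> s01 x01; have /andP[_ h1] := transfer1_itv n s01 x01.
have h2 := transfer1_harnack n s01; have /andP[h3 _] := growth_rate_itv n s01.
by apply: (le_trans h1); apply: (le_trans h2); rewrite ler_pM2l.
Qed.

(** The constant 8 is 2 for the real and imaginary parts times the Harnack constant 4. *)
Lemma K_op_pow s n g M x : 0 <= s <= 1 -> C01 g -> bounded_on01 M g -> 0 <= x <= 1 ->
  normc (iter n (K_op s) g x) <= 8 * growth_rate s ^+ n * M.
Proof.
move=> s01 gC gM x01; have s2 : s <= 2 by lra.
have M0 : 0 <= M by apply: le_trans (normc_ge0 _) (gM x x01).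
rewrite (K_op_iterE n s2 gC x01); apply: (le_trans (normc_le _)) => /=.
have uM y : 0 <= y <= 1 -> `|Re (g y)| <= M.
  by move=> y01; exact: le_trans (normc_Re _) (gM _ y01).
have vM y : 0 <= y <= 1 -> `|Im (g y)| <= M.
  by move=> y01; exact: le_trans (normc_Im _) (gM _ y01).
have h1 := iter_transfer_le_transfer1 n s01 uM x01.
have h2 := iter_transfer_le_transfer1 n s01 vM x01.
have h3 := ler_wpM2l M0 (transfer1_le_rho n s01 x01).
apply: (le_trans (lerD (le_trans h1 h3) (le_trans h2 h3))).
by rewrite le_eqVlt; apply/predU1P; left; ring.
Qed.

(* With [r] the growth rate and [G n] the sum of [r ^- k.+1 * K^k 1] over
   [k < n], [(r - K) (G n) = 1 - r ^- n * K^n 1] is bounded in [n], whereas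
   [G n 0 >= n / (4 * r)]. *)
Lemma growth_rate_in_spectrum s : 0 <= s <= 1 -> spectrum (K_op s) ((growth_rate s)%:C)%C.
Proof.
move=> s01 [B [_ _ [M BM]] inv].
have s2 : s <= 2 by lra.
set r := growth_rate s; have r0 : 0 < r := growth_rate_gt0 s.
have c1 : C01 (fun=> 1 : R[i]^o) := C01_cst 1.
have IC n : C01 (iter n (K_op s) (fun=> 1)).
  by elim: n => [|n ih]; [exact: c1|exact: K_op_C01].
have IE n x : 0 <= x <= 1 -> iter n (K_op s) (fun=> 1) x = ((transfer1 s n x)%:C)%C.
  move=> x01; rewrite (K_op_iterE n s2 c1 x01)/= transfer1E; congr (_ +i* _)%C.
  have z0 (y : R) : 0 <= y <= 1 -> `|(0 : R)| <= 0 by rewrite normr0.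
  by have := iter_transfer_le_transfer1 n s01 z0 x01; rewrite mul0r normr_le0 => /eqP.
pose G n (x : R) : R[i]^o := \sum_(0 <=
  k < n) ((r ^- k.+1)%:C)%C * iter k (K_op s) (fun=> 1) x.
have GC n : C01 (G n).
  elim: n => [|n ih].
    by apply: (C01_ext _ (C01_cst 0)) => x _; rewrite /G big_geq.
  apply: (C01_ext _ (C01_lin ((r ^- n.+1)%:C)%C (IC n) ih)) => x _.
  by rewrite /G big_nat_recr//= addrC.
have KG n x : 0 <= x <= 1 -> ((r%:C)%C * G n x - K_op s (G n) x) =
    1 - ((r ^- n)%:C)%C * iter n (K_op s) (fun=> 1) x.
  move=> x01; have x0 : 0 <= x by lra.
  elim: n => [|n ih].
    have -> : K_op s (G 0%N) x = 0.
      have z : bounded_on01 0 (fun=> 0 : R[i]^o) by move=> y _; rewrite Normc.normc0.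
      have := @K_op_pow s 1 (fun=> 0) 0 x s01 (C01_cst 0) z x01.
      rewrite mulr0 => h; rewrite (K_op_ext s (g := fun=> 0) x01).
        by apply: Normc.eq0_normc; apply/eqP; rewrite eq_le h normc_ge0.
      by move=> y _; rewrite /G big_geq.
    by rewrite /G big_geq// mulr0 subr0 expr0 invr1 mul1r subrr.
  have -> : K_op s (G n.+1) x = ((r ^- n.+1)%:C)%C * K_op s (iter n (K_op s) (fun=> 1)) x
      + K_op s (G n) x.
    rewrite -[RHS](@K_op_lin s ((r ^- n.+1)%:C)%C _ _ x s2 (IC n) (GC n) x01).
    apply: (K_op_ext s x01) => y _.
    by rewrite /G big_nat_recr//= addrC.
  have -> : G n.+1 x = G n x + ((r ^- n.+1)%:C)%C * iter n (K_op s) (fun=> 1) x.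
    by rewrite /G big_nat_recr.
  rewrite -iterS.
  have e : ((r ^- n)%:C)%C = (r%:C)%C * ((r ^- n.+1)%:C)%C.
    by rewrite -rmorphM/= exprS invfM mulrA divff ?mul1r// gt_eqF.
  rewrite e in ih; apply/eqP; rewrite -subr_eq0; apply/eqP.
  by move/eqP: ih; rewrite -subr_eq0 => /eqP <-; ring.
have Gle n x : 0 <= x <= 1 -> normc (G n x) <= `|M| * 5.
  move=> x01.
  pose H (y : R) := (r%:C)%C * G n y - K_op s (G n) y.
  have HC : C01 H.
    apply: (C01_ext _ (C01_lin (-1) (K_op_C01 s2 (GC n)) (C01_lin (r%:C)%C (GC n)
      (C01_cst 0)))) => y _.
    by rewrite /H mulN1r addr0 addrC.
  have [BH _] := inv _ x (GC n) x01.
  have HM : supnorm H <= 5.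
    apply: supnorm_le => y y01; rewrite /H KG// IE//.
    apply: (le_trans (normcB _ _)); rewrite Normc.normc1 -rmorphM/=.
    rewrite expr0n addr0 sqrtr_sqr ger0_norm; last first.
      by rewrite mulr_ge0 ?invr_ge0 ?exprn_ge0 ?(ltW r0)// ltW// transfer1_gt0//; lra.
    have : r ^- n * transfer1 s n y <= 4.
      by rewrite ler_pdivrMl ?exprn_gt0// mulrC transfer1_le_rho.
    lra.
  have HM0 : 0 <= supnorm H.
    by apply: le_trans (normc_ge0 _) (supnorm_ge HC x01).
  have BHC : C01 (B H).
    by apply: (C01_ext _ (GC n)) => y y01; have [-> _] := inv _ y (GC n) y01.
  rewrite -BH; apply: (le_trans (supnorm_ge BHC x01)).
  apply: (le_trans (BM _ HC)); apply: (@le_trans _ _ (`|M| * supnorm H)).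
    by rewrite ler_wpM2r// ler_norm.
  by rewrite ler_wpM2l.
have Gge n : n%:R * (4^-1 / r) <= normc (G n 0).
  have z01 : 0 <= (0 : R) <= 1 by rewrite lexx ler01.
  apply: (le_trans _ (normc_Re _)); apply: (le_trans _ (ler_norm _)).
  rewrite /G raddf_sum/=; elim: n => [|n ih]; first by rewrite mul0r big_geq.
  rewrite big_nat_recr//= -natr1 mulrDl mul1r lerD// IE//= mul0r subr0.
  rewrite exprS invfM -mulrA mulrC ler_wpM2l ?invr_ge0 ?(ltW r0)//.
  rewrite ler_pdivlMl ?exprn_gt0// ler_pdivrMr//.
  have /andP[_ h1] := growth_rate_itv n s01; have := transfer1_harnack n s01.
  by rewrite -/r in h1 => h2; rewrite mulrC; apply: le_trans h1 h2.
have c0 : 0 < 4^-1 / r by rewrite divr_gt0.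
have z01 : 0 <= (0 : R) <= 1 by rewrite lexx ler01.
set t := `|M| * 5 / (4^-1 / r).
have t0 : 0 <= t by rewrite /t !mulr_ge0 ?invr_ge0 ?(ltW c0)// (ltW r0).
have := le_trans (Gge (Num.truncn t).+1) (Gle _ 0 z01).
rewrite -ler_pdivlMr// -/t; have /andP[_] := truncn_itv t0.
by move=> h1 h2; have := lt_le_trans h1 h2; rewrite ltxx.
Qed.

Lemma spectral_radius_K_op s : 0 <= s <= 1 -> spectral_radius (K_op s) = growth_rate s.
Proof.
move=> s01; have s2 : s <= 2 by lra.
have ub l : spectrum (K_op s) l -> normc l <= growth_rate s.
  move=> ls; rewrite leNgt; apply/negP => rl; apply: ls.
  apply: (@neumann_resolvent _ (K_op s) 8 (growth_rate s)) =>
    [g|a f g x|f g x fg x01|n g M x||].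
  - exact: K_op_C01.
  - exact: K_op_lin.
  - exact: K_op_ext.
  - exact: K_op_pow.
  - exact: growth_rate_gt0.
  - exact: rl.
have rs := growth_rate_in_spectrum s01.
have nr : normc ((growth_rate s)%:C)%C = growth_rate s
  by rewrite normc_real// ltW// growth_rate_gt0.
apply/eqP; rewrite eq_le; apply/andP; split.
  apply: ge_sup; first by exists (normc ((growth_rate s)%:C)%C);
    exists ((growth_rate s)%:C)%C.
  by move=> _ [l ls <-]; exact: ub.
rewrite -[leLHS]nr; apply: ub_le_sup; last by exists ((growth_rate s)%:C)%C.
by exists (growth_rate s) => _ [l ls <-]; exact: ub.
Qed.

Lemma pressure_eq0 s : 0 <= s <= 1 -> pressure s = 0 <-> growth_rate s = 1.
Proof.
move=> s01; rewrite /pressure spectral_radius_K_op//; split=> [/eqP|->].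
  by rewrite ln_eq0 ?growth_rate_gt0// => /eqP.
exact: ln1.
Qed.

End transfer_operator_spectrum.

(** * Stern-Brocot partitions *)

Section farey_tree.
Context {R : realType}.
Implicit Types (s t x y a b c d w : R) (h g phi : R -> R) (q p k n N : nat).

Definition mono01 h := forall x y, 0 <= x -> x <= y -> y <= 1 -> h x <= h y.

(** These are the inverse branches of the slow continued fraction map: for x > 0, [contract] raises
    the first partial quotient by one, and [flip] puts a new partial quotient 1 in front. *)
Definition contract x : R := x / (1 + x).
Definition flip x : R := (1 + x)^-1.

(* [phi] is a Moebius map with denominator [p * x + q] and determinant [e],
   mapping [0, 1] to an interval of [minkq]-mass [w]. *)
Definition node phi q p w :=
  [/\ forall x, 0 <= x <= 1 -> 0 <= phi x <= 1,
      exists2 e : R, e = 1 \/ e = -1 & forall x y, 0 <= x <= 1 -> 0 <= y <= 1 ->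
        phi x - phi y = e * ((x - y) / ((p%:R * x + q%:R) * (p%:R * y + q%:R)))
    & exists A B : R, `|B| = w /\
        forall x, 0 <= x <= 1 -> minkq (phi x) = A + B * minkq x].

Lemma node_id : node id 1 0 1.
Proof.
split=> //; first by exists 1; [left|move=> x y _ _; rewrite !mul0r add0r; field].
by exists 0, 1; split=> [|x _]; rewrite ?normr1// add0r mul1r.
Qed.

Lemma contract01 x : 0 <= x <= 1 -> 0 <= contract x <= 1.
Proof.
move=> x01; have x1 : 0 < 1 + x by lra.
by rewrite /contract divr_ge0 ?ler_pdivrMr; lra.
Qed.

Lemma flip01 x : 0 <= x <= 1 -> 0 <= flip x <= 1.
Proof.
move=> x01; have x1 : 0 < 1 + x by lra.
by rewrite /flip invr_ge0 invf_le1//; lra.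
Qed.

Lemma node_contract phi q p w : (0 < q)%N -> node phi q p w ->
  node (phi \o contract) q (q + p) (w / 2).
Proof.
move=> q0 [phi01 [e e1 phiB] [A [B [Bw phiG]]]]; split.
- by move=> x x01; exact/phi01/contract01.
- exists e => // x y x01 y01; rewrite /= phiB ?contract01//; congr (_ * _).
  have q0' : 0 < q%:R :> R by rewrite ltr0n.
  have p0' : 0 <= p%:R :> R by [].
  rewrite /contract natrD; move: (q%:R) (p%:R) q0' p0' => Q P Q0 P0.
  have d1 : 1 + x != 0 by rewrite gt_eqF//; lra.
  have d2 : 1 + y != 0 by rewrite gt_eqF//; lra.
  have n1 : (Q + P) * x + Q != 0 by rewrite gt_eqF//; nra.
  have n2 : (Q + P) * y + Q != 0 by rewrite gt_eqF//; nra.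
  have -> : P * (x / (1 + x)) + Q = ((Q + P) * x + Q) / (1 + x) by field.
  have -> : P * (y / (1 + y)) + Q = ((Q + P) * y + Q) / (1 + y) by field.
  by field; rewrite n1 n2 d1 d2.
- exists A, (B / 2); split; first by rewrite normrM Bw normfV ger0_norm.
  by move=> x x01; rewrite /= phiG ?contract01// minkq_contract//; ring.
Qed.

Lemma node_flip phi q p w : (0 < q)%N -> node phi q p w ->
  node (phi \o flip) (q + p) q (w / 2).
Proof.
move=> q0 [phi01 [e e1 phiB] [A [B [Bw phiG]]]]; split.
- by move=> x x01; exact/phi01/flip01.
- exists (- e); first by case: e1 => ->; [right|left; rewrite opprK].
  move=> x y x01 y01; rewrite /= phiB ?flip01// mulNr -mulrN; congr (_ * _).
  have q0' : 0 < q%:R :> R by rewrite ltr0n.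
  have p0' : 0 <= p%:R :> R by [].
  rewrite /flip natrD; move: (q%:R) (p%:R) q0' p0' => Q P Q0 P0.
  have d1 : 1 + x != 0 by rewrite gt_eqF//; lra.
  have d2 : 1 + y != 0 by rewrite gt_eqF//; lra.
  have n1 : Q * x + (Q + P) != 0 by rewrite gt_eqF//; nra.
  have n2 : Q * y + (Q + P) != 0 by rewrite gt_eqF//; nra.
  have -> : P * (1 + x)^-1 + Q = (Q * x + (Q + P)) / (1 + x) by field.
  have -> : P * (1 + y)^-1 + Q = (Q * y + (Q + P)) / (1 + y) by field.
  by field; rewrite n1 n2 d1 d2.
- exists (A + B), (- (B / 2)); split; first by rewrite normrN normrM Bw normfV ger0_norm.
  by move=> x x01; rewrite /= phiG ?flip01// minkq_flip//; ring.
Qed.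

(** The absolute value absorbs the orientation, which every [flip] reverses. *)
Definition variation h phi : R := `|h (phi 1) - h (phi 0)|.

Lemma contract0 : contract 0 = 0. Proof. by rewrite /contract mul0r. Qed.
Lemma contract1 : contract 1 = 2^-1. Proof. by rewrite /contract mul1r. Qed.
Lemma flip0 : flip 0 = 1. Proof. by rewrite /flip addr0 invr1. Qed.
Lemma flip1 : flip 1 = 2^-1. Proof. by []. Qed.

Lemma node_mono phi q p w : (0 < q)%N -> node phi q p w ->
  (forall x y, 0 <= x <= y -> y <= 1 -> phi x <= phi y) \/
  (forall x y, 0 <= x <= y -> y <= 1 -> phi y <= phi x).
Proof.
move=> q0 [_ [e e1 phiB] _].
have q0' : 0 < q%:R :> R by rewrite ltr0n.
have p0' : 0 <= p%:R :> R by [].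
have dpos (z : R) : 0 <= z -> 0 < p%:R * z + q%:R.
  by move=> z0; have := mulr_ge0 p0' z0; lra.
have pos (u v : R) : 0 <= u <= v -> v <= 1 ->
    0 <= (v - u) / ((p%:R * v + q%:R) * (p%:R * u + q%:R)).
  move=> uv v1; rewrite divr_ge0 ?subr_ge0 ?mulr_ge0 ?(ltW (dpos _ _))//; lra.
case: e1 => ee; [left|right] => u v uv v1; rewrite -subr_ge0.
  by rewrite phiB ?ee ?mul1r ?pos//; lra.
by rewrite -opprB phiB ?ee ?mulN1r ?opprK ?pos//; lra.
Qed.

(** The images of [0, 1] under [contract] and [flip] are [0, 1/2] and [1/2, 1], so that the children
    subdivide the interval of the node. *)
Lemma variation_split h phi q p w : mono01 h -> (0 < q)%N -> node phi q p w ->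
  variation h phi = variation h (phi \o contract) + variation h (phi \o flip).
Proof.
move=> hm q0 phiN; have [phi01 _ _] := phiN.
rewrite /variation /= contract0 contract1 flip0 flip1.
have h0 : 0 <= (0 : R) <= 1 by rewrite lexx ler01.
have h1 : 0 <= (1 : R) <= 1 by rewrite lexx ler01.
have h2 : 0 <= (2^-1 : R) <= 1 by lra.
have /andP[a0 a1] := phi01 _ h0; have /andP[b0 b1] := phi01 _ h1.
have /andP[c0 c1] := phi01 _ h2.
have [m|m] := node_mono q0 phiN.
  have k1 : phi 0 <= phi 2^-1 by apply: m; lra.
  have k2 : phi 2^-1 <= phi 1 by apply: m; lra.
  have := hm _ _ a0 k1 c1; have := hm _ _ c0 k2 b1 => l1 l2.
  rewrite ger0_norm; last lra.
  rewrite ger0_norm; last lra.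
  rewrite ler0_norm; lra.
have k1 : phi 2^-1 <= phi 0 by apply: m; lra.
have k2 : phi 1 <= phi 2^-1 by apply: m; lra.
have := hm _ _ c0 k1 a1; have := hm _ _ b0 k2 c1 => l1 l2.
rewrite ler0_norm; last lra.
rewrite ler0_norm; last lra.
rewrite ger0_norm; lra.
Qed.

Lemma node_length phi q p w : (0 < q)%N -> node phi q p w ->
  `|phi 1 - phi 0| = (q%:R * (q + p)%:R)^-1.
Proof.
have h0 : 0 <= (0 : R) <= 1 by rewrite lexx ler01.
have h1 : 0 <= (1 : R) <= 1 by rewrite lexx ler01.
move=> q0 [_ [e e1 phiB] _]; rewrite (phiB _ _ h1 h0).
have -> : `|e * ((1 - 0) / ((p%:R * 1 + q%:R) * (p%:R * 0 + q%:R)))| =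
    `|(q%:R * (q + p)%:R)^-1|.
  rewrite normrM; case: e1 => ->;
    rewrite ?normrN normr1 mul1r natrD mulr1 mulr0 add0r subr0 mul1r.
    by rewrite addrC mulrC.
  by rewrite addrC mulrC.
by rewrite ger0_norm// invr_ge0 mulr_ge0.
Qed.

Lemma node_variation phi q p w : node phi q p w -> variation minkq phi = w.
Proof.
move=> [_ _ [A [B [Bw phiG]]]]; rewrite /variation.
have h0 : 0 <= (0 : R) <= 1 by rewrite lexx ler01.
have h1 : 0 <= (1 : R) <= 1 by rewrite lexx ler01.
rewrite (phiG _ h0) (phiG _ h1) minkq0 minkq1.
by rewrite mulr1 mulr0 addr0 addrC addKr.
Qed.

Variable Q : nat.

(** The number [2 * q + p] is the denominator of the mediant at which a node is cut in two; nodes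
    are cut while it is below [Q]. *)
Fixpoint leafsum (F : (R -> R) -> R) k phi q p : R :=
  if k is k'.+1 then
    if (2 * q + p < Q)%N then
      leafsum F k' (phi \o contract) q (q + p) + leafsum F k' (phi \o flip) (q + p) q
    else F phi
  else F phi.

(** By [leafsum_variation] this is the sum of the squared masses of the leaves, relative to the
    node. It depends on the denominators alone, and its recursion is the one that [homog_iter]
    satisfies. *)
Fixpoint leafweight k q p : R :=
  if k is k'.+1 then
    if (2 * q + p < Q)%N then 4^-1 * (leafweight k' q (q + p) + leafweight k' (q + p) q)
    else 1
  else 1.

Lemma leafweight_ge0 k q p : 0 <= leafweight k q p.
Proof.
elim: k q p => [|k ih] q p //=; case: ifP => // _.
by rewrite mulr_ge0 ?addr_ge0.
Qed.

(* [k] bounds the remaining depth: the invariant forces the recursion to stop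
   at nodes with [Q <= 2 q + p] only. *)
Definition admissible k q p := [&& 0 < q, q + p <= Q & Q <= 2 * q + p + k]%N.

Lemma admissible_contract k q p : admissible k.+1 q p -> (2 * q + p < Q)%N ->
  admissible k q (q + p).
Proof. by rewrite /admissible; lia. Qed.

Lemma admissible_flip k q p : admissible k.+1 q p -> (2 * q + p < Q)%N ->
  admissible k (q + p) q.
Proof. by rewrite /admissible; lia. Qed.

Lemma leafsum_le F F' k phi q p w : admissible k q p -> node phi q p w ->
  (forall phi q p w, (0 < q)%N -> (q + p <= Q <= 2 * q + p)%N -> node phi q p w ->
     F phi <= F' phi) ->
  leafsum F k phi q p <= leafsum F' k phi q p.
Proof.
move=> + + FF; elim: k phi q p w => [|k ih] phi q p w /[dup] kqp /and3P[q0 qQ Qq] phiN /=.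
  by apply: (FF _ q p w) => //; lia.
case: ltnP => h; last by apply: (FF _ q p w) => //; lia.
apply: lerD.
  by apply: ih (admissible_contract kqp h) (node_contract q0 phiN).
by apply: ih (admissible_flip kqp h) (node_flip q0 phiN).
Qed.

Lemma leafsum_sum (I : Type) (r : seq I) (F : I -> (R -> R) -> R) k phi q p :
  leafsum (fun phi => \sum_(i <- r) F i phi) k phi q p =
  \sum_(i <- r) leafsum (F i) k phi q p.
Proof.
elim: k phi q p => [|k ih] phi q p //=; case: ifP => // _.
by rewrite !ih big_split.
Qed.

Lemma leafsumZ c F k phi q p :
  leafsum (fun phi => c * F phi) k phi q p = c * leafsum F k phi q p.
Proof. by elim: k phi q p => [|k ih] phi q p //=; case: ifP => // _;
  rewrite !ih mulrDr. Qed.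

Lemma leafsum_ge0 F k phi q p : (forall phi, 0 <= F phi) -> 0 <= leafsum F k phi q p.
Proof.
by move=> F0; elim: k phi q p => [|k ih] phi q p //=; case: ifP => // _; rewrite addr_ge0.
Qed.

Lemma leafsum_variation k phi q p w : admissible k q p -> node phi q p w ->
  leafsum (fun phi => variation minkq phi ^+ 2) k phi q p = w ^+ 2 * leafweight k q p.
Proof.
elim: k phi q p w => [|k ih] phi q p w /[dup] kqp /and3P[q0 qQ Qq] phiN /=.
  by rewrite (node_variation phiN) mulr1.
case: ltnP => h; last by rewrite (node_variation phiN) mulr1.
rewrite (ih _ _ _ _ (admissible_contract kqp h) (node_contract q0 phiN)).
rewrite (ih _ _ _ _ (admissible_flip kqp h) (node_flip q0 phiN)).
by field.
Qed.

(** At each cut the variations add up, and u^2 + v^2 <= (u + v)^2 for nonnegative u and v. *)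
Lemma leafsum_sqr_le h k phi q p w : mono01 h -> admissible k q p -> node phi q p w ->
  leafsum (fun phi => variation h phi ^+ 2) k phi q p <= variation h phi ^+ 2.
Proof.
move=> hm; elim: k phi q p w => [|k ih] phi q p w /[dup] kqp /and3P[q0 qQ Qq] phiN //=.
case: ltnP => // lt; rewrite (variation_split hm q0 phiN).
have := ih _ _ _ _ (admissible_contract kqp lt) (node_contract q0 phiN).
have := ih _ _ _ _ (admissible_flip kqp lt) (node_flip q0 phiN).
have : 0 <= variation h (phi \o contract) by exact: normr_ge0.
have : 0 <= variation h (phi \o flip) by exact: normr_ge0.
move: (variation _ _) (variation _ _) (leafsum _ _ _ _ _) (leafsum _ _ _ _ _) => u v A B.
by move=> u0 v0 k1 k2; rewrite sqrrD; nra.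
Qed.

(** The hypotheses x^2 <= k t replace square roots and reproduce themselves, which suits an
    induction over a tree or a sum. The mixed term 2 x y is bounded by k1 t2 + k2 t1, the inequality
    of arithmetic and geometric means. *)
Lemma cauchy_schwarz2 (x y k1 k2 t1 t2 : R) : 0 <= k1 -> 0 <= k2 -> 0 <= t1 -> 0 <= t2 ->
  x ^+ 2 <= k1 * t1 -> y ^+ 2 <= k2 * t2 -> (x + y) ^+ 2 <= (k1 + k2) * (t1 + t2).
Proof.
move=> k10 k20 t10 t20 h1 h2.
have h3 : (x * y) ^+ 2 <= (k1 * t2) * (k2 * t1).
  rewrite exprMn (_ : _ * _ * _ = (k1 * t1) * (k2 * t2)); last by ring.
  by apply: ler_pM; rewrite ?sqr_ge0.
have h4 : (2 * (x * y)) ^+ 2 <= (k1 * t2 + k2 * t1) ^+ 2.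
  have : 0 <= (k1 * t2 - k2 * t1) ^+ 2 by rewrite sqr_ge0.
  rewrite exprMn; move: h3; rewrite !expr2; nra.
have h5 : 2 * (x * y) <= k1 * t2 + k2 * t1.
  apply: (le_trans (ler_norm _)); rewrite -[leRHS]ger0_norm.
    by rewrite -ler_sqr ?nnegrE// !real_normK ?num_real.
  by rewrite addr_ge0// mulr_ge0.
by move: h1 h2 h5; rewrite !expr2; nra.
Qed.

(** Cauchy-Schwarz over the leaves on which [h] varies. Their number is replaced by the variation of
    [g], which is additive under cuts and at least 1 on each such leaf. *)
Lemma variation_sqr_le h g k phi q p w : mono01 h -> mono01 g ->
  admissible k q p -> node phi q p w ->
  (forall phi q p w, (0 < q)%N -> (q + p <= Q <= 2 * q + p)%N -> node phi q p w ->
     variation h phi = 0 \/ 1 <= variation g phi) ->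
  variation h phi ^+ 2 <=
    variation g phi * leafsum (fun phi => variation h phi ^+ 2) k phi q p.
Proof.
move=> hm gm + + hg.
have leaf phi' q' p' w' : (0 < q')%N -> (q' + p' <= Q <= 2 * q' + p')%N ->
    node phi' q' p' w' -> variation h phi' ^+ 2 <= variation g phi' * variation h phi' ^+ 2.
  move=> q0 qQ phiN; have [->|g1] := hg _ _ _ _ q0 qQ phiN.
    by rewrite expr0n mulr0.
  by rewrite ler_peMl// sqr_ge0.
elim: k phi q p w => [|k ih] phi q p w /[dup] kqp /and3P[q0 qQ Qq] phiN /=.
  by apply: (leaf _ q p w) => //; lia.
case: ltnP => lt; last by apply: (leaf _ q p w) => //; lia.
rewrite (variation_split hm q0 phiN) (variation_split gm q0 phiN).
apply: cauchy_schwarz2; rewrite ?normr_ge0//.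
- by apply: leafsum_ge0 => ?; rewrite sqr_ge0.
- by apply: leafsum_ge0 => ?; rewrite sqr_ge0.
- exact: ih (admissible_contract kqp lt) (node_contract q0 phiN).
- exact: ih (admissible_flip kqp lt) (node_flip q0 phiN).
Qed.

End farey_tree.

(** * Counting the intervals that meet a given one *)

Section overlaps.
Context {R : realType}.
Implicit Types (s t x y a b c d l w : R) (phi : R -> R) (q p k n N Q : nat).

Definition clamp a b t : R := Num.max a (Num.min t b).

Lemma clamp_l a b t : t <= a -> a <= b -> clamp a b t = a.
Proof. by move=> ta ab; rewrite /clamp min_l ?max_l//; exact: le_trans ab. Qed.

Lemma clamp_r a b t : b <= t -> a <= b -> clamp a b t = b.
Proof. by move=> bt ab; rewrite /clamp min_r ?max_r. Qed.

Lemma clamp_id a b t : a <= t -> t <= b -> clamp a b t = t.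
Proof. by move=> at_ tb; rewrite /clamp min_l ?max_r. Qed.

(** Its increment over an interval is the [?]-mass of the part of this interval inside [a, b]. *)
Definition local_minkq a b t : R := minkq (clamp a b t).

(* A monotone function that increases by at least 1 across every interval of
   length at least [l] meeting the interior of [[a, b]], and by at most
   [(b - a) / l + 2] in total. *)
Definition overlap_count a b l t : R := clamp a b t / l + (a < t)%R%:R + (b < t)%R%:R.

Lemma clamp_mono a b x y : x <= y -> clamp a b x <= clamp a b y.
Proof.
move=> xy; rewrite /clamp ge_max le_max lexx/=.
by rewrite le_max le_min !ge_min xy lexx !orbT.
Qed.

Lemma clamp_itv a b t : a <= b -> a <= clamp a b t <= b.
Proof. by move=> ab; rewrite /clamp le_max lexx ge_max ab ge_min lexx orbT. Qed.

Lemma local_minkq_mono a b x y : 0 <= a -> a <= b -> b <= 1 -> x <= y ->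
  local_minkq a b x <= local_minkq a b y.
Proof.
move=> a0 ab b1 xy; have h1 := clamp_itv x ab; have h2 := clamp_itv y ab.
apply: minkq_le; [case/andP: h1; lra|exact: clamp_mono|case/andP: h2; lra].
Qed.

Lemma lt_mono a x y : x <= y -> (a < x)%R%:R <= (a < y)%R%:R :> R.
Proof.
move=> xy; rewrite ler_nat; case: (ltP a x) => // ax.
by rewrite (lt_le_trans ax xy).
Qed.

Lemma overlap_count_mono a b l x y : 0 < l -> x <= y ->
  overlap_count a b l x <= overlap_count a b l y.
Proof.
move=> l0 xy; rewrite !lerD ?lt_mono// ler_pM2r ?invr_gt0//.
exact: clamp_mono.
Qed.

(** An interval that meets the interior of [a, b] either crosses [a] or [b], where a unit jump
    counts it, or lies inside [a, b], where the linear part does. *)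
Lemma overlap_countP a b c d l : a <= b -> c <= d -> 0 < l -> l <= d - c ->
  local_minkq a b d - local_minkq a b c = 0 \/
  1 <= overlap_count a b l d - overlap_count a b l c.
Proof.
move=> ab cd l0 ldc.
have [da|ad] := leP d a.
  by left; rewrite /local_minkq !clamp_l ?subrr// (le_trans cd da).
have [bc|cb] := leP b c.
  by left; rewrite /local_minkq !clamp_r ?subrr// (le_trans bc cd).
right.
have m2 := lt_mono a cd; have m3 := lt_mono b cd.
have m4 : clamp a b c / l <= clamp a b d / l.
  by rewrite ler_pM2r ?invr_gt0//; exact: clamp_mono.
rewrite /overlap_count.
have [ca|ac] := leP c a.
  move: m2 m3 m4; rewrite ad (ltNge a c) ca /=.
  by move: (_ / l) (_ / l) (_ < _)%R%:R (_ < _)%R%:R => *; lra.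
have [db|bd] := leP d b.
  move: m4 m2 m3; rewrite (clamp_id (ltW ad) db) (clamp_id (ltW ac) (ltW cb)).
  rewrite ad ac (ltNge b d) db (ltNge b c) (ltW cb) /=.
  have : 1 <= d / l - c / l by rewrite -mulrBl ler_pdivlMr// mul1r.
  by move: (_ / l) (_ / l) => *; lra.
move: m2 m3 m4; rewrite ad ac bd (ltNge b c) (ltW cb) /=.
by move: (_ / l) (_ / l) => *; lra.
Qed.

(** Both sides are the [?]-mass of the intersection of [a, b] and [s, t]. The symmetry lets one
    counting function serve for leaves in a cell and for cells in a leaf. *)
Lemma overlap_sym a b s t : a <= b -> s <= t ->
  local_minkq a b t - local_minkq a b s = local_minkq s t b - local_minkq s t a.
Proof.
move=> ab st; rewrite /local_minkq.
have [ta|at_] := leP t a.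
  rewrite (clamp_l ta ab) (clamp_l (le_trans st ta) ab).
  by rewrite (clamp_r ta st) (clamp_r (le_trans ta ab) st) !subrr.
have [bs|sb] := leP b s.
  rewrite (clamp_r bs ab) (clamp_r (le_trans bs st) ab).
  by rewrite (clamp_l bs st) (clamp_l (le_trans ab bs) st) !subrr.
congr (minkq _ - minkq _).
  have [tb|bt] := leP t b.
    by rewrite (clamp_id (ltW at_) tb) (clamp_r tb st).
  by rewrite (clamp_r (ltW bt) ab) (clamp_id (ltW sb) (ltW bt)).
have [sa|as_] := leP s a.
  by rewrite (clamp_l sa ab) (clamp_id sa (ltW at_)).
by rewrite (clamp_id (ltW as_) (ltW sb)) (clamp_l (ltW as_) st).
Qed.

Lemma cauchy_schwarz_sum (x k : nat -> R) n : (forall j, 0 <= k j) ->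
  (forall j, x j = 0 \/ 1 <= k j) ->
  (\sum_(0 <= j < n) x j) ^+ 2 <= (\sum_(0 <= j < n) k j) * \sum_(0 <= j < n) x j ^+ 2.
Proof.
move=> k0 xk; elim: n => [|n ih]; first by rewrite !big_geq// expr0n mul0r.
rewrite !big_nat_recr//=; apply: cauchy_schwarz2; rewrite ?sqr_ge0 ?sumr_ge0//.
  by move=> j _; rewrite sqr_ge0.
by have [->|k1] := xk n; rewrite ?expr0n ?mulr0// ler_peMl// sqr_ge0.
Qed.

Lemma sum_sqr_le (x : nat -> R) n : (forall j, 0 <= x j) ->
  \sum_(0 <= j < n) x j ^+ 2 <= (\sum_(0 <= j < n) x j) ^+ 2.
Proof.
move=> x0; elim: n => [|n ih]; first by rewrite !big_geq// expr0n.
rewrite !big_nat_recr//= sqrrD.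
have : 0 <= (\sum_(0 <= i < n) x i) * x n by rewrite mulr_ge0// sumr_ge0.
lra.
Qed.

Definition cell N j t := local_minkq (j%:R / N%:R) (j.+1%:R / N%:R) t.

Lemma cell_itv N j : (0 < N)%N -> (j < N)%N ->
  [/\ 0 <= j%:R / N%:R :> R, j%:R / N%:R <= j.+1%:R / N%:R :> R & j.+1%:R / N%:R <= 1 :> R].
Proof.
move=> N0 jN; have N0' : 0 < N%:R :> R by rewrite ltr0n.
by rewrite divr_ge0// ler_pM2r ?invr_gt0// ler_nat leqnSn ler_pdivrMr// mul1r ler_nat.
Qed.

Lemma sum_cells N s t : (0 < N)%N -> 0 <= s -> s <= t -> t <= 1 ->
  \sum_(0 <= j < N) (cell N j t - cell N j s) = minkq t - minkq s.
Proof.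
move=> N0 s0 st t1.
transitivity (\sum_(0 <= j < N)
    (local_minkq s t (j.+1%:R / N%:R) - local_minkq s t (j%:R / N%:R))).
  apply: eq_big_nat => j /andP[_ jN]; have [h1 h2 h3] := cell_itv N0 jN.
  exact: overlap_sym.
rewrite telescope_sumr// mul0r divff ?pnatr_eq0 -?lt0n//.
by rewrite /local_minkq clamp_r// clamp_l.
Qed.

Lemma cell_mono N j x y : (0 < N)%N -> (j < N)%N -> x <= y -> cell N j x <= cell N j y.
Proof.
by move=> N0 jN xy; have [h1 h2 h3] := cell_itv N0 jN; apply: local_minkq_mono.
Qed.

Lemma sum_cells_sqr_le N s t : (0 < N)%N -> 0 <= s -> s <= t -> t <= 1 ->
  \sum_(0 <= j < N) (cell N j t - cell N j s) ^+ 2 <= (minkq t - minkq s) ^+ 2.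
Proof.
move=> N0 s0 st t1; rewrite -(sum_cells N0 s0 st t1).
pose x j := if (j < N)%N then cell N j t - cell N j s else 0.
have xE j : (0 <= j < N)%N -> cell N j t - cell N j s = x j.
  by rewrite /x => /andP[_ ->].
rewrite (eq_big_nat _ _ (F2 := fun j => x j ^+ 2)) => [|j jN]; last by rewrite xE.
rewrite (eq_big_nat _ _ xE); apply: sum_sqr_le => j; rewrite /x.
by case: ltnP => // jN; rewrite subr_ge0 cell_mono.
Qed.

(** The constant 4 bounds the number of cells that count: 2 from the length of [s, t] in units of 1
    / N, and 2 from the jumps at its ends. *)
Lemma sum_cells_sqr_ge N s t : (0 < N)%N -> 0 <= s -> s <= t -> t <= 1 ->
  t - s <= 2 / N%:R ->
  (minkq t - minkq s) ^+ 2 <= 4 * \sum_(0 <= j < N) (cell N j t - cell N j s) ^+ 2.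
Proof.
move=> N0 s0 st t1 ts; rewrite -(sum_cells N0 s0 st t1).
have N0' : 0 < N%:R :> R by rewrite ltr0n.
have Ni0 : 0 < N%:R^-1 :> R by rewrite invr_gt0.
pose x j := if (j < N)%N then cell N j t - cell N j s else 0.
pose k j := overlap_count s t N%:R^-1 (j.+1%:R / N%:R) - overlap_count s t N%:R^-1 (j%:R
  / N%:R).
have xE j : (0 <= j < N)%N -> cell N j t - cell N j s = x j.
  by rewrite /x => /andP[_ ->].
have jj j : j%:R / N%:R <= j.+1%:R / N%:R :> R by rewrite ler_pM2r// ler_nat.
have -> : \sum_(0 <= j < N) (cell N j t - cell N j s) ^+ 2 = \sum_(0 <= j < N) x j ^+ 2.
  by apply: eq_big_nat => j jN; rewrite xE.
rewrite (eq_big_nat _ _ xE).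
apply: le_trans (cauchy_schwarz_sum N (k := k) _ _) _ => [j|j|].
- by rewrite subr_ge0 overlap_count_mono.
- rewrite /x; case: ltnP => jN; last by left.
  have [h1 h2 h3] := cell_itv N0 jN.
  rewrite /cell overlap_sym//; apply: overlap_countP => //.
  by rewrite -mulrBl -natr1 addrAC subrr add0r mul1r.
apply: ler_wpM2r; first by apply: sumr_ge0 => j _; rewrite sqr_ge0.
rewrite telescope_sumr// mul0r divff ?pnatr_eq0 -?lt0n// /overlap_count.
rewrite (clamp_r t1 st) (clamp_l s0 st) invrK.
have : t * N%:R - s * N%:R <= 2 by rewrite -mulrBl -ler_pdivlMr.
have b1 (b : bool) : (0 <= b%:R :> R) && (b%:R <= 1 :> R).
  by case: b; rewrite /= ?lexx ?ler01.
have := b1 (s < 1); have := b1 (t < 1); have := b1 (s < 0); have := b1 (t < 0).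
by move: (_ * _) (_ * _) (_ < _)%R%:R (_ < _)%R%:R (_ < _)%R%:R (_ < _)%R%:R
  => u v p q r z /andP[? ?] /andP[? ?] /andP[? ?] /andP[? ?] ?; lra.
Qed.

Lemma SigmaE N : (0 < N)%N ->
  @Sigma R N = \sum_(0 <= j < N) variation (cell N j) id ^+ 2.
Proof.
move=> N0; rewrite /Sigma big_mkord; apply: eq_bigr => j _.
have [h1 h2 h3] := cell_itv N0 (ltn_ord j).
rewrite /variation /cell /local_minkq clamp_r// clamp_l//.
by rewrite real_normK ?num_real.
Qed.

End overlaps.

(** * Asymptotics of Sigma *)

Section sigma_asymptotics.
Context {R : realType}.
Implicit Types (s t x y a b c d l w : R) (phi : R -> R) (q p k n N Q : nat).

Lemma variation_sqr (h phi : R -> R) : variation h phi ^+ 2 = (h (phi 1) - h (phi 0)) ^+ 2.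
Proof. by rewrite real_normK ?num_real. Qed.

Lemma node_ends phi q p w : node phi q p w -> 0 <= phi 0 <= 1 /\ 0 <= phi 1 <= 1.
Proof. by move=> [phi01 _ _]; split; apply: phi01; rewrite lexx ler01. Qed.

Lemma sum_cells_variation_le N phi q p w : (0 < N)%N -> node phi q p w ->
  \sum_(0 <= j < N) variation (cell N j) phi ^+ 2 <= variation minkq phi ^+ 2.
Proof.
move=> N0 /node_ends[/andP[u0 u1] /andP[v0 v1]]; rewrite variation_sqr.
under eq_bigr do rewrite variation_sqr.
have [uv|/ltW vu] := leP (phi 0) (phi 1); first exact: sum_cells_sqr_le.
rewrite -sqrrN opprB; under eq_bigr do rewrite -sqrrN opprB.
exact: sum_cells_sqr_le.
Qed.

Lemma sum_cells_variation_ge N phi q p w : (0 < N)%N -> node phi q p w ->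
  `|phi 1 - phi 0| <= 2 / N%:R ->
  variation minkq phi ^+ 2 <= 4 * \sum_(0 <= j < N) variation (cell N j) phi ^+ 2.
Proof.
move=> N0 /node_ends[/andP[u0 u1] /andP[v0 v1]]; rewrite variation_sqr.
under eq_bigr do rewrite variation_sqr.
have [uv|/ltW vu] := leP (phi 0) (phi 1).
  by rewrite ger0_norm ?subr_ge0// => uvN; exact: sum_cells_sqr_ge.
rewrite -sqrrN opprB; under eq_bigr do rewrite -sqrrN opprB.
by rewrite distrC ger0_norm ?subr_ge0// => uvN; exact: sum_cells_sqr_ge.
Qed.

Lemma cell_mono01 N j : (0 < N)%N -> (j < N)%N -> mono01 (@cell R N j).
Proof. by move=> N0 jN x y _ xy _; exact: cell_mono. Qed.

(** Both end denominators q and q + p are at most [Q], so that the node has length at least Q^-2. *)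
Lemma node_overlap a b phi q p w Q : (0 < Q)%N -> 0 <= a -> a <= b -> b <= 1 ->
  (0 < q)%N -> (q + p <= Q)%N -> node phi q p w ->
  variation (local_minkq a b) phi = 0 \/
  1 <= variation (overlap_count a b (Q%:R ^- 2)) phi.
Proof.
move=> Q0 a0 ab b1 q0 qQ phiN; have len := node_length q0 phiN.
have Q0' : 0 < Q%:R :> R by rewrite ltr0n.
have l0 : 0 < Q%:R ^- 2 :> R by rewrite invr_gt0 exprn_gt0.
have lQ : Q%:R ^- 2 <= `|phi 1 - phi 0|.
  rewrite len lef_pV2 ?posrE ?mulr_gt0 ?exprn_gt0 ?ltr0n ?addn_gt0 ?q0//.
  by rewrite expr2 ler_pM// ler_nat// (leq_trans _ qQ)// leq_addr.
rewrite /variation; have [uv|/ltW vu] := leP (phi 0) (phi 1).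
  rewrite ger0_norm ?subr_ge0// in lQ.
  have [e|h] := overlap_countP ab uv l0 lQ; first by left; rewrite e normr0.
  by right; apply: le_trans h (ler_norm _).
rewrite distrC ger0_norm ?subr_ge0// in lQ.
have [e|h] := overlap_countP ab vu l0 lQ; first by left; rewrite distrC e normr0.
by right; rewrite distrC; apply: le_trans h (ler_norm _).
Qed.

Lemma admissible_root Q : (0 < Q)%N -> admissible Q Q 1 0.
Proof. by rewrite /admissible; lia. Qed.

(** A cell counts at most 6 leaves: Q^2 / N <= 4 by length, and 2 by its ends. After Cauchy-Schwarz
    in each cell the sums are exchanged, and the squared masses of the pieces of one leaf sum to at
    most its squared mass. *)
Lemma Sigma_le N Q : (0 < N)%N -> (0 < Q)%N -> (Q ^ 2 <= 4 * N)%N ->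
  @Sigma R N <= 6 * leafweight Q Q 1 0.
Proof.
move=> N0 Q0 QN; rewrite SigmaE//.
have kQ := admissible_root Q0; have idN := @node_id R.
apply: (@le_trans _ _ (\sum_(0 <= j < N)
    6 * leafsum Q (fun phi => variation (cell N j) phi ^+ 2) Q id 1 0)).
  apply: ler_sum_nat => j /andP[_ jN]; have [h1 h2 h3] := cell_itv (R := R) N0 jN.
  set a := j%:R / N%:R in h1 h2 *; set b := j.+1%:R / N%:R in h2 h3 *.
  have l0 : 0 < Q%:R ^- 2 :> R by rewrite invr_gt0 exprn_gt0 ?ltr0n.
  apply: (@le_trans _ _ (variation (overlap_count a b (Q%:R ^- 2)) id *
      leafsum Q (fun phi => variation (cell N j) phi ^+ 2) Q id 1 0)).
    apply: (variation_sqr_le _ _ kQ idN) => [||phi q p w q0 /andP[qQ _] phiN].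
    - exact: cell_mono01.
    - by move=> x y _ xy _; exact: overlap_count_mono.
    - exact: (node_overlap Q0 h1 h2 h3 q0 qQ phiN).
  apply: ler_wpM2r; first by apply: leafsum_ge0 => phi; rewrite sqr_ge0.
  rewrite /variation /overlap_count (clamp_r h3 h2) (clamp_l h1 h2) invrK.
  have ba : b * Q%:R ^+ 2 - a * Q%:R ^+ 2 <= 4.
    rewrite -mulrBl /a /b -mulrBl -natr1 addrAC subrr add0r mul1r.
    by rewrite mulrC ler_pdivrMr ?ltr0n// -natrX -natrM ler_nat.
  have ba0 : a * Q%:R ^+ 2 <= b * Q%:R ^+ 2 by rewrite ler_wpM2r// exprn_ge0.
  have b1 (e : bool) : (0 <= e%:R :> R) && (e%:R <= 1 :> R).
    by case: e; rewrite /= ?lexx ?ler01.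
  have m1 := lt_mono a (@ler01 R); have m2 := lt_mono b (@ler01 R).
  move: ba ba0 m1 m2; have := b1 (a < 1); have := b1 (b < 1).
  have := b1 (a < 0); have := b1 (b < 0).
  move: (_ * _ ^+ 2) (_ * _ ^+ 2) (_ < _)%R%:R (_ < _)%R%:R (_ < _)%R%:R (_ < _)%R%:R.
  move=> u v p q r z /andP[? ?] /andP[? ?] /andP[? ?] /andP[? ?] ? ? ? ?.
  rewrite ger0_norm; lra.
rewrite -mulr_sumr -leafsum_sum ler_pM2l//.
have -> : leafweight Q Q 1 0 = leafsum Q (fun phi =>
  variation minkq phi ^+ 2) Q id 1 0 :> R.
  by rewrite (leafsum_variation kQ idN) expr1n mul1r.
apply: (leafsum_le kQ idN) => phi q p w q0 _ phiN.
exact: sum_cells_variation_le phiN.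
Qed.

(** The constant 16 is 4 for passing to a child of half the mass, times 4 for the number of cells
    that this child counts. *)
Lemma Sigma_ge N Q : (0 < N)%N -> (0 < Q)%N -> (N <= Q ^ 2)%N ->
  leafweight Q Q 1 0 <= 16 * @Sigma R N.
Proof.
move=> N0 Q0 NQ; rewrite SigmaE//.
have kQ := admissible_root Q0; have idN := @node_id R.
have -> : leafweight Q Q 1 0 = leafsum Q (fun phi =>
  variation minkq phi ^+ 2) Q id 1 0 :> R.
  by rewrite (leafsum_variation kQ idN) expr1n mul1r.
apply: (@le_trans _ _ (leafsum Q (fun phi => 16 * \sum_(0 <= j < N)
    variation (cell N j) phi ^+ 2) Q id 1 0)).
  apply: (leafsum_le kQ idN) => phi q p w q0 /andP[qQ Qq] phiN.
  (* The leaf itself may be long if q is small. Its [flip] child has length 1 / ((q + p) (2 q + p)),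
     and both factors are large because Q <= 2 q + p. *)
  have flN := node_flip q0 phiN.
  have q1 : (0 < q + p)%N by rewrite addn_gt0 q0.
  have lenf := node_length q1 flN.
  have lf : `|(phi \o flip) 1 - (phi \o flip) 0| <= 2 / N%:R.
    rewrite lenf ler_pdivlMr ?ltr0n// mulrC ler_pdivrMr ?mulr_gt0 ?ltr0n ?addn_gt0 ?q0//.
    rewrite -!natrM ler_nat; apply: (leq_trans NQ); rewrite expnS expn1.
    have -> : (2 * ((q + p) * (q + p + q)) = (2 * q + 2 * p) * (2 * q + p))%N by lia.
    by apply: leq_mul; lia.
  have := sum_cells_variation_ge N0 flN lf.
  rewrite (node_variation flN) (node_variation phiN) => h.
  have le2 : \sum_(0 <= j < N) variation (cell N j) (phi \o flip) ^+ 2 <=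
      \sum_(0 <= j < N) variation (cell N j) phi ^+ 2.
    apply: ler_sum_nat => j /andP[_ jN].
    rewrite (variation_split (cell_mono01 N0 jN) q0 phiN).
    by apply: lerXn2r; rewrite ?nnegrE ?addr_ge0 ?normr_ge0// lerDr normr_ge0.
  have : w ^+ 2 = 4 * (w / 2) ^+ 2 by field.
  move: (\sum_(0 <= j < N) _) (\sum_(0 <= j < N) _) (w ^+ 2) (_ ^+ 2) h le2 => A B C D; lra.
rewrite leafsumZ leafsum_sum ler_pM2l//.
apply: ler_sum_nat => j /andP[_ jN].
exact: (leafsum_sqr_le (cell_mono01 N0 jN) kQ idN).
Qed.

(* [q^(2s) transfer^n 1 (p / q)] is the homogeneous form of [transfer^n 1]: splitting off
   the first partial quotient turns it into the recursion of the tree. *)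
Definition homog_iter s n q p : R := q%:R `^ (2 * s) * transfer1 s n (p%:R / q%:R).

(** This is [transfer_shift] multiplied by q^(2s). For the child of [flip] the current digit is
    complete and one iterate is used up; for that of [contract] the digit goes on and the number of
    iterates stays. *)
Lemma homog_iter_split s n q p : 0 <= s <= 1 -> (0 < q)%N ->
  homog_iter s n.+1 q p = 4^-1 * (homog_iter s n (q + p) q + homog_iter s n.+1 q (q + p)).
Proof.
move=> s01 q0; have q0' : 0 < q%:R :> R by rewrite ltr0n.
have x0 : 0 <= p%:R / q%:R :> R by rewrite divr_ge0.
have s2 : s <= 2 by lra.
rewrite /homog_iter !transfer1S (transfer_shift s2 x0 (bounded01_transfer1 n s01)).
have e : 1 + p%:R / q%:R = (q + p)%:R / q%:R :> R.
  by rewrite natrD mulrDl divff// gt_eqF.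
rewrite e invf_div powRM ?invr_ge0// mulrDr (mulrCA _ 4^-1) (mulrCA _ 4^-1) -mulrDr.
congr (_ * (_ + _)); rewrite !mulrA; congr (_ * _).
rewrite mulrAC -powRM ?invr_ge0 ?divr_ge0// divff ?gt_eqF//.
by rewrite powR1 mul1r.
Qed.

(** * Tree sums at the critical exponent *)

Section critical_exponent.
Variable s : R.
Hypotheses (s01 : 0 <= s <= 1) (rho1 : growth_rate s = 1).

Lemma transfer1_critical n : 4^-1 <= transfer1 s n 0 /\ transfer1 s n 0 <=
  1 /\ transfer1 s n 1 <= 4.
Proof.
have /andP[h1 h2] := growth_rate_itv n s01; rewrite rho1 expr1n in h1 h2.
have h3 := transfer1_harnack n s01; split; [lra|split=> //; lra].
Qed.

(** The ratio p / q is unbounded on the tree, so that bounds on [0, 1] do not suffice; the first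
    digit alone already supplies the power of 1 + p / q. The constant is 4^-1 from its weight times
    4^-1 from [transfer1_critical]. *)
Lemma homog_iter_ge n q p : (0 < q)%N -> 16^-1 * (q + p)%:R `^ (2 * s) <=
  homog_iter s n.+1 q p.
Proof.
have /andP[s0 s1] := s01.
move=> q0; have q0' : 0 < q%:R :> R by rewrite ltr0n.
have x0 : 0 <= p%:R / q%:R :> R by rewrite divr_ge0.
have s2 : s <= 2 by lra.
have h := transfer_ge_first s2 x0 (bounded01_transfer1 n s01).
have e : (q + p)%:R = q%:R * (1 + p%:R / q%:R) :> R.
  by rewrite natrD mulrDr mulr1 mulrCA divff ?mulr1// gt_eqF.
rewrite /homog_iter transfer1S e powRM ?addr_ge0// mulrCA; apply: ler_wpM2l;
  first exact: powR_ge0.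
apply: le_trans (h _) => [|y y01]; last by apply/ltW/transfer1_gt0 => //; lra.
have -> : 16^-1 * (1 + p%:R / q%:R) `^ (2 * s) =
    4^-1 * ((1 + p%:R / q%:R) `^ (2 * s) * 4^-1) :> R by field.
rewrite ler_pM2l// ler_wpM2l ?powR_ge0//.
have [f0 _] := transfer1_critical n; apply: (le_trans f0).
have [_ m _] := cone_transfer1 n s01; apply: m; rewrite lexx invr_ge0; lra.
Qed.

(** From m + 1 + x <= (m + 1) (1 + x), the power of 1 + x factors out of every term. What remains is
    at most 4 times [transfer s (cst 1) 0], which is at most 32. *)
Lemma homog_iter_le n q p : (0 < q)%N -> homog_iter s n.+1 q p <=
  128 * (q + p)%:R `^ (2 * s).
Proof.
have /andP[s0 s1] := s01.
move=> q0; have q0' : 0 < q%:R :> R by rewrite ltr0n.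
set x := p%:R / q%:R : R; have x0 : 0 <= x by rewrite divr_ge0.
have s2 : s <= 2 by lra.
have b1 : bounded01 (1 : R) (cst 1) by move=> y _; rewrite normr1.
have fM := bounded01_transfer1 n s01.
have h : transfer s (transfer1 s n) x <= ((1 + x) `^ (2 * s) * 4) * transfer s (cst 1) 0.
  apply: (transfer_le s2 s2 x0 (lexx 0) fM b1) => m.
  rewrite /transfer_term /transfer_weight addr0 mulr1 mulrCA -!mulrA ler_wpM2l ?invr_ge0
    ?exprn_ge0//.
  have n1 : (1 : R) <= m.+1%:R by rewrite ler1n.
  apply: (@le_trans _ _ ((m.+1%:R `^ (2 * s) * (1 + x) `^ (2 * s)) * 4)); last first.
    by rewrite le_eqVlt; apply/predU1P; left; ring.
  apply: ler_pM; rewrite ?powR_ge0//.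
  - by apply/ltW/transfer1_gt0 => //; rewrite invr_ge0; lra.
  - rewrite -powRM//; last lra.
    by apply: ge0_ler_powR; rewrite ?nnegrE; nra.
  - have /andP[i0 i1] := shift_inv_itv m x0.
    have [_ [_ f4]] := transfer1_critical n; apply: le_trans f4.
    by have [_ mm _] := cone_transfer1 n s01; apply: mm; rewrite (ltW i0) i1.
have r32 : transfer s (cst 1) 0 <= 32.
  have := transfer_bound s2 (lexx 0) b1; rewrite addr0 expr1n !mulr1.
  exact/le_trans/ler_norm.
have e : (q + p)%:R = q%:R * (1 + x) :> R.
  by rewrite natrD mulrDr mulr1 mulrCA divff ?mulr1// gt_eqF.
rewrite /homog_iter transfer1S -/x e powRM ?addr_ge0// mulrCA; apply: ler_wpM2l;
  first exact: powR_ge0.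
apply: (le_trans h); have p0 := powR_ge0 (1 + x) (2 * s).
have -> : 128 * (1 + x) `^ (2 * s) = ((1 + x) `^ (2 * s) * 4) * 32 :> R by ring.
by rewrite ler_wpM2l// mulr_ge0.
Qed.

(** Both sides obey the same recursion, except that [flip] uses up an iterate; with n > k at least
    one is left at every leaf, where the two previous bounds apply. The constant 64 is 16 times the
    factor 4 from Q <= 2 (q + p). *)
Lemma leafweight_homog_iter Q k n q p : admissible Q k q p -> (k < n)%N ->
  64^-1 * Q%:R `^ (2 * s) * leafweight Q k q p <= homog_iter s n q p /\
  homog_iter s n q p <= 128 * Q%:R `^ (2 * s) * leafweight Q k q p.
Proof.
have /andP[s0 s1] := s01.
have leaf n' q' p' : (0 < q')%N -> (q' + p' <= Q <= 2 * q' + p')%N ->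
    64^-1 * Q%:R `^ (2 * s) <= homog_iter s n'.+1 q' p' /\
    homog_iter s n'.+1 q' p' <= 128 * Q%:R `^ (2 * s).
  move=> q0 /andP[qQ Qq]; have h1 := homog_iter_ge n' p' q0; have h2 :=
    homog_iter_le n' p' q0.
  have k1 : (q' + p')%:R `^ (2 * s) <= Q%:R `^ (2 * s) :> R.
    by apply: ge0_ler_powR; rewrite ?nnegrE ?ler_nat//; lra.
  have k2 : Q%:R `^ (2 * s) <= 4 * (q' + p')%:R `^ (2 * s) :> R.
    apply: (@le_trans _ _ ((2 * (q' + p')%:R) `^ (2 * s))).
      apply: ge0_ler_powR; rewrite ?nnegrE ?mulr_ge0//.
      by rewrite -natrM ler_nat; lia.
    by rewrite powRM// ler_wpM2r ?powR_ge0// powR2_le4.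
  move: (_ `^ _) (_ `^ _) h1 h2 k1 k2 => u v h1 h2 k1 k2; split; lra.
elim: k n q p => [|k ih] n q p /[dup] kqp /and3P[q0 qQ Qq]; case: n => // n kn.
  by rewrite /= !mulr1; apply: leaf => //; lia.
rewrite [leafweight _ _ _ _]/=; case: ltnP => lt; last first.
  by rewrite !mulr1; apply: leaf => //; lia.
have [a1 a2] := ih n _ _ (admissible_flip kqp lt) kn.
have [b1 b2] := ih n.+1 _ _ (admissible_contract kqp lt) (ltnW kn).
rewrite (homog_iter_split n p s01 q0).
move: (leafweight _ _ _ _) (leafweight _ _ _ _) (homog_iter _ _ _ _) (homog_iter _ _ _ _)
  a1 a2 b1 b2.
by move: (_ `^ _) => P A B C D a1 a2 b1 b2; split; lra.
Qed.

Lemma leafweight_asymp Q : (0 < Q)%N ->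
  512^-1 <= Q%:R `^ (2 * s) * leafweight Q Q 1 0 /\
  Q%:R `^ (2 * s) * leafweight Q Q 1 0 <= 64.
Proof.
move=> Q0; have [h1 h2] := leafweight_homog_iter (admissible_root Q0) (ltnSn Q).
have [f1 [f2 _]] := transfer1_critical Q.+1.
have e : homog_iter s Q.+1 1 0 = transfer1 s Q.+1 0
  by rewrite /homog_iter powR1 mul1r mul0r.
rewrite e in h1 h2.
by move: (_ `^ _) (leafweight _ _ _ _) h1 h2 => u v h1 h2; split; lra.
Qed.

Lemma sqrt_scale N : (0 < N)%N -> exists Q, [/\ (0 < Q)%N, (N <= Q ^ 2)%N & (Q ^ 2 <=
  4 * N)%N].
Proof.
move=> N0; have ex : exists Q, (N <= Q ^ 2)%N by exists N; rewrite expnS expn1 leq_pmulr.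
case: (ex_minnP ex) => Q QN Qmin; exists Q.
have Q0 : (0 < Q)%N by case: Q QN {Qmin} => //; rewrite exp0n//; lia.
split=> //; case: Q Q0 QN Qmin => // Q _ QN Qmin.
have : ~~ (N <= Q ^ 2)%N by apply/negP => /Qmin; rewrite ltnn.
rewrite -ltnNge !expnS !expn0 !muln1 => lt.
by case: Q lt {QN Qmin} => [|Q] lt; nia.
Qed.

Lemma Sigma_asymp : exists c C : R, [/\ 0 < c, c <= C &
  forall N, (1 <= N)%N -> c * N%:R `^ (- s) <= Sigma N /\ Sigma N <= C * N%:R `^ (- s)].
Proof.
have /andP[s0 s1] := s01.
(* The factors 512 and 64 are from [leafweight_asymp], 16 and 6 from the comparison with [Sigma],
   and 4 from Q^(2s) <= 4 N^s. *)
exists (512^-1 / 16 / 4), (6 * 64); split=> [||N N0]; [lra|lra|].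
have [Q [Q0 NQ QN]] := sqrt_scale N0.
have [h1 h2] := leafweight_asymp Q0.
have k1 := Sigma_le N0 Q0 QN; have k2 := Sigma_ge N0 Q0 NQ.
have N0' : 0 < N%:R :> R by rewrite ltr0n.
have NQ' : N%:R `^ s <= Q%:R `^ (2 * s) :> R.
  rewrite powRrM; apply: ge0_ler_powR; rewrite ?nnegrE ?powR_ge0//.
  by rewrite powR_mulrn// -natrX ler_nat.
have QN' : Q%:R `^ (2 * s) <= 4 * N%:R `^ s :> R.
  rewrite powRrM powR_mulrn// -natrX.
  apply: (@le_trans _ _ ((4 * N%:R) `^ s)).
    apply: ge0_ler_powR; rewrite ?nnegrE ?mulr_ge0//.
    by rewrite -natrM ler_nat.
  rewrite powRM// ler_wpM2r ?powR_ge0// -[leRHS]powRr1//.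
  by apply: ler_powR; lra.
have p0 : 0 < N%:R `^ s :> R by rewrite powR_gt0.
have l0 := leafweight_ge0 Q Q 1 0 : 0 <= leafweight Q Q 1 0 :> R.
rewrite powRN.
move: (N%:R `^ s) (Q%:R `^ (2 * s)) (leafweight Q Q 1 0) (@Sigma R N) p0 h1 h2 k1 k2 NQ'
  QN' l0.
move=> P q L S P0 h1 h2 k1 k2 Pq qP L0; rewrite !ler_pdivlMr// !ler_pdivrMr//; split.
  have : q * L <= 4 * P * L by apply: ler_wpM2r.
  have : P * L <= P * (16 * S) by apply: ler_wpM2l; lra.
  lra.
have : S * P <= 6 * L * P by apply: ler_wpM2r => //; lra.
have : P * L <= q * L by apply: ler_wpM2r.
lra.
Qed.

Lemma log_ratio_cvg : @log_ratio R @ \oo --> - s.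
Proof.
have [c [C [c0 cC h]]] := Sigma_asymp; have C0 : 0 < C by apply: lt_le_trans cC.
apply/cvgrPdist_le => e e0.
pose K := Num.max `|ln c| `|ln C|.
near=> N.
have N2 : (2 <= N)%N by near: N; exact: nbhs_infty_ge.
have N0 : (0 < N)%N by apply: leq_trans N2.
have N0' : 0 < N%:R :> R by rewrite ltr0n.
have L0 : 0 < ln N%:R :> R by rewrite ln_gt0// ltr1n.
have LK : K <= e * ln N%:R.
  rewrite -ler_pdivrMl// -ler_expR lnK ?posrE//.
  near: N; exact: nbhs_infty_ger.
have [h1 h2] := h N N0.
have p0 : 0 < N%:R `^ (- s) :> R by rewrite powR_gt0.
have S0 : 0 < @Sigma R N by apply: lt_le_trans h1; rewrite mulr_gt0.
have l1 : ln c - s * ln N%:R <= ln (@Sigma R N).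
  by rewrite -mulNr -ln_powR -lnM ?posrE// ler_ln ?posrE// mulr_gt0.
have l2 : ln (@Sigma R N) <= ln C - s * ln N%:R.
  by rewrite -mulNr -ln_powR -lnM ?posrE// ler_ln ?posrE// mulr_gt0.
have k1 : `|ln c| <= K by rewrite le_max lexx.
have k2 : `|ln C| <= K by rewrite le_max lexx orbT.
move: k1 k2; rewrite !ler_norml => /andP[k1 _] /andP[_ k2].
rewrite /log_ratio; apply/andP; split.
  have : ln (Sigma N) / ln N%:R <= e - s by rewrite ler_pdivrMr//; lra.
  lra.
have : - e - s <= ln (Sigma N) / ln N%:R by rewrite ler_pdivlMr//; lra.
lra.
Unshelve. all: by end_near. Qed.

End critical_exponent.

End sigma_asymptotics.

(** * Fejer means of the squared Fourier transform *)

Section trigonometric_integrals.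
Context {R : realType}.
Implicit Types (x y t u S : R) (f F : R -> R).

Lemma is_derive_cosM u t : is_derive t 1 (fun t => cos (u * t)) (- u * sin (u * t)).
Proof.
have h : is_derive t 1 ( *%R u) u.
  by apply: is_derive_eq; rewrite /GRing.scale/= mulr1.
apply: (is_derive_eq (is_derive1_comp (is_derive_cos (u * t)) h)).
by rewrite mulrC mulrN mulNr.
Qed.

Lemma is_derive_sinM u t : is_derive t 1 (fun t => sin (u * t)) (u * cos (u * t)).
Proof.
have h : is_derive t 1 ( *%R u) u.
  by apply: is_derive_eq; rewrite /GRing.scale/= mulr1.
apply: (is_derive_eq (is_derive1_comp (is_derive_sin (u * t)) h)).
by rewrite mulrC.
Qed.

Lemma lipschitz_of_derive f (df : R -> R) L : (forall x, is_derive x 1 f (df x)) ->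
  (forall x, `|df x| <= L) -> forall x y, `|f x - f y| <= L * `|x - y|.
Proof.
move=> fdf dfL x y.
wlog xy : x y / x <= y.
  by move=> h; case: (leP x y) => [/h//|/ltW /h]; rewrite distrC [`|y - x|]distrC.
have cf : {within `[x, y], continuous f}.
  apply: continuous_subspaceT => z; apply: differentiable_continuous.
  by apply/derivable1_diffP; have [] := fdf z.
have [c _ e] := MVT_segment xy (fun z _ => fdf z) cf.
by rewrite distrC e normrM [`|x - y|]distrC ler_wpM2r.
Qed.

Lemma sin_max x : `|sin x| <= 1.
Proof. by rewrite ler_norml sin_geN1 sin_le1. Qed.

Lemma cos_lipschitz u x y : `|cos (u * x) - cos (u * y)| <= `|u| * `|x - y|.
Proof.
apply: (lipschitz_of_derive (is_derive_cosM u)) => z.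
by rewrite normrM normrN ler_piMr// sin_max.
Qed.

Lemma sin_lipschitz u x y : `|sin (u * x) - sin (u * y)| <= `|u| * `|x - y|.
Proof.
apply: (lipschitz_of_derive (is_derive_sinM u)) => z.
by rewrite normrM ler_piMr// cos_max.
Qed.

(** The mean value theorem for the cosine, followed by |sin c| <= |c|; it loses a factor 2 in the
    quadratic term, which is harmless in [fejer_ge]. *)
Lemma cos_ge x : 1 - x ^+ 2 <= cos x.
Proof.
have [c cI e] : exists2 c, `|c| <= `|x| & cos x - 1 = - sin c * x.
  have cc a b : {within `[a, b], continuous (@cos R)}.
    by apply: continuous_subspaceT => z; exact: continuous_cos.
  have [x0|/ltW x0] := leP 0 x.
    have [c] := MVT_segment x0 (fun z _ => is_derive_cos z) (cc 0 x).
    rewrite in_itv/= cos0 subr0 => /andP[c0 cx] e; exists c => //.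
    by rewrite !ger0_norm.
  have [c] := MVT_segment x0 (fun z _ => is_derive_cos z) (cc x 0).
  rewrite in_itv/= cos0 sub0r => /andP[c0 cx] e; exists c.
    by rewrite !ler0_norm// lerN2.
  by rewrite -opprB e; ring.
have sc : `|sin c| <= `|x|.
  apply: le_trans cI; have := sin_lipschitz 1 c 0.
  by rewrite !mul1r normr1 mul1r sin0 !subr0.
have : `|cos x - 1| <= x ^+ 2.
  by rewrite e normrM normrN -(real_normK (num_real x)) expr2 ler_wpM2r.
by rewrite ler_norml; lra.
Qed.

Lemma Rintegral_FTC F f a b : a < b -> (forall x, is_derive x 1 F (f x)) ->
  continuous f -> \int[lebesgue_measure]_(t in `[a, b]) f t = F b - F a.
Proof.
move=> ab Ff cf.
have cF : continuous F.
  move=> z; apply: differentiable_continuous; apply/derivable1_diffP.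
  by have [] := Ff z.
rewrite /Rintegral (@continuous_FTC2 _ f F)//.
- exact: continuous_subspaceT.
- split=> [x _||]; [by have [] := Ff x| |].
    exact/cvg_at_right_filter/cF.
  exact/cvg_at_left_filter/cF.
- by move=> x _; rewrite derive1E; have [] := Ff x.
Qed.

Lemma continuous_integrable f a b : continuous f ->
  lebesgue_measure.-integrable `[a, b] (EFin \o f).
Proof.
move=> cf; apply: continuous_compact_integrable; first exact: segment_compact.
exact: continuous_subspaceT.
Qed.

(** Half the Fejer kernel, that is, half the Fourier transform of the tent 1 - |t| / S on [-S, S].
    The tent replaces the indicator function because its transform is nonnegative. *)
Definition fejer S u : R := \int[lebesgue_measure]_(t in `[0,
  S]) ((1 - t / S) * cos (u * t)).

Lemma continuous_cosM u : continuous (fun t => cos (u * t)).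
Proof.
move=> z; apply: differentiable_continuous; apply/derivable1_diffP.
by have [] := is_derive_cosM u z.
Qed.

Lemma continuous_sinM u : continuous (fun t => sin (u * t)).
Proof.
move=> z; apply: differentiable_continuous; apply/derivable1_diffP.
by have [] := is_derive_sinM u z.
Qed.

Lemma is_derive_tent S t : is_derive t 1 (fun t => 1 - t / S) (- S^-1).
Proof. by apply: is_derive_eq; rewrite /GRing.scale/=; ring. Qed.

Lemma continuous_tent S : continuous (fun t => 1 - t / S).
Proof.
move=> z; apply: differentiable_continuous; apply/derivable1_diffP.
by have [] := is_derive_tent S z.
Qed.

Lemma continuous_fejer S u : continuous (fun t => (1 - t / S) * cos (u * t)).
Proof.
by move=> z; apply: cvgM; [exact: continuous_tent|exact: continuous_cosM].
Qed.

Lemma fejerE S u : 0 < S -> u != 0 -> fejer S u = (1 - cos (u * S)) / (u ^+ 2 * S).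
Proof.
move=> S0 u0; have S0' : S != 0 by rewrite gt_eqF.
(* An antiderivative from one integration by parts; the sine terms of its derivative cancel. *)
pose F t := (1 - t / S) * (u^-1 * sin (u * t)) - (u ^- 2 / S) * cos (u * t).
have FS : fejer S u = F S - F 0.
  apply: Rintegral_FTC => // [t|]; last exact: continuous_fejer.
  have h1 := is_derive_tent S t; have h2 := is_derive_sinM u t; have h3 :=
    is_derive_cosM u t.
  by rewrite /F; apply: is_derive_eq; rewrite /GRing.scale/=; field; rewrite S0' u0.
by rewrite FS /F divff// subrr mul0r mulr0 cos0 mul0r sin0; field; rewrite S0' u0.
Qed.

Lemma tent_integral S : 0 < S -> \int[lebesgue_measure]_(t in `[0, S]) (1 - t / S) = S / 2.
Proof.
move=> S0; have S0' : S != 0 by rewrite gt_eqF.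
pose F t := t - (2 * S)^-1 * t ^+ 2.
have -> : \int[lebesgue_measure]_(t in `[0, S]) (1 - t / S) = F S - F 0.
  apply: Rintegral_FTC => // [t|]; last exact: continuous_tent.
  by rewrite /F; apply: is_derive_eq; rewrite /GRing.scale/=; field.
by rewrite /F; field.
Qed.

Lemma fejer_le S u : 0 < S -> fejer S u <= S.
Proof.
move=> S0; apply: (@le_trans _ _ (\int[lebesgue_measure]_(t in `[0, S]) 1)).
  apply: le_Rintegral => //.
  - exact/continuous_integrable/continuous_fejer.
  - exact/continuous_integrable/cst_continuous.
  move=> t; rewrite /= in_itv/= => /andP[t0 tS].
  have h : 0 <= 1 - t / S by rewrite subr_ge0 ler_pdivrMr ?mul1r.
  have h2 : 0 <= t / S by rewrite divr_ge0// ltW.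
  have := cos_le1 (u * t); move: (cos _) (t / S) h h2 => c z h h2 h3; nra.
rewrite Rintegral_cst//= lebesgue_measure_itv/= lte_fin S0 -EFinB/=.
by rewrite mul1r subr0.
Qed.

(** For u != 0 the sign is visible only in the closed form. It permits dropping pairs of distant
    points in [fejer_mean_ge]. *)
Lemma fejer_ge0 S u : 0 < S -> 0 <= fejer S u.
Proof.
move=> S0; have [->|u0] := eqVneq u 0.
  apply: Rintegral_ge0 => t; rewrite /= in_itv/= => /andP[t0 tS].
  by rewrite mul0r cos0 mulr1 subr_ge0 ler_pdivrMr ?mul1r.
by rewrite fejerE// divr_ge0 ?subr_ge0 ?cos_le1// mulr_ge0 ?sqr_ge0// ltW.
Qed.

Lemma fejer_decay S u : 0 < S -> u != 0 -> fejer S u <= 2 / (u ^+ 2 * S).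
Proof.
move=> S0 u0; rewrite fejerE// ler_pM2r; first by have := cos_geN1 (u * S); lra.
by rewrite invr_gt0 mulr_gt0// exprn_even_gt0.
Qed.

(** On this range cos (u t) >= 1 - 1/4, and the tent has integral S / 2. *)
Lemma fejer_ge S u : 0 < S -> `|u| * S <= 2^-1 -> 3 / 8 * S <= fejer S u.
Proof.
move=> S0 uS; have -> : 3 / 8 * S = 3 / 4 * (S / 2) by field.
rewrite -(tent_integral S0) -RintegralZl//;
  last exact/continuous_integrable/continuous_tent.
apply: le_Rintegral => //.
- by apply: continuous_integrable => z; apply: cvgMl_tmp; exact: continuous_tent.
- exact/continuous_integrable/continuous_fejer.
move=> t; rewrite /= in_itv/= => /andP[t0 tS].
have h : 0 <= 1 - t / S by rewrite subr_ge0 ler_pdivrMr ?mul1r.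
rewrite mulrC ler_wpM2l//; apply: le_trans (cos_ge _).
have ut : `|u * t| <= 2^-1.
  by apply: le_trans uS; rewrite normrM (ger0_norm t0) ler_wpM2l.
have : (u * t) ^+ 2 <= 2^-1 ^+ 2.
  by rewrite -(real_normK (num_real (u * t))); apply: lerXn2r; rewrite ?nnegrE.
lra.
Qed.

End trigonometric_integrals.

(** * Riemann-Stieltjes sums for the measure of [?] *)

Section stieltjes.
Context {R : realType}.
Implicit Types (x y t u a b L K : R) (f : R -> R) (N M n k j : nat).

Local Notation mu := (lebesgue_stieltjes_measure (@minkq_cdf R)).

Lemma minkq_cdfE x : 0 <= x <= 1 -> minkq_cdf x = minkq x.
Proof. by move=> /andP[x0 x1]; rewrite /minkq_cdf min_l// max_r. Qed.

Lemma minkq_measure_itvoc a b : a <= b -> mu `]a, b] = (minkq_cdf b - minkq_cdf a)%:E.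
Proof.
move=> ab; rewrite /lebesgue_stieltjes_measure /measure_extension/=.
by rewrite measurable_mu_extE/= ?wlength_itv_bnd//; exact: is_ocitv.
Qed.

(** The distribution function vanishes on (-1, 0], so that there is no atom at 0. This starts the
    induction in [stieltjes_approx], which adds half-open mesh intervals to the point 0. *)
Lemma minkq_measure_set1 : mu [set 0] = 0%E.
Proof.
apply/eqP; rewrite eq_le measure_ge0 andbT.
apply: (@le_trans _ _ (mu `](-1), 0])).
  apply: le_measure; rewrite ?inE; [exact: measurable_set1|exact: measurable_itv|].
  by move=> x ->; rewrite /= in_itv/= lexx andbT ltrN10.
rewrite minkq_measure_itvoc ?lerN10// minkq_cdfE ?lexx ?ler01// /minkq_cdf min_l; last
  by lra.
by rewrite max_l ?lerN10// subrr.
Qed.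

Lemma minkq_measure_integrable f a b (c1 c2 : bool) K : continuous f -> (forall x,
  `|f x| <= K) ->
  mu.-integrable [set` Interval (BSide c1 a) (BSide c2 b)] (EFin \o f).
Proof.
move=> cf fK; apply: measurable_bounded_integrable => //.
- apply: (@le_lt_trans _ _ (mu `](a - 1), b])).
    apply: le_measure; rewrite ?inE; [exact: measurable_itv|exact: measurable_itv|].
    by move=> x; case: c1; case: c2; rewrite /= !in_itv/= => /andP[h1 h2]; lra.
  have [ab|ba] := leP (a - 1) b; first by rewrite minkq_measure_itvoc// ltry.
  by rewrite set_itv_ge ?measure0 ?ltry// bnd_simp -leNgt ltW.
- by apply: measurable_realfun.subspace_continuous_measurable_fun;
  [exact: measurable_itv|exact: continuous_subspaceT].
- by exists K; split; rewrite ?num_real// => M KM x _; apply: le_trans (fK x) (ltW KM).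
Qed.

Definition stieltjes_sum f M n : R :=
  \sum_(0 <= j < n) (minkq (j.+1%:R / M%:R) - minkq (j%:R / M%:R)) * f (j%:R / M%:R).

(** On each mesh interval the error is at most L / M times its mass, and the masses add up to 1. *)
Lemma stieltjes_approx f L M : (0 < M)%N -> continuous f -> (forall x, `|f x| <= 1) ->
  (forall x y, `|f x - f y| <= L * `|x - y|) ->
  `|\int[mu]_(x in `[0, 1]) f x - stieltjes_sum f M M| <= L / M%:R.
Proof.
move=> M0 cf f1 fL; have M0' : 0 < M%:R :> R by rewrite ltr0n.
have L0 : 0 <= L by have := fL 1 0; rewrite subr0 normr1 mulr1; exact: le_trans.
suff main n : (n <= M)%N -> `|\int[mu]_(x in `[0,
  n%:R / M%:R]) f x - stieltjes_sum f M n| <=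
    L / M%:R * minkq (n%:R / M%:R).
  by have := main M (leqnn _); rewrite divff ?gt_eqF// minkq1 mulr1.
elim: n => [|n ih] nM.
  rewrite /stieltjes_sum big_geq// subr0 mul0r minkq0 mulr0 normr_le0; apply/eqP.
  have -> : \int[mu]_(x in `[0, 0]) f x = \int[mu]_(x in [set 0]) (f 0).
    by rewrite set_itv1; apply: eq_Rintegral => x /[!inE] ->.
  rewrite Rintegral_cst; last exact: measurable_set1.
  by rewrite [X in fine X]minkq_measure_set1 mulr0.
have ab : n%:R / M%:R <= n.+1%:R / M%:R :> R by rewrite ler_pM2r ?invr_gt0// ler_nat.
have [h1 _ h3] := cell_itv (R := R) M0 nM.
have split : `[0, (n.+1%:R / M%:R)]%classic =
    (`[0, (n%:R / M%:R)] `|` `](n%:R / M%:R), (n.+1%:R / M%:R)])%classic :> set R.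
  by rewrite (@itv_bndbnd_setU _ _ _ (BRight (n%:R / M%:R)))// bnd_simp.
rewrite split Rintegral_setU; first last.
- rewrite disj_set2E; apply/eqP/seteqP; split=> // x [].
  by rewrite /= !in_itv/= => /andP[_ h] /andP[]; rewrite ltNge h.
- by rewrite -split; exact: minkq_measure_integrable f1.
- exact: measurable_itv.
- exact: measurable_itv.
rewrite /stieltjes_sum big_nat_recr//= -/(stieltjes_sum f M n).
have muE : fine (mu `](n%:R / M%:R), (n.+1%:R / M%:R)]) =
    minkq (n.+1%:R / M%:R) - minkq (n%:R / M%:R).
  by rewrite minkq_measure_itvoc//= !minkq_cdfE ?h1 ?h3 ?andbT ?(le_trans ab)//=
    (le_trans h1).
set w := minkq _ - minkq _ in muE *.
have I1 : \int[mu]_(x in `](n%:R / M%:R), (n.+1%:R / M%:R)]) f x - w * f (n%:R / M%:R) =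
    \int[mu]_(x in `](n%:R / M%:R), (n.+1%:R / M%:R)]) (f x - f (n%:R / M%:R)).
  rewrite RintegralB; [|exact: measurable_itv|exact: minkq_measure_integrable f1|].
    rewrite Rintegral_cst; last exact: measurable_itv.
    by rewrite [X in f _ * X]muE [f _ * _]mulrC.
  by apply: (minkq_measure_integrable _ _ _ _ (K := 1)) => [|x];
    [exact: cst_continuous|exact: f1].
have cd : continuous (fun x => f x - f (n%:R / M%:R)).
  by move=> x; apply: cvgB; [exact: cf|exact: cvg_cst].
have d2 x : `|f x - f (n%:R / M%:R)| <= 2.
  by rewrite (le_trans (ler_normB _ _))// (_ : 2 = 1 + 1)// lerD.
have I2 : `|\int[mu]_(x in `](n%:R / M%:R), (n.+1%:R / M%:R)]) f x - w * f (n%:R / M%:R)| <=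
    L / M%:R * w.
  rewrite I1; apply: (le_trans (le_normr_Rintegral _ _)).
  - exact: measurable_itv.
  - exact: minkq_measure_integrable d2.
  rewrite -[X in _ <= _ * X]muE -Rintegral_cst; last exact: measurable_itv.
  apply: le_Rintegral.
  - exact: measurable_itv.
  - apply: (minkq_measure_integrable _ _ _ _ (K := 2)) => [x|x]; last by rewrite normr_id.
    by apply: cvg_norm; exact: cd.
  - apply: (minkq_measure_integrable _ _ _ _ (K := `|L / M%:R|)) => [|x]; last exact: lexx.
    exact: cst_continuous.
  move=> x; rewrite /= in_itv/= => /andP[nx xn].
  apply: (le_trans (fL _ _)); rewrite ler_wpM2l// ger0_norm ?subr_ge0 ?(ltW nx)//.
  rewrite lerBlDr (le_trans xn)// -natr1 mulrDl mul1r addrC lexx//.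
have := ih (ltnW nM); move: I2.
have -> : L / M%:R * minkq (n.+1%:R / M%:R) = L / M%:R * minkq (n%:R / M%:R) + L / M%:R * w.
  by rewrite -mulrDr /w addrC subrK.
move=> h2 h4; rewrite opprD addrACA; apply: (le_trans (ler_normD _ _)).
exact: lerD.
Qed.

End stieltjes.

(** * The squared Fourier transform and its discretization *)

Section energy.
Context {R : realType}.
Implicit Types (x y t u a b c S T : R) (f g : R -> R) (N M L n k j A B : nat).

Local Notation mu := (lebesgue_stieltjes_measure (@minkq_cdf R)).

(** A constant has Lipschitz constant 0, so that the approximation is exact with a single mesh
    interval. *)
Lemma minkq_measure_total : \int[mu]_(x in `[0, 1]) (1 : R) = 1.
Proof.
have c1 : continuous (cst 1 : R -> R) by exact: cst_continuous.
have n1 (x : R) : `|cst 1 x| <= 1 :> R by rewrite normr1.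
have l1 (x y : R) : `|cst 1 x - cst 1 y| <= 0 * `|x - y| :> R.
  by rewrite subrr normr0 mul0r.
have := stieltjes_approx (ltn0Sn 0) c1 n1 l1.
rewrite mul0r /stieltjes_sum big_nat1 divr1 mul0r minkq1 minkq0 subr0 mulr1.
by rewrite normr_le0 subr_eq0 => /eqP.
Qed.

Lemma minkq_measure_dist_le f g c : continuous f -> continuous g -> (forall x, `|f x| <=
  1) ->
  (forall x, `|g x| <= 1) -> (forall x, 0 <= x <= 1 -> `|f x - g x| <= c) ->
  `|\int[mu]_(x in `[0, 1]) f x - \int[mu]_(x in `[0, 1]) g x| <= c.
Proof.
move=> cf cg f1 g1 fgc.
have fg2 x : `|f x - g x| <= 2.
  by rewrite (le_trans (ler_normB _ _))// (_ : 2 = 1 + 1)// lerD.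
have cfg : continuous (fun x => f x - g x).
  by move=> x; apply: cvgB; [exact: cf|exact: cg].
rewrite -RintegralB; [|exact: measurable_itv|exact: minkq_measure_integrable f1|exact:
  minkq_measure_integrable g1].
apply: (le_trans (le_normr_Rintegral _ _)).
- exact: measurable_itv.
- exact: minkq_measure_integrable fg2.
have <- : \int[mu]_(x in `[0, 1]) (c * 1) = c.
  rewrite RintegralZl; [by rewrite minkq_measure_total mulr1|exact: measurable_itv|].
  by apply: (minkq_measure_integrable _ _ _ _ (K := 1)) => [|x];
    [exact: cst_continuous|rewrite normr1].
apply: le_Rintegral.
- exact: measurable_itv.
- apply: (minkq_measure_integrable _ _ _ _ (K := 2)) => [x|x]; last by rewrite normr_id.
  by apply: cvg_norm; exact: cfg.
- apply: (minkq_measure_integrable _ _ _ _ (K := `|c * 1|)) => [|x]; last exact: lexx.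
  exact: cst_continuous.
by move=> x; rewrite /= in_itv/= mulr1; exact: fgc.
Qed.

Definition fcos t : R := \int[mu]_(x in `[0, 1]) cos (x * t).
Definition fsin t : R := \int[mu]_(x in `[0, 1]) sin (x * t).
Definition energy t : R := fcos t ^+ 2 + fsin t ^+ 2.

Lemma normc_minkq_fourier t : Normc.normc (minkq_fourier t) ^+ 2 = energy t.
Proof. by rewrite /minkq_fourier/= sqr_sqrtr// addr_ge0// sqr_ge0. Qed.

Lemma cosMC t : (fun x => cos (x * t)) = (fun x => cos (t * x)).
Proof. by apply/funext => x; rewrite mulrC. Qed.

Lemma sinMC t : (fun x => sin (x * t)) = (fun x => sin (t * x)).
Proof. by apply/funext => x; rewrite mulrC. Qed.

Lemma cont0 : continuous (fun _ : R => 0 : R). Proof. exact: cst_continuous. Qed.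

Lemma Rintegral0 : \int[mu]_(x in `[0, 1]) (0 : R) = 0.
Proof. by rewrite Rintegral_cst ?mul0r//; exact: measurable_itv. Qed.

Lemma fcos_le1 t : `|fcos t| <= 1.
Proof.
have n0 (x : R) : `|0 : R| <= 1 by rewrite normr0.
have d1 (x : R) : 0 <= x <= 1 -> `|cos (t * x) - 0| <= 1 by rewrite subr0 cos_max.
have := minkq_measure_dist_le (@continuous_cosM R t) cont0 (fun x => cos_max _) n0 d1.
by rewrite Rintegral0 subr0 -cosMC.
Qed.

Lemma fsin_le1 t : `|fsin t| <= 1.
Proof.
have n0 (x : R) : `|0 : R| <= 1 by rewrite normr0.
have d1 (x : R) : 0 <= x <= 1 -> `|sin (t * x) - 0| <= 1 by rewrite subr0 sin_max.
have := minkq_measure_dist_le (@continuous_sinM R t) cont0 (fun x => sin_max _) n0 d1.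
by rewrite Rintegral0 subr0 -sinMC.
Qed.

Lemma fcos_lipschitz t u : `|fcos t - fcos u| <= `|t - u|.
Proof.
rewrite /fcos (cosMC t) (cosMC u); apply: minkq_measure_dist_le => [||x|x|x x01].
- exact: continuous_cosM.
- exact: continuous_cosM.
- exact: cos_max.
- exact: cos_max.
rewrite [t * x]mulrC [u * x]mulrC; apply: (le_trans (cos_lipschitz _ _ _)).
by rewrite ger0_norm ?ler_piMl//; case/andP: x01.
Qed.

Lemma fsin_lipschitz t u : `|fsin t - fsin u| <= `|t - u|.
Proof.
rewrite /fsin (sinMC t) (sinMC u); apply: minkq_measure_dist_le => [||x|x|x x01].
- exact: continuous_sinM.
- exact: continuous_sinM.
- exact: sin_max.
- exact: sin_max.
rewrite [t * x]mulrC [u * x]mulrC; apply: (le_trans (sin_lipschitz _ _ _)).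
by rewrite ger0_norm ?ler_piMl//; case/andP: x01.
Qed.

Lemma continuous_lipschitz1 f : (forall t u, `|f t - f u| <= `|t - u|) -> continuous f.
Proof.
move=> fl t; apply/cvgrPdist_le => e e0; near=> u; apply: (le_trans (fl t u)).
near: u; apply: cvgr_dist_le => //.
Unshelve. all: by end_near. Qed.

Lemma continuous_energy : continuous energy.
Proof.
have cc := continuous_lipschitz1 fcos_lipschitz.
have cs := continuous_lipschitz1 fsin_lipschitz.
move=> t; rewrite /energy; apply: (@cvgD _ _ _ _ _ (fun t => fcos t ^+ 2) (fun t =>
  fsin t ^+ 2)).
  by apply: cvgM; exact: cc.
by apply: cvgM; exact: cs.
Qed.

Lemma energy_ge0 t : 0 <= energy t.
Proof. by rewrite addr_ge0// sqr_ge0. Qed.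

Lemma energyN t : energy (- t) = energy t.
Proof.
rewrite /energy; have -> : fcos (- t) = fcos t.
  by rewrite /fcos; congr (Rintegral _ _ _); apply/funext => x; rewrite mulrN cosN.
have e : fsin (- t) = - fsin t.
  rewrite -[RHS]mulN1r /fsin -RintegralZl; [|exact: measurable_itv|].
    by apply: eq_Rintegral => x _; rewrite mulrN sinN mulN1r.
  apply: (minkq_measure_integrable _ _ _ _ (K := 1)) => [|x]; last exact: sin_max.
  by rewrite sinMC; exact: continuous_sinM.
by rewrite e sqrrN.
Qed.

Lemma sqr_dist (a b d : R) : `|a| <= 1 -> `|b| <= 1 -> `|a - b| <= d ->
  `|a ^+ 2 - b ^+ 2| <= 2 * d.
Proof.
move=> a1 b1 ab; rewrite subr_sqr normrM mulrC.
apply: ler_pM => //; apply: (le_trans (ler_normD _ _)).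
by rewrite (_ : 2 = 1 + 1)// lerD.
Qed.

Definition mesh_mass M j : R := minkq (j.+1%:R / M%:R) - minkq (j%:R / M%:R).

Lemma mesh_mass_ge0 M j : (j < M)%N -> 0 <= mesh_mass M j.
Proof.
move=> jM; have M0 : (0 < M)%N by apply: leq_ltn_trans jM.
have [h1 h2 h3] := cell_itv (R := R) M0 jM.
by rewrite subr_ge0 minkq_le.
Qed.

Lemma sum_mesh_mass M : (0 < M)%N -> \sum_(0 <= j < M) mesh_mass M j = 1.
Proof.
move=> M0; rewrite /mesh_mass (telescope_sumr (fun j => minkq (j%:R / M%:R)))//.
by rewrite divff ?pnatr_eq0 -?lt0n// mul0r minkq1 minkq0 subr0.
Qed.

Lemma stieltjes_sumE f M n :
  stieltjes_sum f M n = \sum_(0 <= j < n) mesh_mass M j * f (j%:R / M%:R).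
Proof. by []. Qed.

Lemma stieltjes_sum_le1 f M : (0 < M)%N -> (forall x, `|f x| <= 1) ->
  `|stieltjes_sum f M M| <= 1.
Proof.
move=> M0 f1; rewrite stieltjes_sumE; apply: (le_trans (ler_norm_sum _ _ _)).
rewrite -(sum_mesh_mass M0); apply: ler_sum_nat => j /andP[_ jM].
by rewrite normrM (ger0_norm (mesh_mass_ge0 jM)) ler_piMr// mesh_mass_ge0.
Qed.

Definition energy_sum M t : R := stieltjes_sum (fun x => cos (t * x)) M M ^+ 2 +
  stieltjes_sum (fun x => sin (t * x)) M M ^+ 2.

Lemma energy_sum_dist M t : (0 < M)%N -> `|energy t - energy_sum M t| <= 4 * (`|t| / M%:R).
Proof.
move=> M0; rewrite /energy /energy_sum opprD addrACA.
have hc : `|fcos t - stieltjes_sum (fun x => cos (t * x)) M M| <= `|t| / M%:R.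
  rewrite /fcos cosMC; apply: stieltjes_approx => // [|x|x y].
  - exact: continuous_cosM.
  - exact: cos_max.
  - exact: cos_lipschitz.
have hs : `|fsin t - stieltjes_sum (fun x => sin (t * x)) M M| <= `|t| / M%:R.
  rewrite /fsin sinMC; apply: stieltjes_approx => // [|x|x y].
  - exact: continuous_sinM.
  - exact: sin_max.
  - exact: sin_lipschitz.
have c1 := stieltjes_sum_le1 M0 (fun x => cos_max (t * x)).
have s1 := stieltjes_sum_le1 M0 (fun x => sin_max (t * x)).
apply: (le_trans (ler_normD _ _)).
have := lerD (sqr_dist (fcos_le1 t) c1 hc) (sqr_dist (fsin_le1 t) s1 hs).
move/le_trans; apply; rewrite le_eqVlt; apply/predU1P; left; ring.
Qed.

(** The discrete form of |m(it)|^2 as the double integral of cos ((x - y) t), by the addition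
    formula. *)
Lemma energy_sumE M t : energy_sum M t = \sum_(0 <= j < M) \sum_(0 <= k < M)
  mesh_mass M j * mesh_mass M k * cos ((j%:R / M%:R - k%:R / M%:R) * t).
Proof.
rewrite /energy_sum !stieltjes_sumE !expr2 !mulr_suml -big_split/=.
apply: eq_bigr => j _; rewrite !mulr_sumr -big_split/=; apply: eq_bigr => k _.
by rewrite [(_ - _) * t]mulrBl cosB [_ / _ * t]mulrC [k%:R / _ * t]mulrC; ring.
Qed.

Lemma continuous_sum n (F : nat -> R -> R) : (forall j, continuous (F j)) ->
  continuous (fun t => \sum_(0 <= j < n) F j t).
Proof.
move=> cF t; elim: n => [|n ih].
  have -> : (fun t => \sum_(0 <= j < 0) F j t) = (fun=> 0) by apply/funext => z;
    rewrite big_geq.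
  exact: cvg_cst.
have -> : (fun t => \sum_(0 <= j < n.+1) F j t) = (fun t => \sum_(0 <=
  j < n) F j t + F n t).
  by apply/funext => z; rewrite big_nat_recr.
by apply: cvgD => //; exact: cF.
Qed.

Lemma Rintegral_sum n (F : nat -> R -> R) a b : (forall j, continuous (F j)) ->
  \int[lebesgue_measure]_(t in `[a, b]) (\sum_(0 <= j < n) F j t) =
  \sum_(0 <= j < n) \int[lebesgue_measure]_(t in `[a, b]) F j t.
Proof.
move=> cF; elim: n => [|n ih].
  rewrite big_geq//; under eq_Rintegral do rewrite big_geq//.
  by rewrite Rintegral_cst ?mul0r.
rewrite big_nat_recr//= -ih -RintegralD//.
- by apply: eq_Rintegral => t _; rewrite big_nat_recr.
- exact/continuous_integrable/continuous_sum.
- exact: continuous_integrable.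
Qed.

End energy.

(** * Fejer means as double sums over cells *)

Section fejer_means.
Context {R : realType}.
Implicit Types (x y t u S T : R) (f g : R -> R) (N M L n k j A B a b : nat).

Definition fejer_mean S (f : R -> R) : R :=
  \int[lebesgue_measure]_(t in `[0, S]) ((1 - t / S) * f t).

Lemma continuous_tentM S f : continuous f -> continuous (fun t => (1 - t / S) * f t).
Proof. by move=> cf t; apply: cvgM; [exact: continuous_tent|exact: cf]. Qed.

Lemma tent01 S t : 0 < S -> 0 <= t <= S -> 0 <= 1 - t / S <= 1.
Proof.
move=> S0 /andP[t0 tS]; rewrite subr_ge0 ler_pdivrMr// mul1r tS/=.
by rewrite gerBl divr_ge0// ltW.
Qed.

Lemma fejer_mean_energy_sum S M : 0 < S -> fejer_mean S (energy_sum M) =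
  \sum_(0 <= j < M) \sum_(0 <= k < M)
    mesh_mass M j * mesh_mass M k * fejer S (j%:R / M%:R - k%:R / M%:R).
Proof.
move=> S0; pose F j k t := mesh_mass M j * mesh_mass M k * ((1 - t / S) * cos ((j%:R /
  M%:R - k%:R / M%:R) * t)).
have cF j k : continuous (F j k).
  by move=> t; apply: cvgMl_tmp; exact: continuous_fejer.
have -> : fejer_mean S (energy_sum M) =
   \int[lebesgue_measure]_(t in `[0, S]) (\sum_(0 <= j < M) \sum_(0 <= k < M) F j k t).
  apply: eq_Rintegral => t _; rewrite energy_sumE mulr_sumr; apply: eq_bigr => j _.
  by rewrite mulr_sumr; apply: eq_bigr => k _; rewrite /F; ring.
rewrite Rintegral_sum; last by move=> j; exact: continuous_sum.
apply: eq_bigr => j _; rewrite Rintegral_sum//; apply: eq_bigr => k _.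
by rewrite /F RintegralZl//; exact/continuous_integrable/continuous_fejer.
Qed.

Lemma continuous_energy_sum M : continuous (@energy_sum R M).
Proof.
move=> t; have -> : energy_sum M = (fun t => \sum_(0 <= j < M) \sum_(0 <= k < M)
  mesh_mass M j * mesh_mass M k * cos ((j%:R / M%:R - k%:R / M%:R) * t)) :> (R -> R).
  by apply/funext => z; rewrite energy_sumE.
apply: continuous_sum => j; apply: continuous_sum => k z.
by apply: cvgMl_tmp; exact: continuous_cosM.
Qed.

Lemma fejer_mean_dist S M : 0 < S -> (0 < M)%N ->
  `|fejer_mean S (@energy R) - fejer_mean S (energy_sum M)| <= 4 * S ^+ 2 / M%:R.
Proof.
move=> S0 M0; have M0' : 0 < M%:R :> R by rewrite ltr0n.
have c1 := @continuous_tentM S _ (@continuous_energy R).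
have c2 := @continuous_tentM S _ (@continuous_energy_sum M).
have c3 : continuous (fun t => (1 - t / S) * energy t - (1 - t / S) * energy_sum M t).
  by move=> t; apply: cvgB; [exact: c1|exact: c2].
rewrite /fejer_mean -RintegralB//;
  [|exact: continuous_integrable|exact: continuous_integrable].
apply: (le_trans (le_normr_Rintegral _ _)) => //; first exact: continuous_integrable.
have -> : 4 * S ^+ 2 / M%:R = \int[lebesgue_measure]_(t in `[0, S]) (4 * (S / M%:R)).
  rewrite Rintegral_cst//= lebesgue_measure_itv/= lte_fin S0 -EFinB/= subr0.
  by rewrite expr2; ring.
apply: le_Rintegral => //.
- by apply: continuous_integrable => t; apply: cvg_norm; exact: c3.
- by apply: continuous_integrable => t; exact: cvg_cst.
move=> t; rewrite /= in_itv/= => t0S; have /andP[h1 h2] := tent01 S0 t0S.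
rewrite -mulrBr normrM (ger0_norm h1).
have h3 := energy_sum_dist t M0; case/andP: t0S => t0 tS.
have h4 : 4 * (`|t| / M%:R) <= 4 * (S / M%:R).
  by rewrite ler_pM2l// ler_pM2r ?invr_gt0// ger0_norm.
apply: le_trans h4; apply: le_trans h3; exact: ler_piMl.
Qed.

Lemma sum_nat_mul (u : nat -> R) N L :
  \sum_(0 <= j < N * L) u j = \sum_(0 <= A < N) \sum_(0 <= a < L) u (A * L + a)%N.
Proof.
elim: N => [|N ih]; first by rewrite mul0n !big_geq.
rewrite big_nat_recr//= -ih mulSn addnC (big_cat_nat (leq0n (N * L)%N) (leq_addr _ _))/=.
congr (_ + _); rewrite -{1}[(N * L)%N]add0n big_addn addKn.
by apply: eq_bigr => a _; rewrite addnC.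
Qed.

Lemma mesh_block N L A a : (0 < N)%N -> (0 < L)%N -> (a <= L)%N ->
  (A%:R / N%:R <= (A * L + a)%:R / (N * L)%:R :> R) &&
  ((A * L + a)%:R / (N * L)%:R <= A.+1%:R / N%:R :> R).
Proof.
move=> N0 L0 aL.
have e k : k%:R / N%:R = (k * L)%:R / (N * L)%:R :> R.
  by rewrite !natrM invfM mulrACA divff ?mulr1// pnatr_eq0 -lt0n.
rewrite !e !ler_pM2r ?invr_gt0 ?ltr0n ?muln_gt0 ?N0// !ler_nat leq_addr/=.
by rewrite mulSn addnC leq_add2r.
Qed.

Lemma sum_mesh_mass_block N L A : (0 < N)%N -> (0 < L)%N ->
  \sum_(0 <= a < L) mesh_mass (N * L) (A * L + a) = mesh_mass N A :> R.
Proof.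
move=> N0 L0; rewrite /mesh_mass.
transitivity (\sum_(0 <= a < L) (minkq ((A * L + a.+1)%:R / (N * L)%:R : R) -
   minkq ((A * L + a)%:R / (N * L)%:R))); first by apply: eq_bigr => a _; rewrite addnS.
rewrite (telescope_sumr (fun a => minkq ((A * L + a)%:R / (N * L)%:R)))// addn0.
have e k : k%:R / N%:R = (k * L)%:R / (N * L)%:R :> R.
  by rewrite !natrM invfM mulrACA divff ?mulr1// pnatr_eq0 -lt0n.
by rewrite !e mulSn addnC.
Qed.

Lemma sum_mesh_mass_sqr N : \sum_(0 <= A < N) mesh_mass N A ^+ 2 = @Sigma R N.
Proof. by rewrite /Sigma big_mkord. Qed.

Lemma mesh_lt N L A a : (A < N)%N -> (a < L)%N -> (A * L + a < N * L)%N.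
Proof. by move=> AN aL; nia. Qed.

(** The N cells of order 1 / S carry the comparison with [Sigma]; their subdivision into L parts
    makes the discretization error as small as desired while N stays fixed. *)
Lemma fejer_mean_blocks S N L : 0 < S -> (0 < N)%N -> (0 < L)%N ->
  fejer_mean S (energy_sum (N * L)) =
  \sum_(0 <= A < N) \sum_(0 <= B < N) \sum_(0 <= a < L) \sum_(0 <= b < L)
    mesh_mass (N * L) (A * L + a) * mesh_mass (N * L) (B * L + b) *
    fejer S ((A * L + a)%:R / (N * L)%:R - (B * L + b)%:R / (N * L)%:R).
Proof.
move=> S0 N0 L0; rewrite fejer_mean_energy_sum// sum_nat_mul; apply: eq_bigr => A _.
rewrite [RHS]exchange_big/=; apply: eq_bigr => a _.
by rewrite sum_nat_mul.
Qed.

(** Only pairs in a common cell are kept. Their distance is at most 1 / N <= 1 / (2 S), where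
    [fejer_ge] applies. *)
Lemma fejer_mean_ge S N L : 0 < S -> (0 < N)%N -> (0 < L)%N -> 2 * S <= N%:R ->
  3 / 8 * S * @Sigma R N <= fejer_mean S (energy_sum (N * L)).
Proof.
move=> S0 N0 L0 SN; rewrite fejer_mean_blocks// -sum_mesh_mass_sqr mulr_sumr.
have N0' : 0 < N%:R :> R by rewrite ltr0n.
have pos A B a b : (A < N)%N -> (B < N)%N -> (a < L)%N -> (b < L)%N ->
    0 <= mesh_mass (N * L) (A * L + a) * mesh_mass (N * L) (B * L + b) :> R.
  by move=> AN BN aL bL; rewrite mulr_ge0// mesh_mass_ge0// mesh_lt.
apply: ler_sum_nat => A /andP[_ AN].
apply: (@le_trans _ _ (\sum_(0 <= a < L) \sum_(0 <= b < L)
    mesh_mass (N * L) (A * L + a) * mesh_mass (N * L) (A * L + b) *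
    fejer S ((A * L + a)%:R / (N * L)%:R - (A * L + b)%:R / (N * L)%:R))); last first.
  rewrite [leRHS](bigD1_seq A) ?mem_index_iota ?iota_uniq//= lerDl.
  rewrite big_seq_cond; apply: sumr_ge0 => B; rewrite mem_index_iota =>
    /andP[/andP[_ BN] _].
  rewrite big_seq; apply: sumr_ge0 => a; rewrite mem_index_iota => /andP[_ aL].
  rewrite big_seq; apply: sumr_ge0 => b; rewrite mem_index_iota => /andP[_ bL].
  by rewrite mulr_ge0 ?pos ?fejer_ge0.
rewrite -(sum_mesh_mass_block A N0 L0) expr2 mulr_suml mulr_sumr; apply: ler_sum_nat =>
  a /andP[_ aL].
rewrite mulr_sumr mulr_sumr; apply: ler_sum_nat => b /andP[_ bL].
rewrite mulrC; apply: ler_wpM2l; first exact: pos.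
apply: fejer_ge => //.
have /andP[h1 h2] := mesh_block A N0 L0 (ltnW aL).
have /andP[h3 h4] := mesh_block A N0 L0 (ltnW bL).
set x := (A * L + a)%:R / _ in h1 h2 *; set y := (A * L + b)%:R / _ in h3 h4 *.
have d : `|x - y| <= N%:R^-1.
  have e : A.+1%:R / N%:R - A%:R / N%:R = N%:R^-1 :> R.
    by rewrite -mulrBl -natr1 addrAC subrr add0r mul1r.
  by rewrite -e ler_norml; apply/andP; split; lra.
apply: (@le_trans _ _ (N%:R^-1 * S)); first by rewrite ler_wpM2r// ltW.
by rewrite mulrC ler_pdivrMr// mulrC; lra.
Qed.

Definition ndist A B : nat := (A - B + (B - A))%N.

Lemma ndistC A B : ndist A B = ndist B A. Proof. by rewrite /ndist addnC. Qed.

(** Points of two cells at index distance d are at least (d - 1) / N apart; the maximum with 1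
    covers equal and adjacent cells. *)
Definition schur_weight (d : nat) : R := (maxn 1 d.-1)%:R ^- 2.

Lemma schur_weight_ge0 d : 0 <= schur_weight d.
Proof. by rewrite /schur_weight invr_ge0 exprn_ge0. Qed.

Lemma schur_sum n : \sum_(0 <= d < n) schur_weight d <= 4.
Proof.
(* The distances 0, 1 and 2 contribute 3; the others contribute 1 / m^2 from m = 2 on, which
   telescopes against 1 / (m - 1) - 1 / m. *)
have main k : \sum_(0 <= d < k.+3) schur_weight d <= 4 - k.+1%:R^-1.
  elim: k => [|k ih].
    by rewrite !big_nat_recl//= big_geq// /schur_weight/= /maxn/= !expr1n invr1; lra.
  rewrite big_nat_recr//=; apply: (le_trans (lerD ih (lexx _))).
  rewrite /schur_weight/= /maxn/=; rewrite -[k.+2%:R]natr1.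
  have k1 : 0 < k.+1%:R :> R by rewrite ltr0n.
  move: (k.+1%:R) k1 => z z1.
  have -> : 4 - (z + 1)^-1 = 4 - z^-1 + (z * (z + 1))^-1.
    by field; rewrite !gt_eqF//; lra.
  by rewrite lerD2l lef_pV2 ?posrE; nra.
apply: (@le_trans _ _ (\sum_(0 <= d < n.+3) schur_weight d)).
  rewrite [leRHS](big_cat_nat (leq0n n) (leq_addl 3 n))/= lerDl sumr_ge0// => d _.
  exact: schur_weight_ge0.
by apply: (le_trans (main n)); rewrite gerBl invr_ge0.
Qed.

Lemma schur_row A N : (A < N)%N -> \sum_(0 <= B < N) schur_weight (ndist A B) <= 8.
Proof.
move=> AN; rewrite (big_cat_nat (leq0n A) (ltnW AN))/=.
have -> : 8 = 4 + 4 :> R by ring.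
apply: lerD.
  rewrite big_nat_rev/= add0n; apply: le_trans (schur_sum A.+1).
  rewrite big_nat_recl//= -[leLHS]add0r lerD ?schur_weight_ge0//.
  by rewrite le_eqVlt; apply/predU1P; left; apply: eq_big_nat => B BA;
    congr schur_weight; rewrite /ndist; lia.
rewrite -{1}[A]add0n big_addn; apply: le_trans (schur_sum (N - A)).
by rewrite le_eqVlt; apply/predU1P; left; apply: eq_big_nat => B BA; congr schur_weight;
  rewrite /ndist; lia.
Qed.

(** By 2 v_A v_B <= v_A^2 + v_B^2 and the symmetry of the weight, only its row sums matter, and
    these are at most 8. *)
Lemma schur_test (v : nat -> R) N :
  \sum_(0 <= A < N) \sum_(0 <= B < N) v A * v B * schur_weight (ndist A B) <=
  8 * \sum_(0 <= A < N) v A ^+ 2.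
Proof.
pose h A B := 2^-1 * (v A ^+ 2 * schur_weight (ndist A B)).
apply: (@le_trans _ _ (\sum_(0 <= A < N) \sum_(0 <= B < N) (h A B + h B A))).
  apply: ler_sum => A _; apply: ler_sum => B _; rewrite /h [ndist B A]ndistC.
  rewrite -mulrDr -mulrDl mulrA; apply: ler_wpM2r; first exact: schur_weight_ge0.
  have : 0 <= (v A - v B) ^+ 2 by rewrite sqr_ge0.
  rewrite sqrrB; lra.
under eq_bigr do rewrite big_split/=.
rewrite big_split/= [X in _ + X]exchange_big/= -mulr2n.
have row : \sum_(0 <= A < N) \sum_(0 <= B < N) h A B <= \sum_(0 <= A < N) 4 * v A ^+ 2.
  apply: ler_sum_nat => A /andP[_ AN]; rewrite /h -mulr_sumr -mulr_sumr.
  have := ler_wpM2l (sqr_ge0 (v A)) (schur_row AN); lra.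
rewrite -mulr_sumr in row; rewrite -mulr_natr; lra.
Qed.

(** For cells at distance d > 2, [fejer_decay] gives 2 N^2 / ((d - 1)^2 S), and N <= 3 S turns this
    into 18 S / (d - 1)^2. For closer cells the bound S is enough. The factor 8 is from
    [schur_test]. *)
Lemma fejer_mean_le S N L : 0 < S -> (0 < N)%N -> (0 < L)%N -> N%:R <= 3 * S ->
  fejer_mean S (energy_sum (N * L)) <= 18 * 8 * S * @Sigma R N.
Proof.
move=> S0 N0 L0 NS; rewrite fejer_mean_blocks// -sum_mesh_mass_sqr.
have N0' : 0 < N%:R :> R by rewrite ltr0n.
apply: (@le_trans _ _ (18 * S * \sum_(0 <= A < N) \sum_(0 <= B < N)
    mesh_mass N A * mesh_mass N B * schur_weight (ndist A B))); last first.
  have := schur_test (mesh_mass N) N; have S1 : 0 <= 18 * S by lra.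
  by move=> /(ler_wpM2l S1); rewrite !mulrA [18 * S * 8]mulrAC.
rewrite mulr_sumr; apply: ler_sum_nat => A /andP[_ AN].
rewrite mulr_sumr; apply: ler_sum_nat => B /andP[_ BN].
rewrite -(sum_mesh_mass_block A N0 L0) -(sum_mesh_mass_block B N0 L0) !mulr_suml mulr_sumr.
apply: ler_sum_nat => a /andP[_ aL].
rewrite mulr_sumr mulr_suml mulr_sumr; apply: ler_sum_nat => b /andP[_ bL].
rewrite [leRHS]mulrCA; apply: ler_wpM2l.
  by rewrite mulr_ge0// mesh_mass_ge0// mesh_lt.
rewrite /schur_weight.
have [d2|d2] := leqP (ndist A B) 2.
  have -> : maxn 1 (ndist A B).-1 = 1%N by apply/maxn_idPl; case: ndist d2 => [|[|[|]]].
  by rewrite expr1n invr1 mulr1; apply: (le_trans (fejer_le _ S0)); lra.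
have -> : maxn 1 (ndist A B).-1 = (ndist A B).-1 by apply/maxn_idPr; case: ndist d2 =>
  [|[|[|]]].
set d := (ndist A B).-1; have d0 : (0 < d)%N by rewrite /d; case: ndist d2 => [|[|[|]]].
have d0' : 0 < d%:R :> R by rewrite ltr0n.
have /andP[h1 h2] := mesh_block A N0 L0 (ltnW aL).
have /andP[h3 h4] := mesh_block B N0 L0 (ltnW bL).
set x := (A * L + a)%:R / _ in h1 h2 *; set y := (B * L + b)%:R / _ in h3 h4 *.
have xy : d%:R / N%:R <= `|x - y|.
  have [AB|BA] := leqP A B.
    have e : d%:R / N%:R = B%:R / N%:R - A.+1%:R / N%:R :> R.
      rewrite -mulrBl; congr (_ / _).
      by rewrite /d /ndist -natrB; [congr (_%:R); lia|rewrite /ndist in d2; lia].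
    by rewrite e distrC; apply: le_trans (ler_norm _); lra.
  have e : d%:R / N%:R = A%:R / N%:R - B.+1%:R / N%:R :> R.
    rewrite -mulrBl; congr (_ / _).
    by rewrite /d /ndist -natrB; [congr (_%:R); lia|rewrite /ndist in d2; lia].
  by rewrite e; apply: le_trans (ler_norm _); lra.
have dN0 : 0 < d%:R / N%:R :> R by rewrite divr_gt0.
have xy0 : x - y != 0 by rewrite -normr_gt0; apply: lt_le_trans xy.
apply: (le_trans (fejer_decay S0 xy0)).
have sq : (d%:R / N%:R) ^+ 2 <= (x - y) ^+ 2.
  rewrite -(real_normK (num_real (x - y))); apply: lerXn2r; rewrite ?nnegrE//.
have dN2 : 0 < (d%:R / N%:R) ^+ 2 :> R by rewrite exprn_gt0.
rewrite ler_pdivrMr; last by rewrite mulr_gt0// (lt_le_trans dN2).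
apply: (@le_trans _ _ (18 * S * d%:R ^- 2 * ((d%:R / N%:R) ^+ 2 * S))); last first.
  rewrite ler_wpM2l ?ler_wpM2r ?(ltW S0)// !mulr_ge0 ?invr_ge0 ?exprn_ge0// ltW//.
rewrite expr_div_n.
have -> : 18 * S * d%:R ^- 2 * (d%:R ^+ 2 / N%:R ^+ 2 * S) = 18 * S ^+ 2 / N%:R ^+ 2.
  by field; rewrite !gt_eqF.
rewrite ler_pdivlMr ?exprn_gt0//.
have : N%:R ^+ 2 <= (3 * S) ^+ 2 by apply: lerXn2r; rewrite ?nnegrE//; lra.
rewrite exprMn; lra.
Qed.

End fejer_means.

(** * From Fejer means to the integral over [-T, T] *)

Section mean_energy.
Context {R : realType}.
Implicit Types (S T : R) (N L : nat).

Lemma energy_integralE T : 0 < T ->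
  \int[lebesgue_measure]_(t in `[- T, T]) energy t =
  2 * \int[lebesgue_measure]_(t in `[0, T]) @energy R t.
Proof.
move=> T0; have cE := @continuous_energy R.
have split : `[- T, T]%classic = (`[- T, 0] `|` `]0, T])%classic :> set R.
  by rewrite (@itv_bndbnd_setU _ _ _ (BRight 0))// bnd_simp; lra.
rewrite split Rintegral_setU//; first last.
- rewrite disj_set2E; apply/eqP/seteqP; split=> // x [].
  by rewrite /= !in_itv/= => /andP[_ h] /andP[]; rewrite ltNge h.
- by rewrite -split; exact: continuous_integrable.
have -> : \int[lebesgue_measure]_(t in `[- T, 0]) @energy R t =
    \int[lebesgue_measure]_(t in `[0, T]) energy t.
  have := @integration_by_substitution_oppr R energy 0 T (ltW T0).
  rewrite oppr0 => h; rewrite /Rintegral h; last exact: continuous_subspaceT.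
  by congr fine; apply: eq_integral => t _; rewrite [LHS]/= energyN.
have -> : \int[lebesgue_measure]_(t in `]0, T]) @energy R t =
    \int[lebesgue_measure]_(t in `[0, T]) energy t.
  apply: Rintegral_itv_obnd_cbnd;
    apply: integrableS (@continuous_integrable R _ 0 T cE) => //.
  by move=> x; rewrite /= !in_itv/= => /andP[/ltW -> ->].
by ring.
Qed.

Lemma fejer_mean_le_integral S : 0 < S ->
  fejer_mean S (@energy R) <= \int[lebesgue_measure]_(t in `[0, S]) energy t.
Proof.
move=> S0; apply: le_Rintegral => //.
- by apply: continuous_integrable; apply: continuous_tentM; exact: continuous_energy.
- by apply: continuous_integrable; exact: continuous_energy.
move=> t; rewrite /= in_itv/= => tS; have /andP[h1 h2] := tent01 S0 tS.
by apply: ler_piMl => //; exact: energy_ge0.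
Qed.

(** The tent of width 2 T is at least 1/2 on [0, T], and the rest of its mean is nonnegative. *)
Lemma integral_le_fejer_mean T : 0 < T ->
  \int[lebesgue_measure]_(t in `[0, T]) energy t <= 2 * fejer_mean (2 * T) (@energy R).
Proof.
move=> T0; have S0 : 0 < 2 * T by lra.
have cE := @continuous_energy R; have cF := @continuous_tentM R (2 * T) _ cE.
have pos t : 0 <= t <= 2 * T -> 0 <= (1 - t / (2 * T)) * energy t.
  by move=> /(tent01 S0)/andP[h1 _]; rewrite mulr_ge0// energy_ge0.
have split : `[0, 2 * T]%classic = (`[0, T] `|` `]T, 2 * T])%classic :> set R.
  by rewrite (@itv_bndbnd_setU _ _ _ (BRight T))// bnd_simp; lra.
have -> : fejer_mean (2 * T) (@energy R) =
    \int[lebesgue_measure]_(t in `[0, T]) ((1 - t / (2 * T)) * energy t) +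
    \int[lebesgue_measure]_(t in `]T, 2 * T]) ((1 - t / (2 * T)) * energy t).
  rewrite /fejer_mean split Rintegral_setU//.
    by rewrite -split; exact: continuous_integrable.
  rewrite disj_set2E; apply/eqP/seteqP; split=> // x [].
  by rewrite /= !in_itv/= => /andP[_ h] /andP[]; rewrite ltNge h.
apply: (@le_trans _ _ (2 * \int[lebesgue_measure]_(t in `[0,
  T]) ((1 - t / (2 * T)) * energy t))).
  rewrite -RintegralZl//; last exact: continuous_integrable.
  apply: le_Rintegral => //; first exact: continuous_integrable.
    by apply: continuous_integrable => t; apply: cvgMl_tmp; exact: cF.
  move=> t; rewrite /= in_itv/= => /andP[t0 tT]; rewrite mulrA.
  apply: ler_peMl; first exact: energy_ge0.
  have : t / (2 * T) <= 2^-1 by rewrite ler_pdivrMr//; lra.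
  lra.
rewrite ler_pM2l// lerDl; apply: Rintegral_ge0 => t; rewrite /= in_itv/= => /andP[t1 t2].
by apply: pos; lra.
Qed.

Lemma fejer_mean_approx S N e : 0 < S -> (0 < N)%N -> 0 < e ->
  exists2 L, (0 < L)%N &
    `|fejer_mean S (@energy R) - fejer_mean S (energy_sum (N * L))| <= e.
Proof.
move=> S0 N0 e0; exists (Num.truncn (4 * S ^+ 2 / e)).+1 => //.
set L := _.+1.
have Lge : 4 * S ^+ 2 / e <= L%:R.
  have /truncn_itv/andP[_ /ltW//] : 0 <= 4 * S ^+ 2 / e.
  by rewrite divr_ge0 ?mulr_ge0 ?sqr_ge0// ltW.
have NL0 : (0 < N * L)%N by rewrite muln_gt0 N0.
have NL0' : 0 < (N * L)%:R :> R by rewrite ltr0n.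
apply: (le_trans (fejer_mean_dist S0 NL0)).
rewrite ler_pdivrMr//; move: Lge; rewrite ler_pdivrMr// => h.
apply: (le_trans h); rewrite mulrC ler_pM2l// ler_nat.
by rewrite leq_pmull.
Qed.

Lemma fejer_mean_Sigma_ge S N : 0 < S -> (0 < N)%N -> 2 * S <= N%:R -> 0 < @Sigma R N ->
  4^-1 * S * Sigma N <= fejer_mean S (@energy R).
Proof.
move=> S0 N0 SN P0; have N0' : 0 < N%:R :> R by rewrite ltr0n.
apply/ler_addgt0Pl => e e0.
have [L L0] := fejer_mean_approx S0 N0 e0; rewrite ler_norml => /andP[h1 _].
have h2 := fejer_mean_ge S0 N0 L0 SN.
have : 0 < S * Sigma N by rewrite mulr_gt0.
lra.
Qed.

Lemma fejer_mean_Sigma_le S N : 0 < S -> (0 < N)%N -> N%:R <= 3 * S ->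
  fejer_mean S (@energy R) <= 18 * 8 * S * Sigma N.
Proof.
move=> S0 N0 SN; apply/ler_addgt0Pl => e e0.
have [L L0] := fejer_mean_approx S0 N0 e0; rewrite ler_norml => /andP[_ h1].
have h2 := fejer_mean_le S0 N0 L0 SN.
lra.
Qed.

Lemma scale_between S : 1 <= S -> exists N, [/\ (0 < N)%N, 2 * S <= N%:R & N%:R <= 3 * S].
Proof.
move=> S1; exists (Num.truncn (2 * S)).+1.
have /andP[h1 h2] : (Num.truncn (2 * S))%:R <= 2 * S < (Num.truncn (2 * S)).+1%:R.
  by apply: truncn_itv; lra.
by split=> //; [exact: ltW|rewrite -natr1; lra].
Qed.

(** The lower bound uses the tent of width T and loses N^s <= 3 T^s; with the factor 2 of evenness
    and the 4^-1 of [fejer_mean_Sigma_ge] this is 6^-1. The upper bound uses the tent of width 2 T: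
    evenness and the tent give 2 * 2, and the width gives the last factor 2 next to 18 * 8. *)
Lemma mean_energy_asymp (s c C : R) : 0 <= s <= 1 -> 0 < c -> c <= C ->
  (forall N, (1 <= N)%N -> c * N%:R `^ (- s) <= Sigma N /\ Sigma N <= C * N%:R `^ (- s)) ->
  forall T, 1 <= T ->
    6^-1 * c * T `^ (1 - s) <= \int[lebesgue_measure]_(t in `[- T, T]) energy t /\
    \int[lebesgue_measure]_(t in `[- T, T]) energy t <= 4 * (18 * 8 * 2) * C * T `^ (1 - s).
Proof.
move=> s01 c0 cC hS T T1; have T0 : 0 < T by lra.
have C0 : 0 < C by lra.
rewrite energy_integralE//.
have p0 : 0 < T `^ (- s) by rewrite powR_gt0.
have -> : T `^ (1 - s) = T * T `^ (- s).
  by rewrite powRD; [rewrite powRr1 ?(ltW T0)|rewrite (gt_eqF T0) implybT].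
split.
  have [N [N0 N2 N3]] := scale_between T1.
  have [h1 _] := hS N N0.
  have N0' : 0 < N%:R :> R by rewrite ltr0n.
  have Np : 3^-1 * T `^ (- s) <= N%:R `^ (- s).
    rewrite !powRN -invfM lef_pV2 ?posrE ?mulr_gt0 ?powR_gt0//.
    apply: (@le_trans _ _ ((3 * T) `^ s)).
      by apply: ge0_ler_powR; rewrite ?nnegrE ?mulr_ge0 ?(ltW T0) ?(ltW N0')//; lra.
    rewrite powRM ?(ltW T0)// ler_wpM2r ?powR_ge0//.
    by rewrite -[leRHS]powRr1//; apply: ler_powR; lra.
  have P0 : 0 < @Sigma R N by apply: lt_le_trans h1; rewrite mulr_gt0// powR_gt0.
  have h2 := fejer_mean_Sigma_ge T0 N0 N2 P0.
  have h3 := fejer_mean_le_integral T0.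
  have h4 : 3^-1 * c * T `^ (- s) <= Sigma N.
    by apply: le_trans h1; rewrite [3^-1 * c]mulrC -mulrA ler_pM2l.
  have h5 := ler_wpM2l (ltW T0) h4.
  apply: (@le_trans _ _ (2 * (4^-1 * T * Sigma N))); last first.
    by rewrite ler_pM2l//; exact: le_trans h2 h3.
  have -> : 2 * (4^-1 * T * Sigma N) = 2^-1 * (T * Sigma N) by field.
  have -> : 6^-1 * c * (T * T `^ (- s)) = 2^-1 * (T * (3^-1 * c * T `^ (- s))) by field.
  by rewrite ler_pM2l.
have S1 : 1 <= 2 * T by lra.
have S0 : 0 < 2 * T by lra.
have [N [N0 N2 N3]] := scale_between S1.
have [_ h1] := hS N N0.
have N0' : 0 < N%:R :> R by rewrite ltr0n.
have Np : N%:R `^ (- s) <= T `^ (- s).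
  rewrite !powRN lef_pV2 ?posrE ?powR_gt0//.
  by apply: ge0_ler_powR; rewrite ?nnegrE ?(ltW T0) ?(ltW N0')//; lra.
have h2 := fejer_mean_Sigma_le S0 N0 N3.
have h3 := integral_le_fejer_mean T0.
have h4 : Sigma N <= C * T `^ (- s) by apply: (le_trans h1); rewrite ler_pM2l.
apply: (@le_trans _ _ (2 * (2 * (18 * 8 * (2 * T) * Sigma N)))).
  by rewrite ler_pM2l//; apply: (le_trans h3); rewrite ler_pM2l.
have -> : 2 * (2 * (18 * 8 * (2 * T) * Sigma N)) = 4 * (18 * 8 * 2) * (T * Sigma N) by ring.
have -> : 4 * (18 * 8 * 2) * C * (T * T `^ (- s)) = 4 * (18 * 8 * 2) * (T * (C * T `^ (-
  s))) by ring.
by rewrite ler_wpM2l ?mulr_ge0// ler_pM2l.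
Qed.

End mean_energy.

Theorem proposition1 (R : realType) :
  [/\ cvgn (@log_ratio R),
      exists! s : R, 0 < s < 1 /\ pressure s = 0,
      forall s : R, 0 < s < 1 -> pressure s = 0 -> D2 R = s,
      asymp [set N | (1 <= N)%N] (@Sigma R) (fun N => N%:R `^ (- D2 R))
    & asymp [set T : R | 1 <= T]
        (fun T => \int[lebesgue_measure]_(t in `[- T, T])
                    Normc.normc (minkq_fourier t) ^+ 2)
        (fun T => T `^ (1 - D2 R))].
Proof.
have [s s01 rs] := @growth_rate_eq1 R.
have s01' : 0 <= s <= 1 by lra.
have cs := log_ratio_cvg s01' rs.
have D2s : D2 R = s.
  by rewrite /D2 (cvg_lim _ cs) ?opprK//; exact: Rhausdorff.
have ps : pressure s = 0 by apply/(pressure_eq0 s01').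
have uniq u : 0 < u < 1 -> pressure u = 0 -> s = u.
  move=> /andP[/ltW u0 /ltW u1]; have u01' : 0 <= u <= 1 by rewrite u0.
  move=> /(pressure_eq0 u01') ru; case/andP: s01' => s0 s1.
  have [su|us|//] := ltgtP s u.
    by have := growth_rate_lt s0 su u1; rewrite rs ru ltxx.
  by have := growth_rate_lt u0 us s1; rewrite rs ru ltxx.
have [c [C [c0 cC hS]]] := Sigma_asymp s01' rs.
split.
- by apply/cvg_ex; exists (- s).
- by exists s; split=> [//|u [u01 pu]]; exact: uniq.
- by move=> u u01 pu; rewrite D2s; exact: uniq.
- exists c, C; split=> // N N1; rewrite D2s.
  by have [h1 h2] := hS N N1; rewrite h1 h2.
- exists (6^-1 * c), (4 * (18 * 8 * 2) * C); split.
  + by rewrite mulr_gt0.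
  + apply: (@le_trans _ _ c); first by rewrite ler_piMl ?(ltW c0)//; lra.
    by apply: (le_trans cC); rewrite ler_peMl ?(le_trans _ cC) ?(ltW c0)//; lra.
  move=> T T1; rewrite D2s.
  under eq_Rintegral do rewrite normc_minkq_fourier.
  by have [h1 h2] := mean_energy_asymp s01' c0 cC hS T1; rewrite h1 h2.
Qed.
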